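(* Let $(W_n)_{n\in\mathbb{Z}}$ be a stationary reversible Markov chain with Polish state space $\mathcal{W}$, transition function $Q$ and marginal distribution $\pi$. Let $g\in L_0^2(\pi)$, $X_k=g(W_k)$, $S_n=X_1+\cdots+X_n$, $\sigma_n^2=E(S_n^2)$ (with $\sigma_n\ge 0$), and define $\ell(n)$ by $\sigma_n^2=n\ell(n)$ for $n\ge1$. For $n,k\ge1$ let $$D_{n,k}=\bar V_ng(W_k)-Q\bar V_ng(W_{k-1}).$$ Suppose that $\ell$ is slowly varying (at infinity) and that there is a $\lambda\ge0$ for which $$\frac1{\sigma_n^2}\sum_{k=1}^nE\left(D_{n,k}^2\mid W_{k-1}\right)\to\lambda\quad\text{in probability}$$ and, for every $\epsilon>0$, $$\frac1{\sigma_n^2}\sum_{k=1}^nE\left(D_{n,k}^2\mathbf{1}_{\{|D_{n,k}|>\epsilon\sigma_n\}}\mid W_{k-1}\right)\to0\quad\text{in probability}.$$ Then the conditional distribution of $S_n/\sigma_n$ given $W_0$ converges in probability to the normal distribution with mean $0$ and variance $\lambda$.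
   Context: The chain is defined on a probability space $(\Omega,\mathcal{A},P)$; $\pi\{B\}=P[W_n\in B]$ and $Q(w;B)=P[W_{n+1}\in B\mid W_n=w]$ for all $n\in\mathbb{Z}$. Reversibility means $\int_A Q(w;B)\,\pi\{dw\}=\int_B Q(w;A)\,\pi\{dw\}$ for all Borel sets $A,B\subseteq\mathcal{W}$. $Q$ also denotes the operator $Qf(w)=\int_{\mathcal{W}} f(z)\,Q(w;dz)$, and $Q^k$ its $k$-th iterate; $V_n=I+Q+\cdots+Q^{n-1}$ and $\bar V_n=(V_1+\cdots+V_n)/n$. $L_0^2(\pi)=\{f\in L^2(\pi):\int_{\mathcal{W}} f\,d\pi=0\}$. Slow variation of $\ell$: $\ell(n)>0$ for all large $n$, and $\ell(\lfloor ax\rfloor)/\ell(\lfloor x\rfloor)\to1$ as $x\to\infty$ for every $a>0$ (so $\sigma_n>0$ for large $n$). For real random variables $Z_n$ and a distribution $G$ on $\mathbb{R}$, ''the conditional distribution of $Z_n$ given $W_0$ converges in probability to $G$'' means that $d(\mathcal{L}(Z_n\mid W_0),G)\to0$ in probability, where $\mathcal{L}(Z_n\mid W_0)$ is a regular conditional distribution and $d$ is a metric for weak convergence of probability measures on $\mathbb{R}$ (e.g. the Lévy metric). The normal distribution with mean $0$ and variance $0$ is the point mass at $0$. *)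

(* Defs.v *)
From HB Require Import structures.
From mathcomp Require Import all_boot all_order all_algebra.
From mathcomp Require Import all_classical all_reals all_analysis.
Set Implicit Arguments.
Unset Strict Implicit.
Unset Printing Implicit Defensive.
Import Order.TTheory GRing.Theory Num.Theory.
Import numFieldNormedType.Exports.
Local Open Scope classical_set_scope.
Local Open Scope ring_scope.

(* Separable and completely metrizable; completeness of [M] is expressed with
   Cauchy filters, as in the library's complete uniform spaces. *)
Definition polish (R : realType) (T : topologicalType) : Prop :=
  (exists2 S : set T, countable S & dense S) /\
  exists (M : metricType R) (f : T -> M) (h : M -> T),
    [/\ cancel f h, cancel h f, continuous f, continuous h &
        forall F : set_system M, ProperFilter F -> cauchy F ->
          exists x : M, F --> x].

Notation borel T := (g_sigma_algebraType (@open T)).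

Section conditional_expectation.
Context (R : realType) (d : measure_display) (Omega : measurableType d)
  (P : probability Omega R).

(* [Y] is a version of E(X | F), for an integrable [X] and a sigma-algebra [F]
   of measurable sets. *)
Definition is_cond_exp (F : set (set Omega)) (X Y : Omega -> R) : Prop :=
  [/\ forall B : set R, measurable B -> F (Y @^-1` B),
      P.-integrable setT (EFin \o Y) &
      forall A, F A ->
        (\int[P]_(w in A) (Y w)%:E = \int[P]_(w in A) (X w)%:E)%E].

(* [mu] is a regular conditional distribution of [Z] given [F]. *)
Definition is_cond_dist (F : set (set Omega)) (Z : Omega -> R)
    (mu : Omega -> probability (measurableTypeR R) R) : Prop :=
  forall B : set R, measurable B ->
    is_cond_exp F (\1_(Z @^-1` B)) (fun w => fine (mu w B)).

Definition cvg_in_prob (X : nat -> Omega -> R) (l : R) : Prop :=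
  forall e : R, 0 < e ->
    P [set w | e <= `|X n w - l|] @[n --> \oo] --> 0%E.

End conditional_expectation.

Section weak_convergence.
Context (R : realType).
Implicit Types mu nu : probability (measurableTypeR R) R.

Definition dist_fun mu (x : R) : R := fine (mu `]-oo, x]%classic).

(* The Levy metric. *)
Definition levy_dist mu nu : R :=
  inf [set e | 0 < e /\ forall x,
    dist_fun mu (x - e) - e <= dist_fun nu x <= dist_fun mu (x + e) + e].

(* [v] is the variance. The library's [normal_prob] takes the standard
   deviation, and for standard deviation 0 it is not the point mass. *)
Definition normal_law (m v : R) : probability (measurableTypeR R) R :=
  if v == 0 then (@dirac _ (measurableTypeR R) m R : probability (measurableTypeR R) R)
  else (normal_prob m (Num.sqrt v) : probability (measurableTypeR R) R).

Definition slowly_varying (l : nat -> R) : Prop :=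
  (\forall n \near \oo, 0 < l n) /\
  forall a : R, 0 < a ->
    l (Num.truncn (a * x)) / l (Num.truncn x) @[x --> +oo] --> (1 : R).

End weak_convergence.

Section markov_chain.
Context (R : realType) (d d' : measure_display) (Omega : measurableType d)
  (E : measurableType d') (P : probability Omega R)
  (W : int -> {RV P >-> E}) (pi : probability E R) (Q : R.-pker E ~> E).

Definition past (n : int) : set (set Omega) :=
  <<s \bigcup_(m in [set m : int | m <= n]) g_sigma_algebra_preimage (W m) >>.

Definition markov_chain : Prop :=
  forall (n : int) (B : set E), measurable B ->
    is_cond_exp P (past n) (\1_(W (n + 1) @^-1` B))
      (fun w => fine (Q (W n w) B)).

Definition stationary : Prop :=
  forall (n : int) (B : set E), measurable B -> P (W n @^-1` B) = pi B.

Definition reversible : Prop :=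
  forall A B : set E, measurable A -> measurable B ->
    (\int[pi]_(w in A) Q w B = \int[pi]_(w in B) Q w A)%E.

Definition L20 (g : E -> R) : Prop :=
  g \in Lfun pi 2%:E /\ \int[pi]_w g w = 0.

(* For [f] in L^2(pi), [kop f w] is the integral of [f] for pi-almost every
   [w]; where [f] is not [Q w]-integrable its value is immaterial. *)
Definition kop (f : E -> R) (w : E) : R := \int[Q w]_z f z.

Definition Vsum (n : nat) (f : E -> R) (w : E) : R :=
  \sum_(i < n) iter i kop f w.

Definition Vbar (n : nat) (f : E -> R) (w : E) : R :=
  (\sum_(1 <= i < n.+1) Vsum i f w) / n%:R.

Variable g : E -> R.

Definition Sn (n : nat) (w : Omega) : R :=
  \sum_(1 <= k < n.+1) g (W k%:Z w).

Definition sigma (n : nat) : R :=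
  Num.sqrt (fine 'E_P[fun w => Sn n w ^+ 2]).

Definition ell (n : nat) : R := sigma n ^+ 2 / n%:R.

Definition Dnk (n k : nat) (w : Omega) : R :=
  Vbar n g (W k%:Z w) - kop (Vbar n g) (W (k%:Z - 1) w).

End markov_chain.

(* Main.v *)
(* Since g = (I - Q) Vbar_n g + Q V_n g / n, the sum S_n is the sum of the
   martingale differences D_{n,k} up to a remainder R_n. Writing everything with
   the covariances <g, Q^m g>, reversibility gives
     2 |Q V_n g|^2 = sigma_{2n+1}^2 - 2 sigma_{n+1}^2 + sigma_1^2,
   which is o(sigma_n^2) when sigma_n^2 / n varies slowly; hence
   E R_n^2 = o(sigma_n^2), without spectral theory.

   For the martingale part, let u(T, x) = Phi((a - x) / sqrt T), the heat flow
   started from an indicator. Along the partial sums, with the conditional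
   variances as clock, u is almost a martingale. Therefore, uniformly over the
   events A of the past, E[1_A Phi((a - S_n / sigma_n) / delta)] is close to
   P(A) Phi(a / sqrt(delta^2 + lambda)). Choosing for A the event that the
   conditional distribution function of S_n / sigma_n deviates from the normal
   one at a given point shows that this event has small probability, and finitely
   many points control the Levy distance. *)
Require Import Defs.
From HB Require Import structures.
From mathcomp Require Import all_boot all_order all_algebra.
From mathcomp Require Import all_classical all_reals all_analysis.
From mathcomp Require Import measurable_realfun.
From mathcomp Require Import ring lra.
Set Implicit Arguments.
Unset Strict Implicit.
Unset Printing Implicit Defensive.
Import Order.TTheory GRing.Theory Num.Theory.
Import numFieldNormedType.Exports.
Local Open Scope classical_set_scope.
Local Open Scope ring_scope.

(** * Gaussian heat flow *)

Section gaussian.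
Context {R : realType}.
Implicit Types x y t : R.

(** Three obstacles shape the proof. The conditional variances and the Lindeberg sums are controlled
    only in probability, so the martingale is stopped by a predictable factor: once it is stopped,
    every error has a bound free of [n] and of the test event, and the stopping matters only on an
    event of small probability. Next, the conclusion concerns random laws, and the event on which
    they are bad changes with [n]; hence the estimates are uniform over the events of the past,
    which enter only as a bounded factor compatible with each conditional expectation. Finally
    [lambda] may be 0 and the limit a point mass; the flow runs down to time [dl ^+ 2] and never to
    0, which keeps its derivatives bounded and treats both cases at once. In the martingale
    approximation, R_n contains boundary terms Q Vbar_n g besides an average of Q V_n g along the
    path. Their size is a mean of |Q V_i g|^2 over all i <= n, and comparing it with sigma_n^2
    requires the variances to be almost monotone. Single steps may decrease them, so monotonicity is
    proved in steps of two. *)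

Definition ncdf (s x : R) : R := fine (normal_prob 0 s `]-oo, x]).

Definition npdf (x : R) : R := normal_pdf 0 1 x.

Lemma is_derive_ncdf s x : s != 0 -> is_derive x 1 (ncdf s) (normal_pdf 0 s x).
Proof.
move=> s0.
have int u : (@lebesgue_measure R).-integrable [set` Interval -oo%O (BRight u)]
    (EFin \o normal_pdf 0 s).
  by apply: integrableS (integrable_normal_pdf 0 s).
have xu : x < x + 1 by rewrite ltrDl.
have [] := continuous_FTC1 xu (int (x + 1)) (ltNyr _) (@continuous_normal_pdf R 0 s s0 x).
rewrite derive1E => dF F'; apply: DeriveDef; first exact: dF.
by rewrite -F'.
Qed.

Lemma npdfE x : npdf x = normal_peak 1 * expR (- (x ^+ 2 / 2)).
Proof.
rewrite /npdf /normal_pdf (negbTE (oner_neq0 R)) /normal_fun.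
by rewrite subr0 expr1n mulNr.
Qed.

Lemma npdf_ge0 x : 0 <= npdf x.
Proof. exact: normal_pdf_ge0. Qed.

Lemma is_derive_npdf x : is_derive x 1 npdf (- (x * npdf x)).
Proof.
rewrite [npdf](_ : _ = (fun x => normal_peak 1 * expR (- (x ^+ 2 / 2)))); last first.
  by apply/funext => z; rewrite npdfE.
have d1 : is_derive x 1 (fun x : R => - (x ^+ 2 / 2)) (- x).
  apply: is_derive_eq.
  by rewrite !scaler0 add0r /GRing.scale /=; field.
have d2 := is_derive1_comp (is_derive_expR _) d1.
have := is_deriveM (is_derive_cst (normal_peak 1) x 1) d2.
move=> d3; apply: is_derive_eq d3 _.
by rewrite /GRing.scale /=; ring.
Qed.

Definition npdf_bnd : R := 17 * normal_peak 1.

Lemma npdf_bnd_gt0 : 0 < npdf_bnd.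
Proof. by rewrite mulr_gt0// normal_peak_gt0// oner_neq0. Qed.

(** For [k <= 3], |x|^k <= 1 + x^4 <= 17 (1 + x^2/4)^2, and (1 + x^2/4)^2 <= exp(x^2/2) is the
    square of 1 + u <= exp u. Hence the 17 in [npdf_bnd], one constant for all powers up to the
    third. *)
Lemma pow_npdf_le k x : (k <= 3)%N -> `|x| ^+ k * npdf x <= npdf_bnd.
Proof.
move=> k3; rewrite npdfE mulrCA /npdf_bnd mulrC ler_pM2r; last first.
  by rewrite normal_peak_gt0// oner_neq0.
have e0 := expR_gt0 (x ^+ 2 / 2).
rewrite expRN ler_pdivrMr//.
have e1 : (1 + x ^+ 2 / 4) ^+ 2 <= expR (x ^+ 2 / 2).
  rewrite (_ : x ^+ 2 / 2 = 2%:R * (x ^+ 2 / 4)); last by field.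
  rewrite expRM_natl ler_sqr ?nnegrE ?expR_ge0// ?expR_ge1Dx//.
  by rewrite addr_ge0// divr_ge0// sqr_ge0.
have e2 : `|x| ^+ k <= 1 + `|x| ^+ 4.
  have [x1|x1] := leP `|x| 1.
    by rewrite (@le_trans _ _ 1) ?exprn_ile1// lerDl exprn_ge0.
  rewrite (@le_trans _ _ (`|x| ^+ 4))// ?ler_wpDl//.
  by rewrite ler_weXn2l// ?ltW// (leq_trans k3).
apply: (le_trans e2).
rewrite -normrX (ger0_norm (exprn_even_ge0 _ _))//.
have : 17 * (1 + x ^+ 2 / 4) ^+ 2 <= 17 * expR (x ^+ 2 / 2) by rewrite ler_pM2l.
apply: le_trans.
have := sqr_ge0 x; nra.
Qed.

(** The mean value theorem replaces integration of the bound on [f']: the exponent rises by one and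
    the constant stays [M], without a factor 1/(k + 1). Iteration yields the Taylor remainders
    below. *)
Lemma is_derive_growth (f f' : R -> R) M r k :
  (forall x, is_derive x 1 f (f' x)) -> f 0 = 0 ->
  (forall x, `|x| <= r -> `|f' x| <= M * `|x| ^+ k) ->
  forall x, `|x| <= r -> `|f x| <= M * `|x| ^+ k.+1.
Proof.
move=> df f0 f'M x xr.
have cf : continuous f.
  by move=> z; apply/differentiable_continuous/derivable1_diffP; have [] := df z.
have main c : `|c| <= `|x| -> `|f x| = `|f' c| * `|x| -> `|f x| <= M * `|x| ^+ k.+1.
  (* [M] is not assumed nonnegative. The bound at [c] forces its sign unless |c|^k vanishes, and
     then it forces [f' c = 0]. *)
  move=> cx ->; have M0 : 0 <= M \/ `|c| ^+ k = 0.
    have := f'M _ (le_trans cx xr); have := normr_ge0 (f' c).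
    have : 0 <= `|c| ^+ k by rewrite exprn_ge0.
    rewrite le_eqVlt => /predU1P[<-|c0]; first by right.
    by move=> h1 /(le_trans h1); rewrite pmulr_lge0//; left.
  have := f'M _ (le_trans cx xr).
  case: M0 => [M0|->].
    move=> h; rewrite exprSr mulrA ler_wpM2r// (le_trans h)// ler_wpM2l//.
    by rewrite lerXn2r ?nnegrE.
  rewrite mulr0 normr_le0 => /eqP ->; rewrite normr0 mul0r.
  have := f'M _ xr; have [->|x0] := eqVneq x 0; first by rewrite normr0 exprS mul0r mulr0.
  move=> /(le_trans (normr_ge0 _)); rewrite exprSr mulrA => h.
  by rewrite mulr_ge0.
have [x0|x0|x0] := ltgtP x 0; last by rewrite x0 f0 !normr0 exprS mul0r mulr0.
- have [c] := MVT x0 (fun z _ => df z) (continuous_subspaceT cf).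
  rewrite in_itv/= => /andP[xc c0]; rewrite f0 !sub0r => h.
  apply: (main c); first by rewrite !ltr0_norm ?lerN2 ?ltW.
  by rewrite -normrN h normrM normrN.
- have [c] := MVT x0 (fun z _ => df z) (continuous_subspaceT cf).
  rewrite in_itv/= => /andP[xc c0]; rewrite f0 !subr0 => h.
  apply: (main c); first by rewrite !gtr0_norm ?ltW.
  by rewrite h normrM.
Qed.

Definition Phi : R -> R := ncdf 1.

Lemma is_derive_Phi x : is_derive x 1 Phi (npdf x).
Proof. by apply: is_derive_ncdf; rewrite oner_neq0. Qed.

Lemma Phi_ge0 x : 0 <= Phi x.
Proof. by rewrite /Phi /ncdf fine_ge0. Qed.

Lemma Phi_le1 x : Phi x <= 1.
Proof. by rewrite -lee_fin fineK ?fin_num_measure// probability_le1. Qed.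

Lemma npdf_le x : npdf x <= npdf_bnd.
Proof. by have := @pow_npdf_le 0 x isT; rewrite expr0 mul1r. Qed.

Lemma is_derive_shift (f df : R -> R) (a b x : R) :
  (forall x, is_derive x 1 f (df x)) ->
  is_derive x 1 (fun t => f (a + b * t)) (b * df (a + b * x)).
Proof.
move=> fdf.
have d1 : is_derive x 1 (fun t : R => a + b * t) b.
  by apply: is_derive_eq; rewrite /GRing.scale /=; ring.
have := @is_derive1_comp _ f (fun t => a + b * t) _ _ _ (fdf (a + b * x)) d1.
by rewrite mulrC.
Qed.

Lemma is_derive_shift1 (f df : R -> R) (a x : R) :
  (forall x, is_derive x 1 f (df x)) ->
  is_derive x 1 (fun t => f (a + t)) (df (a + x)).
Proof.
move=> fdf; have := is_derive_shift a 1 x fdf; rewrite !mul1r.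
by under eq_fun do rewrite mul1r.
Qed.

Lemma Phi_taylor1 y t : `|Phi (y + t) - Phi y| <= npdf_bnd * `|t|.
Proof.
have d x : is_derive x 1 (fun t => Phi (y + t) - Phi y) (npdf (y + x)).
  have := is_derive_shift1 y x is_derive_Phi => h.
  by apply: is_derive_eq; rewrite /GRing.scale /=; ring.
rewrite -[X in _ <= _ * X]expr1.
apply: (is_derive_growth (r := `|t|) d) => //.
  by rewrite addr0 subrr.
by move=> x _; rewrite expr0 mulr1 ger0_norm ?npdf_ge0// npdf_le.
Qed.

Lemma npdf_deriv_le x : `|x * npdf x| <= npdf_bnd.
Proof.
rewrite normrM (ger0_norm (npdf_ge0 x)).
by have := @pow_npdf_le 1 x isT; rewrite expr1.
Qed.

Lemma npdf_deriv2_le x : `|(x ^+ 2 - 1) * npdf x| <= 2 * npdf_bnd.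
Proof.
rewrite normrM (ger0_norm (npdf_ge0 x)).
have := @pow_npdf_le 2 x isT; have := npdf_le x; have := npdf_ge0 x.
rewrite -normrX => h0 h1 h2.
apply: (@le_trans _ _ ((`|x ^+ 2| + 1) * npdf x)); last lra.
by rewrite ler_wpM2r// (le_trans (ler_normB _ _))// normr1.
Qed.

Lemma is_derive_dnpdf x : is_derive x 1 (fun x => - (x * npdf x)) ((x ^+ 2 - 1) * npdf x).
Proof.
have h := is_derive_npdf x.
by apply: is_derive_eq; rewrite /GRing.scale /=; ring.
Qed.

Lemma npdf_taylor1 y t : `|npdf (y + t) - npdf y| <= npdf_bnd * `|t|.
Proof.
have d x : is_derive x 1 (fun t => npdf (y + t) - npdf y)
    (- ((y + x) * npdf (y + x))).
  have := is_derive_shift1 y x is_derive_npdf => h.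
  by apply: is_derive_eq; rewrite /GRing.scale /=; ring.
rewrite -[X in _ <= _ * X]expr1.
apply: (is_derive_growth (r := `|t|) d) => //.
  by rewrite addr0 subrr.
by move=> x _; rewrite expr0 mulr1 normrN npdf_deriv_le.
Qed.

Lemma Phi_taylor2 y t : `|Phi (y + t) - Phi y - t * npdf y| <= npdf_bnd * `|t| ^+ 2.
Proof.
have d x : is_derive x 1 (fun t => Phi (y + t) - Phi y - t * npdf y)
    (npdf (y + x) - npdf y).
  have := is_derive_shift1 y x is_derive_Phi => h.
  by apply: is_derive_eq; rewrite /GRing.scale /=; ring.
apply: (is_derive_growth (r := `|t|) d) => //.
  by rewrite addr0 mul0r subrr subr0.
by move=> x _; rewrite expr1 npdf_taylor1.
Qed.

Lemma dnpdf_taylor1 y t :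
  `|- ((y + t) * npdf (y + t)) + y * npdf y| <= 2 * npdf_bnd * `|t|.
Proof.
have d x : is_derive x 1 (fun t => - ((y + t) * npdf (y + t)) + y * npdf y)
    (((y + x) ^+ 2 - 1) * npdf (y + x)).
  have := is_derive_shift1 y x is_derive_dnpdf => h.
  by apply: is_derive_eq; rewrite /GRing.scale /=; ring.
rewrite -[X in _ <= _ * X]expr1.
apply: (is_derive_growth (r := `|t|) d) => //.
  by rewrite addr0 addNr.
by move=> x _; rewrite expr0 mulr1 npdf_deriv2_le.
Qed.

Lemma npdf_taylor2 y t :
  `|npdf (y + t) - npdf y + t * (y * npdf y)| <= 2 * npdf_bnd * `|t| ^+ 2.
Proof.
have d x : is_derive x 1 (fun t => npdf (y + t) - npdf y + t * (y * npdf y))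
    (- ((y + x) * npdf (y + x)) + y * npdf y).
  have := is_derive_shift1 y x is_derive_npdf => h.
  by apply: is_derive_eq; rewrite /GRing.scale /=; ring.
apply: (is_derive_growth (r := `|t|) d) => //.
  by rewrite addr0 mul0r subrr addr0.
by move=> x _; rewrite expr1 dnpdf_taylor1.
Qed.

(** The [t]-derivative is the second-order remainder of [npdf], bounded in [npdf_taylor2]. The plus
    sign comes from Phi''(y) = - y npdf(y). *)
Lemma Phi_taylor3 y t :
  `|Phi (y + t) - Phi y - t * npdf y + t ^+ 2 / 2 * (y * npdf y)| <=
  2 * npdf_bnd * `|t| ^+ 3.
Proof.
have d x : is_derive x 1
    (fun t => Phi (y + t) - Phi y - t * npdf y + t ^+ 2 / 2 * (y * npdf y))
    (npdf (y + x) - npdf y + x * (y * npdf y)).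
  have := is_derive_shift1 y x is_derive_Phi => h.
  by apply: is_derive_eq; rewrite /GRing.scale /=; field.
apply: (is_derive_growth (r := `|t|) d) => //.
  by rewrite addr0 mul0r subrr expr0n/= !mul0r; ring.
by move=> x _; rewrite npdf_taylor2.
Qed.

(** The map t |-> Phi(y - y t) has second derivative - y^2 z npdf(z) at z = y (1 - t). For t between
    0 and 1 - r, 2 (1 - t)^2 >= 1 gives y^2 <= 2 z^2, so the bound on |z|^3 npdf(z) makes the
    estimate uniform in [y]. *)
Lemma Phi_scale y (r : R) : 0 < r -> r <= 1 -> 1 <= r ^+ 2 *+ 2 ->
  `|Phi (y * r) - Phi y + y * (1 - r) * npdf y| <= 2 * npdf_bnd * `|1 - r| ^+ 2.
Proof.
move=> r0 r1 r2.
have d1 x : is_derive x 1 (fun t => Phi (y + - y * t) - Phi y + y * t * npdf y)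
    (- y * npdf (y + - y * x) + y * npdf y).
  have := is_derive_shift y (- y) x is_derive_Phi => h.
  by apply: is_derive_eq; rewrite /GRing.scale /=; ring.
have d2 x : is_derive x 1 (fun t => - y * npdf (y + - y * t) + y * npdf y)
    (- y * (- y * - ((y + - y * x) * npdf (y + - y * x)))).
  have := is_derive_shift y (- y) x is_derive_npdf => h.
  by apply: is_derive_eq; rewrite /GRing.scale /=; ring.
have bnd2 x : `|x| <= `|1 - r| ->
    `|- y * (- y * - ((y + - y * x) * npdf (y + - y * x)))| <=
    2 * npdf_bnd * `|x| ^+ 0.
  move=> xr; have x2 : 1 <= (1 - x) ^+ 2 *+ 2.
    rewrite (le_trans r2)// lerMn2r/= ler_sqr ?nnegrE//; last first.
    - by move: xr; rewrite (ger0_norm (_ : 0 <= 1 - r)) ?subr_ge0//;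
        have := ler_norm x; lra.
    - exact: ltW.
    by move: xr; rewrite (ger0_norm (_ : 0 <= 1 - r)) ?subr_ge0//;
        have := ler_norm x; lra.
  set z := y + - y * x; rewrite expr0 mulr1.
  rewrite (_ : - y * _ = - (y ^+ 2 * z * npdf z)); last by ring.
  rewrite normrN 2!normrM (ger0_norm (npdf_ge0 z)) (ger0_norm (sqr_ge0 y)).
  have := @pow_npdf_le 3 z isT; rewrite exprS -normrX (ger0_norm (sqr_ge0 z)).
  have zE : z ^+ 2 = y ^+ 2 * (1 - x) ^+ 2 by rewrite /z; ring.
  have : y ^+ 2 <= z ^+ 2 * 2.
    by rewrite zE -mulrA mulr_natr ler_peMr ?sqr_ge0.
  have := normr_ge0 z; have := npdf_ge0 z; move: (npdf z) => p p0 z0 yz H.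
  have := ler_wpM2r (mulr_ge0 z0 p0) yz.
  by move: H; lra.
have b1 : forall x, `|x| <= `|1 - r| -> `|- y * npdf (y + - y * x) + y * npdf y| <= 2 * npdf_bnd * `|x| ^+ 1.
  by apply: is_derive_growth d2 _ bnd2; rewrite mulr0 addr0 mulNr addNr.
have := is_derive_growth d1 _ b1 (lexx _).
rewrite (_ : y + - y * (1 - r) = y * r); last by ring.
by apply; rewrite !mulr0 addr0 subrr mul0r addr0.
Qed.

(** In the heat flow [r] is the square root of T / (T + c), so that [r ^- 2 - 1] is c / T. If this
    exceeds 1, the trivial bounds on [Phi] suffice; otherwise [Phi_scale] applies and 1 - r is
    traded for half of c / T at a quadratic cost. *)
Lemma Phi_time_step y (r : R) : 0 < r -> r <= 1 ->
  `|Phi (y * r) - Phi y + (r ^- 2 - 1) / 2 * (y * npdf y)| <=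
  (1 + 4 * npdf_bnd) * (r ^- 2 - 1) ^+ 2.
Proof.
move=> r0 r1; set k := r ^- 2 - 1.
have B0 := npdf_bnd_gt0.
have yB := npdf_deriv_le y.
have k0 : 0 <= k by rewrite subr_ge0 invf_ge1 ?exprn_gt0// exprn_ile1// ltW.
have [k1|k1] := leP k 1; last first.
  have p1 := Phi_ge0 y; have p2 := Phi_le1 y.
  have p3 := Phi_ge0 (y * r); have p4 := Phi_le1 (y * r).
  apply: (le_trans (ler_normD _ _)).
  have h1 : `|Phi (y * r) - Phi y| <= 1 by rewrite ler_norml; lra.
  have h2 : `|k / 2 * (y * npdf y)| <= k / 2 * npdf_bnd.
    by rewrite normrM ger0_norm ?divr_ge0// ler_wpM2l// divr_ge0.
  have k2 : k <= k ^+ 2 by rewrite expr2 ler_peMr// ltW.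
  have h3 : npdf_bnd * k <= npdf_bnd * k ^+ 2 by rewrite ler_wpM2l// ltW.
  have h4 : 0 <= npdf_bnd * k by rewrite mulr_ge0// ltW.
  lra.
have rr : r ^+ 2 * r ^- 2 = 1 by rewrite divff// expf_neq0// gt_eqF.
have r2 : 1 <= r ^+ 2 *+ 2.
  rewrite -rr -mulr_natr ler_wpM2l ?sqr_ge0//.
  by move: k1; rewrite /k; lra.
have := Phi_scale y r0 r1 r2 => H.
have i1 : 1 <= r^-1 by rewrite invf_ge1.
have rn : r != 0 by rewrite gt_eqF.
have rn1 : 1 + r != 0 by rewrite gt_eqF// addr_gt0.
have kE : 1 - r = k * (r ^+ 2 / (1 + r)).
  by rewrite /k; field; rewrite ?rn ?rn1.
have d0 : 0 <= 1 - r by rewrite subr_ge0.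
have f1 : r ^+ 2 / (1 + r) <= 1.
  rewrite ler_pdivrMr ?addr_gt0// mul1r.
  by apply: (@le_trans _ _ 1); rewrite ?lerDl ?exprn_ile1// ltW.
have f0 : 0 <= r ^+ 2 / (1 + r) by rewrite divr_ge0 ?sqr_ge0// addr_ge0 ?ltW.
have dk : 1 - r <= k by rewrite kE ler_piMr.
have d2k : (1 - r) ^+ 2 <= k ^+ 2 by rewrite ler_sqr ?nnegrE.
have eE : k / 2 - (1 - r) = (1 - r) ^+ 2 * r ^- 2 * ((1 + 2 * r) / 2).
  by rewrite /k; field; rewrite ?rn.
have e1 : (1 - r) ^+ 2 * r ^- 2 <= k ^+ 2.
  rewrite kE exprMn -mulrA ler_piMr ?sqr_ge0//.
  rewrite (_ : _ * r ^- 2 = (r / (1 + r)) ^+ 2); last first.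
    by field; rewrite ?rn ?rn1.
  have rr0 : 0 <= r / (1 + r) by rewrite divr_ge0// ?addr_ge0// ltW.
  by rewrite exprn_ile1// ler_pdivrMr ?addr_gt0// mul1r lerDr.
have e0 : 0 <= (1 - r) ^+ 2 * r ^- 2.
  by rewrite mulr_ge0// ?sqr_ge0// invr_ge0 sqr_ge0.
have e2 : `|k / 2 - (1 - r)| <= k ^+ 2 * (3 / 2).
  rewrite eE ger0_norm; last by rewrite mulr_ge0// divr_ge0// addr_ge0// mulr_ge0// ltW.
  have q0 : 0 <= (1 + 2 * r) / 2 by lra.
  have q1 : (1 + 2 * r) / 2 <= 3 / 2 by lra.
  by rewrite ler_pM.
rewrite (_ : _ + _ = (Phi (y * r) - Phi y + y * (1 - r) * npdf y) + (k / 2 - (1 - r)) * (y * npdf y)); last by ring.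
apply: (le_trans (ler_normD _ _)); rewrite normrM.
have e3 : `|k / 2 - (1 - r)| * `|y * npdf y| <= (k ^+ 2 * (3 / 2)) * npdf_bnd.
  by rewrite ler_pM.
move: H; rewrite (ger0_norm d0) => H.
have : 2 * npdf_bnd * (1 - r) ^+ 2 <= 2 * npdf_bnd * k ^+ 2.
  by rewrite ler_wpM2l// mulr_ge0// ltW.
have : 0 <= k ^+ 2 by apply: sqr_ge0.
have : 0 <= npdf_bnd * k ^+ 2 by rewrite mulr_ge0 ?sqr_ge0// ltW.
lra.
Qed.

End gaussian.

(** * One-step estimates for the heat flow *)

Section heat_flow.
Context {R : realType}.
Implicit Types a T x y t c D dl : R.

(* [hflow a] solves the heat equation: [hx] is its first [x]-derivative, and
   [hxx] is both half its second [x]-derivative and its [T]-derivative. *)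
Definition hflow (a T x : R) : R := Phi ((a - x) / Num.sqrt T).

Definition hx (a T x : R) : R := - (npdf ((a - x) / Num.sqrt T) / Num.sqrt T).

Definition hxx (a T x : R) : R :=
  - ((a - x) / Num.sqrt T * npdf ((a - x) / Num.sqrt T) / (2 * T)).

Lemma hflow_ge0 a T x : 0 <= hflow a T x. Proof. exact: Phi_ge0. Qed.

Lemma hflow_le1 a T x : hflow a T x <= 1. Proof. exact: Phi_le1. Qed.

Lemma hflow_time a T x c : 0 < T -> 0 <= c ->
  `|hflow a (T + c) x - hflow a T x - c * hxx a T x| <=
  (1 + 4 * npdf_bnd) * (c / T) ^+ 2.
Proof.
move=> T0 c0; rewrite /hflow /hxx; set y := (a - x) / Num.sqrt T.
have Tc0 : 0 < T + c by rewrite ltr_wpDr.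
have sT0 : 0 < Num.sqrt T by rewrite sqrtr_gt0.
have sTc0 : 0 < Num.sqrt (T + c) by rewrite sqrtr_gt0.
pose r := Num.sqrt T / Num.sqrt (T + c).
have r0 : 0 < r by rewrite divr_gt0.
have r1 : r <= 1 by rewrite ler_pdivrMr// mul1r ler_sqrt ?lerDl// ltW.
have rE : r ^- 2 - 1 = c / T.
  rewrite /r exprMn exprVn !sqr_sqrtr ?ltW//.
  by field; rewrite !gt_eqF.
have yE : y * r = (a - x) / Num.sqrt (T + c).
  by rewrite /y /r; field; rewrite !gt_eqF.
have := Phi_time_step y r0 r1; rewrite rE yE.
apply: le_trans; rewrite le_eqVlt; apply/orP; left; apply/eqP.
congr Num.norm; rewrite -/y; field.
by rewrite !gt_eqF.
Qed.

Lemma hflow_time1 a T x c : 0 < T -> 0 <= c ->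
  `|hflow a (T + c) x - hflow a T x| <= (1 + 5 * npdf_bnd) * (c / T).
Proof.
move=> T0 c0.
have B0 := @npdf_bnd_gt0 R; set k := c / T.
have k0 : 0 <= k by rewrite divr_ge0// ltW.
have k20 : 0 <= k / 2 by lra.
have Bk : 0 <= npdf_bnd * k by rewrite mulr_ge0// ltW.
have [k1|k1] := leP k 1; last first.
  have := hflow_ge0 a T x; have := hflow_le1 a T x.
  have := hflow_ge0 a (T + c) x; have := hflow_le1 a (T + c) x.
  by move=> *; rewrite ler_norml; lra.
have H := hflow_time a x T0 c0.
have E : `|c * hxx a T x| <= npdf_bnd * k.
  rewrite /hxx; set y := _ / Num.sqrt T.
  rewrite (_ : c * _ = - (k / 2 * (y * npdf y))); last first.
    by rewrite /k; field; rewrite gt_eqF.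
  rewrite normrN normrM (ger0_norm k20).
  have : k / 2 * `|y * npdf y| <= k / 2 * npdf_bnd.
    exact: ler_wpM2l (npdf_deriv_le y).
  by lra.
have := ler_normD (hflow a (T + c) x - hflow a T x - c * hxx a T x) (c * hxx a T x).
rewrite subrK => h.
have k2 : k ^+ 2 <= k by rewrite expr2 ler_piMr.
have : npdf_bnd * k ^+ 2 <= npdf_bnd * k by rewrite ler_wpM2l// ltW.
move: H; rewrite -/k; lra.
Qed.

(** Time never falls below [dl ^+ 2], so (sqrt T)^-k is at most [dl ^- k]; one constant majorizes
    all the products that occur, with [k <= 4]. *)
Definition heat_cst (dl : R) : R :=
  (1 + 5 * npdf_bnd) * (1 + dl ^- 1 + dl ^- 2 + dl ^- 3 + dl ^- 4).

Lemma heat_cst_gt0 dl : 0 < dl -> 0 < heat_cst dl.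
Proof.
move=> d0; have B0 := @npdf_bnd_gt0 R.
have p j : 0 < dl ^- j by rewrite invr_gt0 exprn_gt0.
have := p 1%N; have := p 2%N; have := p 3%N; have := p 4%N => *.
by apply: mulr_gt0; lra.
Qed.

Lemma heat_cst_ge (b : R) dl k : 0 < dl -> (k <= 4)%N ->
  b <= 1 + 5 * npdf_bnd -> b * dl ^- k <= heat_cst dl.
Proof.
move=> d0 k4 b1; have B0 := @npdf_bnd_gt0 R.
have p j : 0 <= dl ^- j by rewrite invr_ge0 exprn_ge0// ltW.
apply: (@le_trans _ _ ((1 + 5 * npdf_bnd) * dl ^- k)); first by rewrite ler_wpM2r.
rewrite ler_wpM2l//; first by lra.
have := p 1%N; have := p 2%N; have := p 3%N; have := p 4%N.
by case: k k4 => [|[|[|[|[|//]]]]] _ *; rewrite ?expr0 ?invr1 ?expr1; lra.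
Qed.

Lemma sqrt_inv_le dl T k : 0 < dl -> dl ^+ 2 <= T ->
  (Num.sqrt T)^-1 ^+ k <= dl ^- k.
Proof.
move=> d0 dT; rewrite exprVn lef_pV2 ?posrE ?exprn_gt0// ?sqrtr_gt0; last first.
  by rewrite (lt_le_trans _ dT)// exprn_gt0.
rewrite lerXn2r// ?nnegrE ?sqrtr_ge0 ?(ltW d0)//.
have -> : dl = Num.sqrt (dl ^+ 2) by rewrite sqrtr_sqr ger0_norm// ltW.
by rewrite ler_wsqrtr.
Qed.

(** The heat equation lets the second-order term in space and the first-order term in time share the
    coefficient [hxx]. When [D] is a martingale difference with conditional variance [c], both
    subtracted terms have conditional mean zero. The minimum combines two Taylor bounds, the square
    for large jumps and the cube for small ones, as Lindeberg's condition requires. *)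
Lemma hflow_step a T x c D dl : 0 < dl -> dl ^+ 2 <= T -> 0 <= c ->
  `|hflow a T (x + D) - hflow a (T + c) x - D * hx a T x - (D ^+ 2 - c) * hxx a T x|
  <= heat_cst dl * (Num.min (D ^+ 2) (`|D| ^+ 3) + c ^+ 2).
Proof.
move=> d0 dT c0; have B0 := @npdf_bnd_gt0 R.
have T0 : 0 < T by rewrite (lt_le_trans _ dT)// exprn_gt0.
have sT0 : 0 < Num.sqrt T by rewrite sqrtr_gt0.
have H1 := hflow_time a x T0 c0.
have {}H1 : `|hflow a (T + c) x - hflow a T x - c * hxx a T x| <= heat_cst dl * c ^+ 2.
  apply: (le_trans H1).
  rewrite exprMn mulrCA mulrC ler_wpM2r ?sqr_ge0//.
  have -> : T^-1 ^+ 2 = (Num.sqrt T)^-1 ^+ 4.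
    by rewrite (exprM _ 2 2) [in RHS]exprVn sqr_sqrtr// ltW.
  apply: (@le_trans _ _ ((1 + 4 * npdf_bnd) * dl ^- 4)).
    by rewrite ler_wpM2l ?sqrt_inv_le//; lra.
  by apply: heat_cst_ge => //; lra.
set y := (a - x) / Num.sqrt T.
set e := - D / Num.sqrt T.
have H2 : `|hflow a T (x + D) - hflow a T x - D * hx a T x - D ^+ 2 * hxx a T x|
    <= heat_cst dl * Num.min (D ^+ 2) (`|D| ^+ 3).
  have -> : hflow a T (x + D) - hflow a T x - D * hx a T x - D ^+ 2 * hxx a T x
      = Phi (y + e) - Phi y - e * npdf y + e ^+ 2 / 2 * (y * npdf y).
    have -> : Phi (y + e) = hflow a T (x + D).
      by rewrite /hflow /y /e; congr Phi; field; rewrite gt_eqF.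
    rewrite /hflow /hx /hxx -/y /e (_ : 2 * T = 2 * Num.sqrt T ^+ 2); last first.
      by rewrite sqr_sqrtr// ltW.
    field.
    by rewrite gt_eqF.
  have eD k : `|e| ^+ k <= dl ^- k * `|D| ^+ k.
    rewrite /e normrM exprMn normrN mulrC ler_wpM2r ?exprn_ge0//.
    rewrite ger0_norm ?invr_ge0 ?(ltW sT0)//.
    exact: sqrt_inv_le.
  have Bp : 0 <= 2 * @npdf_bnd R by lra.
  rewrite -(ler_pdivrMl _ _ (heat_cst_gt0 d0)) le_min !ler_pdivrMl ?heat_cst_gt0//.
  apply/andP; split.
    have h2 := Phi_taylor2 y e.
    have h3 : `|e ^+ 2 / 2 * (y * npdf y)| <= `|e| ^+ 2 * (npdf_bnd / 2).
      rewrite normrM -normrX ger0_norm ?divr_ge0 ?sqr_ge0// (ger0_norm (sqr_ge0 e)).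
      by rewrite -mulrA ler_wpM2l ?sqr_ge0// mulrC ler_wpM2r ?npdf_deriv_le.
    apply: (le_trans (ler_normD _ _)); apply: (le_trans (lerD h2 h3)).
    have -> : npdf_bnd * `|e| ^+ 2 + `|e| ^+ 2 * (npdf_bnd / 2) = (3 / 2 * npdf_bnd) * `|e| ^+ 2.
      by field.
    apply: (@le_trans _ _ ((3 / 2 * npdf_bnd) * (dl ^- 2 * `|D| ^+ 2))).
      by rewrite ler_wpM2l//; lra.
    rewrite -normrX (ger0_norm (sqr_ge0 D)) mulrA ler_wpM2r ?sqr_ge0//.
    by apply: heat_cst_ge => //; lra.
  apply: (le_trans (Phi_taylor3 y e)).
  apply: (@le_trans _ _ ((2 * npdf_bnd) * (dl ^- 3 * `|D| ^+ 3))).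
    by rewrite ler_wpM2l.
  rewrite mulrA ler_wpM2r ?exprn_ge0//.
  by apply: heat_cst_ge => //; lra.
rewrite mulrDr; apply: le_trans (lerD H2 H1).
apply: le_trans (ler_normB _ _).
by rewrite le_eqVlt; apply/orP; left; apply/eqP; congr Num.norm; ring.
Qed.

Lemma hx_bnd a T x dl : 0 < dl -> dl ^+ 2 <= T -> `|hx a T x| <= heat_cst dl.
Proof.
move=> d0 dT; have B0 := @npdf_bnd_gt0 R.
rewrite /hx normrN normrM (ger0_norm (npdf_ge0 _)) ger0_norm ?invr_ge0 ?sqrtr_ge0//.
apply: (@le_trans _ _ (npdf_bnd * dl ^- 1)); last by apply: heat_cst_ge => //; lra.
rewrite ler_pM ?npdf_ge0 ?invr_ge0 ?sqrtr_ge0 ?npdf_le//.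
by have := sqrt_inv_le 1 d0 dT; rewrite expr1.
Qed.

Lemma hxx_bnd a T x dl : 0 < dl -> dl ^+ 2 <= T -> `|hxx a T x| <= heat_cst dl.
Proof.
move=> d0 dT; have B0 := @npdf_bnd_gt0 R.
have T0 : 0 < T by rewrite (lt_le_trans _ dT)// exprn_gt0.
rewrite /hxx normrN normrM invfM [X in _ * X]ger0_norm ?mulr_ge0 ?invr_ge0 ?(ltW T0)//.
apply: (@le_trans _ _ (npdf_bnd * dl ^- 2)); last by apply: heat_cst_ge => //; lra.
rewrite ler_pM ?normr_ge0 ?npdf_deriv_le ?mulr_ge0 ?invr_ge0 ?(ltW T0)//.
apply: (@le_trans _ _ T^-1).
  by rewrite ler_piMl ?invr_ge0 ?(ltW T0)// invf_le1// ler1n.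
by rewrite lef_pV2 ?posrE// exprn_gt0.
Qed.

Lemma hflow_lip a T x D dl : 0 < dl -> dl ^+ 2 <= T ->
  `|hflow a T (x + D) - hflow a T x| <= heat_cst dl * `|D|.
Proof.
move=> d0 dT; have B0 := @npdf_bnd_gt0 R.
have T0 : 0 < T by rewrite (lt_le_trans _ dT)// exprn_gt0.
have sT0 : 0 < Num.sqrt T by rewrite sqrtr_gt0.
have -> : hflow a T (x + D) = Phi ((a - x) / Num.sqrt T + - D / Num.sqrt T).
  by rewrite /hflow; congr Phi; field; rewrite gt_eqF.
apply: (le_trans (Phi_taylor1 _ _)).
rewrite normrM normrN mulrCA mulrC ler_wpM2r//.
apply: (@le_trans _ _ (npdf_bnd * dl ^- 1)); last by apply: heat_cst_ge => //; lra.
rewrite ler_pM2l// ger0_norm ?invr_ge0 ?(ltW sT0)//.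
by have := sqrt_inv_le 1 d0 dT; rewrite expr1.
Qed.

Lemma hflow_time_lip a T x c dl : 0 < dl -> dl ^+ 2 <= T -> 0 <= c ->
  `|hflow a (T + c) x - hflow a T x| <= heat_cst dl * c.
Proof.
move=> d0 dT c0; have B0 := @npdf_bnd_gt0 R.
have T0 : 0 < T by rewrite (lt_le_trans _ dT)// exprn_gt0.
apply: (le_trans (hflow_time1 a x T0 c0)).
rewrite mulrCA mulrC ler_wpM2r//.
apply: (@le_trans _ _ ((1 + 5 * npdf_bnd) * dl ^- 2)).
  rewrite ler_wpM2l; [by []|by lra|].
  by rewrite lef_pV2 ?posrE// exprn_gt0.
by apply: heat_cst_ge.
Qed.

End heat_flow.

(** * Distribution functions and Gaussian smoothing *)

Section distribution_functions.
Context {R : realType}.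
Implicit Types (mu nu : probability (measurableTypeR R) R) (x y h e b dl : R).

Lemma dist_fun_ge0 mu x : 0 <= dist_fun mu x.
Proof. by rewrite /dist_fun fine_ge0. Qed.

Lemma dist_fun_le1 mu x : dist_fun mu x <= 1.
Proof. by rewrite -lee_fin fineK ?fin_num_measure// probability_le1. Qed.

Lemma dist_fun_nd mu x y : x <= y -> dist_fun mu x <= dist_fun mu y.
Proof.
move=> xy; rewrite /dist_fun fine_le ?fin_num_measure//.
by rewrite le_measure ?inE//; exact: subitvPr.
Qed.

(** A law on the line is the distribution of the identity map, so the limits of [cdf] at both
    infinities become available for [dist_fun]. *)
Let idR : measurableTypeR R -> R := idfun.

#[local] HB.instance Definition _ :=
  @isMeasurableFun.Build _ _ _ _ idR (@measurable_id _ _ setT).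

Lemma dist_funNy mu e : 0 < e -> exists2 M, 0 < M & forall x, x <= - M -> dist_fun mu x <= e.
Proof.
move=> e0; have := @cvg_cdfNy0 _ _ R mu (idR : {RV mu >-> R}).
move/fine_cvgP => [_] /cvgrPdist_le /(_ _ e0) [M [_ HM]].
exists (`|M| + 1); first by rewrite ltr_pwDr.
move=> x xM; have /HM : x < M by have := ler_norm (- M); rewrite normrN; lra.
by rewrite sub0r normrN /= /cdf /distribution /pushforward preimage_id; apply: le_trans; rewrite ler_norm.
Qed.

Lemma dist_funy mu e : 0 < e -> exists2 M, 0 < M & forall x, M <= x -> 1 - e <= dist_fun mu x.
Proof.
move=> e0; have := @cvg_cdfy1 _ _ R mu (idR : {RV mu >-> R}).
move/fine_cvgP => [_] /cvgrPdist_le /(_ _ e0) [M [_ HM]].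
exists (`|M| + 1); first by rewrite ltr_pwDr.
move=> x xM; have /HM : M < x by have := ler_norm M; lra.
by rewrite /= /cdf /distribution /pushforward preimage_id ler_norml /dist_fun; lra.
Qed.

Lemma Phi_dist_fun x : Phi x = dist_fun (normal_prob 0 1 : probability (measurableTypeR R) R) x.
Proof. by []. Qed.

Lemma Phi_nd x y : x <= y -> Phi x <= Phi y.
Proof. by rewrite !Phi_dist_fun; exact: dist_fun_nd. Qed.

Lemma measurable_Phi : measurable_fun setT (@Phi R).
Proof. by apply: nondecreasing_measurable => // x y *; exact: Phi_nd. Qed.

Lemma measurable_npdf : measurable_fun setT (@npdf R).
Proof. exact: measurable_normal_pdf. Qed.

(** Both sides have the same derivative in [x], hence differ by a constant, which is 0 because both
    vanish at minus infinity. *)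
Lemma dist_fun_normal (v x : R) : 0 < v ->
  dist_fun (normal_law 0 v) x = Phi (x / Num.sqrt v).
Proof.
move=> v0; rewrite /normal_law gt_eqF//.
set s := Num.sqrt v; have s0 : 0 < s by rewrite sqrtr_gt0.
have -> : dist_fun (normal_prob 0 s : probability (measurableTypeR R) R) x = ncdf s x by [].
pose f y := ncdf s y - Phi (0 + s^-1 * y).
have df y : is_derive y 1 f 0.
  have d1 := @is_derive_ncdf R s y (lt0r_neq0 s0).
  have d2 := is_derive_shift 0 s^-1 y (@is_derive_Phi R).
  apply: is_derive_eq.
  rewrite add0r npdfE /normal_pdf (gt_eqF s0) /normal_fun /normal_peak subr0.
  rewrite expr1n mul1r -mulrnAr sqrtrM ?sqr_ge0// sqrtr_sqr (gtr0_norm s0).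
  rewrite (_ : - y ^+ 2 / (s ^+ 2 *+ 2) = - ((s^-1 * y) ^+ 2 / 2)); last first.
    by rewrite -mulr_natr; field; rewrite gt_eqF.
  rewrite invfM mulrA subrr//.
have fc y z : f y = f z.
  wlog yz : y z / y < z => [H|].
    by have [/H|/H|->] := ltgtP y z.
  have cf : continuous f.
    by move=> t; apply/differentiable_continuous/derivable1_diffP; have [] := df t.
  have [c _] := MVT yz (fun z _ => df z) (continuous_subspaceT cf).
  by rewrite mul0r => /eqP; rewrite subr_eq0 => /eqP ->.
have f0 : f x = 0.
  apply/eqP; rewrite -normr_eq0; apply/eqP/le_anti; rewrite normr_ge0 andbT.
  apply/ler_addgt0Pr => e e0; rewrite add0r.
  have e20 : 0 < e / 2 by rewrite divr_gt0.
  have [M M0 HM] := dist_funNy (normal_prob 0 s : probability (measurableTypeR R) R) e20.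
  have [N N0 HN] := dist_funNy (normal_prob 0 1 : probability (measurableTypeR R) R) e20.
  (* Far enough to the left for both functions: y <= - M and y / s <= - N. *)
  pose y := - (M + s * N).
  have h1 : ncdf s y <= e / 2.
    by apply: HM; rewrite lerN2 lerDl mulr_ge0// ltW.
  have h2 : Phi (0 + s^-1 * y) <= e / 2.
    apply: HN; rewrite add0r /y mulrN lerN2 mulrDr mulKf ?gt_eqF//.
    by rewrite lerDr mulr_ge0 ?invr_ge0 ?ltW.
  have h3 : 0 <= ncdf s y := dist_fun_ge0 _ _.
  have h4 := @Phi_ge0 R (0 + s^-1 * y).
  by rewrite (fc x y) ler_norml /f; lra.
by move: f0; rewrite /f add0r mulrC => /eqP; rewrite subr_eq0 => /eqP.
Qed.

Lemma dist_fun_dirac (x : R) : dist_fun (normal_law 0 0) x = (0 <= x)%R%:R.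
Proof.
rewrite /normal_law eqxx /dist_fun/= /dirac indicE/=.
by congr (nat_of_bool _)%:R; apply/idP/idP; rewrite inE/= in_itv.
Qed.

(** The scale [dl] serves two ends: a Gaussian of standard deviation [dl] rarely exceeds [h], and
    adding its variance to [v] hardly changes the law. For [v = 0] the shift by [h] absorbs the jump
    of the point mass; for [v > 0] the change of value is bounded by [hflow_time1]. *)
Lemma normal_smoothing (v h e b : R) : 0 <= v -> 0 < h -> 0 < e ->
  exists dl, [/\ 0 < dl, Phi (- h / dl) <= e, 1 - e <= Phi (h / dl) &
     dist_fun (normal_law 0 v) (b - h) - e <= Phi (b / Num.sqrt (dl ^+ 2 + v)) <=
     dist_fun (normal_law 0 v) (b + h) + e].
Proof.
move=> v0 h0 e0.
have [M M0 HM] := dist_funNy (normal_prob 0 1 : probability (measurableTypeR R) R) e0.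
have [N N0 HN] := dist_funy (normal_prob 0 1 : probability (measurableTypeR R) R) e0.
have B0 := @npdf_bnd_gt0 R.
pose C : R := 1 + 5 * npdf_bnd.
have C0 : 0 < C by rewrite /C; lra.
(* [h / (M + N)] puts h / dl beyond both tail thresholds; [dl <= 1] and [dl <= e * v / C] give C
   dl^2 / v <= e. *)
pose dl := Num.min 1 (Num.min (h / (M + N)) (if v == 0 then 1 else e * v / C)).
have dl0 : 0 < dl.
  rewrite !lt_min ltr01/= divr_gt0 ?addr_gt0//=.
  case: eqVneq => // vn; rewrite divr_gt0// mulr_gt0// lt_neqAle eq_sym vn//.
have hdl : M + N <= h / dl.
  rewrite ler_pdivlMr// mulrC -ler_pdivlMr ?addr_gt0//.
  by rewrite !ge_min lexx orbT.
have p1 : Phi (- h / dl) <= e by apply: HM; rewrite mulNr lerN2; lra.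
have p2 : 1 - e <= Phi (h / dl) by apply: HN; lra.
exists dl; split => //.
have [v00|vn] := eqVneq v 0.
  rewrite v00 !dist_fun_dirac addr0 sqrtr_sqr gtr0_norm//.
  have := Phi_ge0 (b / dl); have := Phi_le1 (b / dl).
  have [bh|bh] := leP 0 (b + h); have [bh'|bh'] := leP 0 (b - h) => /=;
    rewrite ?mulr1n ?mulr0n => *; apply/andP; split; try lra.
  - suff : Phi (h / dl) <= Phi (b / dl) by lra.
    by apply: Phi_nd; rewrite ler_pM2r ?invr_gt0//; lra.
  - suff : Phi (b / dl) <= Phi (- h / dl) by lra.
    by apply: Phi_nd; rewrite ler_pM2r ?invr_gt0//; lra.
have vp : 0 < v by rewrite lt_neqAle eq_sym vn.
have dlv : dl <= e * v / C.
  by rewrite !ge_min (negbTE vn) lexx !orbT.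
have dl1 : dl <= 1 by rewrite ge_min lexx.
have H : `|Phi (b / Num.sqrt (dl ^+ 2 + v)) - Phi (b / Num.sqrt v)| <= e.
  have := hflow_time1 b 0 vp (sqr_ge0 dl).
  rewrite /hflow subr0 [v + _]addrC => /le_trans; apply.
  rewrite -/C mulrC -ler_pdivlMr// ler_pdivrMr//.
  rewrite -mulrA [_^-1 * _]mulrC mulrA (le_trans _ dlv)// expr2 ler_piMl// ltW//.
have := dist_fun_nd (normal_law 0 v) (_ : b - h <= b).
have := dist_fun_nd (normal_law 0 v) (_ : b <= b + h).
rewrite (dist_fun_normal b)// => h1 h2.
have {}h1 := h1 ltac:(lra); have {}h2 := h2 ltac:(lra).
by move: H; rewrite ler_norml; lra.
Qed.

End distribution_functions.

(** * Slow variation *)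

Section slow_variation.
Context {R : realType}.
(** To be read with [s n] = E(S_n^2), [q n] = |Q V_n g|^2 and [c0] = E(X_1^2). *)
Variables (s q : nat -> R) (c0 : R).
Hypothesis slow : slowly_varying (fun n => s n / n%:R).
Hypothesis s_ge0 : forall n, 0 <= s n.
Hypothesis s_step2 : forall n, s n <= s n.+2.
Hypothesis s_step1 : forall n (h : R), 0 < h -> s n.+1 <= (1 + h) * s n + (1 + h^-1) * c0.
Hypothesis c0_ge0 : 0 <= c0.
Hypothesis qE : forall n, q n = (s n.*2.+1 - 2 * s n.+1 + s 1%N) / 2.

Lemma slow_gt0 : exists N, forall n, (N <= n)%N -> 0 < s n.
Proof.
have [[N _ HN] _] := slow; exists N.+1 => n Nn.
have n0 : (0 < n)%N by apply: leq_trans Nn.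
have /HN : (N <= n)%N by rewrite ltnW.
by move=> /=; rewrite pmulr_lgt0// invr_gt0 ltr0n.
Qed.

Lemma slow_ratio (e : R) : 0 < e -> exists N, forall n (j : bool), (N <= n)%N ->
  `|s (j + n.*2)%N / (j + n.*2)%:R / (s n / n%:R) - 1| <= e.
Proof.
move=> e0; have [_ /(_ 2 (ltr0n _ 2))] := slow.
move=> /cvgrPdist_le /(_ e e0) [M [_ HM]].
exists (Num.truncn `|M|).+1 => n j Nn.
have Mn : M < n%:R.
  rewrite (le_lt_trans (ler_norm _))// (lt_le_trans (truncnS_gt _))//.
  by rewrite ler_nat.
(* Slow variation is stated for real arguments: at n + j/2 the integer part of 2x is 2n + j and that
   of x is n, so the single ratio a = 2 reaches both parities. *)
pose x : R := n%:R + j%:R / 2.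
have j0 : 0 <= (j%:R : R) by [].
have j1 : (j%:R : R) <= 1 by rewrite lern1; case: (j).
have /HM : M < x by rewrite /x; lra.
have -> : Num.truncn (2 * x) = (j + n.*2)%N.
  have -> : 2 * x = (j + n.*2)%:R by rewrite /x natrD -mul2n natrM; field.
  by rewrite natrK.
have -> : Num.truncn x = n.
  by apply/truncn_def; rewrite /x -[n.+1%:R]natr1; lra.
by rewrite distrC.
Qed.

Lemma slow_double_le (e : R) : 0 < e -> exists N, forall n, (N <= n)%N ->
  s n.*2.+1 <= (2 + e) * s n.
Proof.
(* The factor is at most (1 + d) (2 + 1/n) with 1/n <= d, and (1 + d) (2 + d) <= 2 + 4 d <= 2 + e
   since [d <= 1]. *)
move=> e0; pose d : R := Num.min 1 (e / 4).
have d0 : 0 < d by rewrite lt_min ltr01 divr_gt0.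
have [N1 H1] := slow_gt0; have [N2 H2] := slow_ratio d0.
pose N3 := (Num.truncn d^-1).+1.
exists (maxn N1 (maxn N2 N3)).+1 => n; rewrite !gtn_max => /and3P[n1 n2 n3].
have sn := H1 n (ltnW n1); have := H2 n true (ltnW n2).
have nd : d^-1 < n%:R.
  by rewrite (lt_le_trans (truncnS_gt _))// ler_nat ltnW.
have n0 : 0 < n%:R :> R by rewrite (lt_trans _ nd)// invr_gt0.
have nd1 : 1 <= d * n%:R by rewrite mulrC -ler_pdivrMr// mul1r ltW.
rewrite add1n ler_norml lerBlDl => /andP[_].
rewrite ler_pdivrMr ?divr_gt0// ler_pdivrMr ?ltr0n// => /le_trans; apply.
rewrite (_ : _ * _ * _ = ((1 + d) * (n.*2.+1)%:R / n%:R) * s n); last first.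
  by field; rewrite gt_eqF.
rewrite ler_wpM2r ?(ltW sn)// ler_pdivrMr// -[_.+1%:R]natr1 -mul2n natrM.
have d1 : d <= 1 by rewrite ge_min lexx.
have d4 : d <= e / 4 by rewrite ge_min lexx orbT.
have : d * n%:R <= e / 4 * n%:R by rewrite ler_pM2r.
have : d * d * n%:R <= d * n%:R by rewrite ler_pM2r// ler_piMl// ltW.
nra.
Qed.

Lemma slow_double_ge : exists N, forall n (j : bool), (N <= n)%N ->
  3 / 2 * s n <= s (j + n.*2)%N.
Proof.
have [N1 H1] := slow_gt0; have q0 : 0 < 1 / 4 :> R by lra.
have [N2 H2] := slow_ratio q0.
exists (maxn N1 N2).+1 => n j; rewrite !gtn_max => /andP[n1 n2].
have sn := H1 n (ltnW n1); have := H2 n j (ltnW n2).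
have n0 : 0 < n%:R :> R by rewrite ltr0n (leq_trans _ n1).
have m0 : 0 < (j + n.*2)%:R :> R.
  by rewrite ltr0n addn_gt0 double_gt0 (leq_trans _ n1) ?orbT.
rewrite ler_norml => /andP[+ _]; rewrite lerBrDl.
rewrite ler_pdivlMr ?divr_gt0// ler_pdivlMr//; apply: le_trans.
rewrite [leRHS](_ : _ = (1 + - (1 / 4)) * ((j + n.*2)%:R / n%:R) * s n); last first.
  by field; rewrite gt_eqF.
rewrite ler_wpM2r ?(ltW sn)//.
have : 2 <= (j + n.*2)%:R / n%:R :> R.
  by rewrite ler_pdivlMr// -natrM ler_nat mul2n leq_addl.
by lra.
Qed.

Lemma slow_le_max m n : (m <= n)%N -> s m <= Num.max (s n) (s n.+1).
Proof.
move=> /subnK <-; elim: (n - m)%N => [|k IH]; first by rewrite add0n le_max lexx.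
apply: (le_trans IH); rewrite addSn ge_max !le_max.
by rewrite s_step2 lexx orbT.
Qed.

Lemma slow_cvgy K : exists N, forall n, (N <= n)%N -> K <= s n.
Proof.
have [N1 H1] := slow_gt0; have [N2 H2] := slow_double_ge.
pose N := (maxn N1 N2).+1.
have [N1N N2N] : (N1 <= N)%N /\ (N2 <= N)%N.
  by split; rewrite leqW// leq_max leqnn ?orbT.
pose a := s N; have a0 : 0 < a by apply: H1.
(* Two neighbouring indices are tracked, so that steps of two carry the bound to all later indices
   of either parity. Doubling the index multiplies [s] by at least 3/2, which raises 1 + k/2 by at
   least 1/2. *)
have main k : exists m, (N <= m)%N /\ (1 + k%:R / 2) * a <= s m /\ (1 + k%:R / 2) * a <= s m.+1.
  elim: k => [|k [m [Nm [h1 h2]]]].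
    exists N.*2; split; first by rewrite -addnn leq_addr.
    have := H2 N false N2N; have := H2 N true N2N.
    by rewrite add0n add1n -/a => *; split; lra.
  have N2m : (N2 <= m)%N by apply: leq_trans Nm.
  exists m.*2; split; first by rewrite -addnn (leq_trans Nm)// leq_addr.
  have := H2 m false N2m; have := H2 m true N2m.
  rewrite add0n add1n -[k.+1%:R]natr1 => *.
  have k0 : 0 <= k%:R * a by rewrite mulr_ge0 ?ler0n// ltW.
  by split; lra.
have [m [_ [h1 h2]]] := main (Num.truncn (2 * `|K| / a)).+1.
exists m => n mn.
apply: (@le_trans _ _ ((1 + (Num.truncn (2 * `|K| / a)).+1%:R / 2) * a)).
  have := truncnS_gt (2 * `|K| / a); rewrite ltr_pdivrMr//.
  by have := ler_norm K; lra.
rewrite -(subnK mn) -{1}[(n - m)%N]odd_double_half.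
elim: (_./2) => [|k IH]; first by case: odd; rewrite ?add0n ?add1n.
by rewrite doubleS !addnS !addSn; apply: (le_trans IH (s_step2 _)).
Qed.

(** Slow variation bounds s_{2n+1} above by (2 + e/2) s_n. The lower bound for s_{n+1} comes from
    s_n <= s_{n+2} <= (1 + h) s_{n+1} + const. Additive constants are absorbed because [s] tends to
    infinity. *)
Lemma slow_remainder (e : R) : 0 < e ->
  exists N, forall n, (N <= n)%N -> q n <= e * s n.
Proof.
move=> e0; pose h := Num.min 1 (e / 4).
have h0 : 0 < h by rewrite lt_min ltr01/= divr_gt0.
have h1 : h <= 1 by rewrite ge_min lexx.
have he : h <= e / 4 by rewrite ge_min lexx orbT.
have e2 : 0 < e / 2 by rewrite divr_gt0.
have [N1 H1] := slow_double_le e2.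
have [N2 H2] := slow_cvgy ((2 * (1 + h^-1) * c0 + s 1%N) / e).
exists (maxn N1 N2) => n; rewrite geq_max => /andP[n1 n2].
have := H1 _ n1; have := H2 _ n2; rewrite ler_pdivrMr// => k1 k2.
have k3 : s n <= (1 + h) * s n.+1 + (1 + h^-1) * c0.
  exact: le_trans (s_step2 n) (s_step1 _ h0).
have k4 : (1 - h) * s n <= s n.+1 + (1 + h^-1) * c0.
  have i0 : 0 <= (1 + h^-1) * c0 by rewrite mulr_ge0// addr_ge0// invr_ge0 ltW.
  have : (1 - h) * s n <= (1 - h) * ((1 + h) * s n.+1 + (1 + h^-1) * c0).
    by rewrite ler_wpM2l// subr_ge0.
  have : 0 <= h * h * s n.+1 by rewrite !mulr_ge0// ltW.
  have : 0 <= h * ((1 + h^-1) * c0) by rewrite mulr_ge0// ltW.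
  by move: ((1 + h^-1) * c0) i0 => z; nra.
have k5 : h * s n <= e / 4 * s n by rewrite ler_wpM2r.
by rewrite qE; lra.
Qed.

(** For every [i], q_i <= (e/4) s_i + K, where [K] takes care of the finitely many small indices.
    For i <= n, [slow_le_max] and [s_step1] with [h = 1] bound s_i by 2 s_n + 2 c0, so each term of
    the average is already below e s_n. *)
Lemma slow_remainder_avg (e : R) : 0 < e -> exists N, forall n, (N <= n)%N ->
  (\sum_(1 <= i < n.+1) q i) / n%:R <= e * s n.
Proof.
move=> e0; have e3 : 0 < e / 4 by rewrite divr_gt0.
have [N1 H1] := slow_remainder e3.
pose K : R := \sum_(i < N1) `|q i|.
have K0 : 0 <= K by apply: sumr_ge0.
have qK i : q i <= e / 4 * s i + K.
  have [N1i|iN1] := leqP N1 i; first by rewrite (le_trans (H1 _ N1i))// lerDl.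
  have es := mulr_ge0 (ltW e3) (s_ge0 i).
  rewrite (@le_trans _ _ K)// ?lerDr//.
  rewrite /K (bigD1 (Ordinal iN1))//= (le_trans (ler_norm _))// lerDl.
  by apply: sumr_ge0 => *.
have [N2 H2] := slow_cvgy ((e / 4 * (2 * c0) + K) * 2 / e).
exists N2.+1 => n nN2; have := H2 _ (ltnW nN2).
have n0 : 0 < n%:R :> R by rewrite ltr0n (leq_trans _ nN2).
rewrite ler_pdivrMr// ler_pdivrMr// => k1.
have qn i : (i <= n)%N -> q i <= e * s n.
  move=> /slow_le_max; have := s_step1 n (ltr01 : 0 < 1 :> R); rewrite invr1 => a1 a2.
  have : s i <= 2 * s n + 2 * c0.
    have := s_ge0 n => sn0; have c00 := c0_ge0.
    by apply: (le_trans a2); rewrite ge_max; apply/andP; split; lra.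
  move=> /(ler_wpM2l (ltW e3)); have := qK i; lra.
apply: (@le_trans _ _ (\sum_(1 <= i < n.+1) e * s n)); last first.
  by rewrite sumr_const_nat subn1/= mulr_natr.
rewrite big_nat [leRHS]big_nat; apply: ler_sum => i /andP[_ i1].
exact: qn.
Qed.

End slow_variation.

(** * Integrals on a probability space *)

Notation intg mu f := (mu.-integrable setT (EFin \o f)).

Section integrals.
Context {R : realType} {d : measure_display} {T : measurableType d}.
Variable mu : probability T R.
Implicit Types (f g h : T -> R) (A : set T) (K : R).

Lemma intg_measurable f : intg mu f -> measurable_fun setT f.
Proof. by move=> /integrableP[/measurable_EFinP]. Qed.

Lemma intg_le f g : measurable_fun setT f -> intg mu g ->
  (forall x, `|f x| <= `|g x|) -> intg mu f.
Proof.
move=> mf ig fg; apply: le_integrable ig => //; first exact/measurable_EFinP.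
by move=> x _; rewrite /= lee_fin.
Qed.

Lemma measurable_preimT f (B : set R) : measurable_fun setT f -> measurable B ->
  measurable (f @^-1` B).
Proof. by move=> mf mB; rewrite -[X in measurable X]setTI; exact: mf. Qed.

Lemma measurable_lt_norm f K : measurable_fun setT f -> measurable [set x | K < `|f x|].
Proof.
move=> mf; rewrite (_ : [set _ | _] = (fun y => `|f y|) @^-1` `]K, +oo[%classic).
  by apply: measurable_preimT => //; exact: measurableT_comp.
by apply/seteqP; split => y /=; rewrite in_itv/= andbT.
Qed.

Lemma measurable_le_norm f K : measurable_fun setT f -> measurable [set x | K <= `|f x|].
Proof.
move=> mf; rewrite (_ : [set _ | _] = (fun y => `|f y|) @^-1` `[K, +oo[%classic).
  by apply: measurable_preimT => //; exact: measurableT_comp.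
by apply/seteqP; split => y /=; rewrite in_itv/= andbT.
Qed.

Lemma intg_cst K : intg mu (cst K).
Proof. exact: finite_measure_integrable_cst. Qed.

Lemma intg_bnd f K : measurable_fun setT f -> (forall x, `|f x| <= K) -> intg mu f.
Proof.
move=> mf fK; apply: (intg_le mf (intg_cst K)) => x.
by rewrite (le_trans (fK x))// ler_norm.
Qed.

Lemma intgD f g : intg mu f -> intg mu g -> intg mu (fun x => f x + g x).
Proof. by move=> hf hg; have := integrableD measurableT hf hg. Qed.

Lemma intgB f g : intg mu f -> intg mu g -> intg mu (fun x => f x - g x).
Proof. by move=> hf hg; have := integrableB measurableT hf hg. Qed.

Lemma intgZ K f : intg mu f -> intg mu (fun x => K * f x).
Proof. by move=> hf; have := integrableZl measurableT K hf. Qed.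

Lemma intgM h f K : measurable_fun setT h -> (forall x, `|h x| <= K) ->
  intg mu f -> intg mu (fun x => h x * f x).
Proof.
move=> mh hK intf; apply: (intg_le _ (intgZ K intf)).
  exact: measurable_funM mh (intg_measurable intf).
by move=> x; rewrite !normrM ler_wpM2r// (le_trans (hK x))// ler_norm.
Qed.

Lemma intg_norm f : intg mu f -> intg mu (fun x => `|f x|).
Proof.
move=> intf; apply: (intg_le _ intf) => [|x]; last by rewrite normr_id.
by apply: measurableT_comp => //; exact: intg_measurable.
Qed.

Lemma intg_sum (I : Type) (s : seq I) (F : I -> T -> R) :
  (forall i, intg mu (F i)) -> intg mu (fun x => \sum_(i <- s) F i x).
Proof.
move=> iF; elim: s => [|i s IH].
  by under [X in EFin \o X]eq_fun do rewrite big_nil; exact: intg_cst.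
under [X in EFin \o X]eq_fun do rewrite big_cons.
exact: intgD.
Qed.

Lemma intg_indic A : measurable A -> intg mu (\1_A).
Proof. by move=> mA; exact: integrable_indic. Qed.

Lemma indic_le1 A x : `|\1_A x : R| <= 1.
Proof. by rewrite indicE; case: (x \in A); rewrite ?normr1 ?normr0. Qed.

Lemma exD f g : intg mu f -> intg mu g ->
  \int[mu]_x (f x + g x) = \int[mu]_x f x + \int[mu]_x g x.
Proof. by move=> *; rewrite RintegralD. Qed.

Lemma exB f g : intg mu f -> intg mu g ->
  \int[mu]_x (f x - g x) = \int[mu]_x f x - \int[mu]_x g x.
Proof. by move=> *; rewrite RintegralB. Qed.

Lemma exZ K f : intg mu f -> \int[mu]_x (K * f x) = K * \int[mu]_x f x.
Proof. by move=> *; rewrite RintegralZl. Qed.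

Lemma ex_le f g : intg mu f -> intg mu g -> (forall x, f x <= g x) ->
  \int[mu]_x f x <= \int[mu]_x g x.
Proof. by move=> *; apply: le_Rintegral. Qed.

Lemma ex_cst K : \int[mu]_x K = K.
Proof. by rewrite /Rintegral integral_cst//= probability_setT mule1. Qed.

Lemma ex_norm f : intg mu f -> `|\int[mu]_x f x| <= \int[mu]_x `|f x|.
Proof. by move=> *; apply: le_normr_Rintegral. Qed.

Lemma ex_sum (I : Type) (s : seq I) (F : I -> T -> R) :
  (forall i, intg mu (F i)) ->
  \int[mu]_x (\sum_(i <- s) F i x) = \sum_(i <- s) \int[mu]_x F i x.
Proof.
move=> iF; elim: s => [|i s IH].
  by under eq_Rintegral do rewrite big_nil; rewrite ex_cst big_nil.
under eq_Rintegral do rewrite big_cons.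
by rewrite exD// ?IH ?big_cons//; exact: intg_sum.
Qed.

Lemma ex_ae f g : measurable_fun setT f -> measurable_fun setT g ->
  {ae mu, forall x, f x = g x} -> \int[mu]_x f x = \int[mu]_x g x.
Proof.
move=> mf mg fg; congr fine; apply: ae_eq_integral => //.
- exact/measurable_EFinP.
- exact/measurable_EFinP.
- by apply: filterS fg => x /= -> .
Qed.

Lemma intg_ae f g : measurable_fun setT g ->
  {ae mu, forall x, f x = g x} -> intg mu f -> intg mu g.
Proof.
move=> mg fg intf; have mf := intg_measurable intf.
apply/integrableP; split; first exact/measurable_EFinP.
have /integrableP[_] := intf; congr (_ < _)%E; apply: ae_eq_integral => //.
- by apply: measurableT_comp => //; exact/measurable_EFinP.
- by apply: measurableT_comp => //; exact/measurable_EFinP.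
- by apply: filterS fg => x /= -> .
Qed.

Lemma ex_indic A : measurable A -> \int[mu]_x \1_A x = fine (mu A).
Proof. by move=> mA; rewrite /Rintegral integral_indic// setIT. Qed.

Lemma ex_setE A f : measurable A -> \int[mu]_(x in A) f x = \int[mu]_x (\1_A x * f x).
Proof.
move=> mA; rewrite Rintegral_mkcond; apply: eq_Rintegral => x _.
by rewrite patchE indicE; case: (x \in A); rewrite ?mul1r ?mul0r.
Qed.

Lemma ex0_ae f : intg mu f -> \int[mu]_x `|f x| = 0 -> {ae mu, forall x, f x = 0}.
Proof.
move=> intf f0.
have mf : measurable_fun setT (EFin \o f).
  by apply/measurable_EFinP; exact: intg_measurable.
have : (\int[mu]_(x in setT) `|(EFin \o f) x| = 0)%E.
  have /integral_fune_fin_num := intg_norm intf => /(_ measurableT)/fineK <-.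
  by move: f0; rewrite /Rintegral => ->.
move=> /(ae_eq_integral_abs mu measurableT mf).
by apply: filterS => x /= /(_ I) [].
Qed.

End integrals.

Section square_integrable.
Context {R : realType} {d : measure_display} {T : measurableType d}.
Variable mu : probability T R.
Implicit Types (f g h : T -> R) (K : R).

Definition L2 f := measurable_fun setT f /\ intg mu (fun x => f x ^+ 2).

Lemma L2_measurable f : L2 f -> measurable_fun setT f. Proof. by case. Qed.

Lemma L2M f g : L2 f -> L2 g -> intg mu (fun x => f x * g x).
Proof.
move=> [mf if2] [mg ig2]; apply: (intg_le _ (intgD if2 ig2)).
  exact: measurable_funM.
move=> x; rewrite ler_norml.
rewrite (ger0_norm (addr_ge0 (sqr_ge0 _) (sqr_ge0 _))).
have := sqr_ge0 (f x + g x); have := sqr_ge0 (f x - g x).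
have := sqr_ge0 (f x); have := sqr_ge0 (g x).
by move=> *; lra.
Qed.

Lemma L2_cst K : L2 (cst K).
Proof. by split => //; exact: (intg_cst mu (K ^+ 2)). Qed.

Lemma L2_intg f : L2 f -> intg mu f.
Proof.
move=> f2; have := L2M (L2_cst 1) f2.
by under [X in EFin \o X]eq_fun do rewrite /cst mul1r.
Qed.

Lemma L2D f g : L2 f -> L2 g -> L2 (fun x => f x + g x).
Proof.
move=> f2 g2; split; first by apply: measurable_funD; apply: L2_measurable.
under [X in EFin \o X]eq_fun do rewrite sqrrD -mulr_natl.
apply: intgD; last by case: g2.
by apply: intgD; [case: f2|exact/intgZ/L2M].
Qed.

Lemma L2Z K f : L2 f -> L2 (fun x => K * f x).
Proof.
move=> [mf if2]; split; first by apply: measurable_funM.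
by under [X in EFin \o X]eq_fun do rewrite exprMn; exact: intgZ.
Qed.

Lemma L2B f g : L2 f -> L2 g -> L2 (fun x => f x - g x).
Proof.
move=> f2 g2; have := L2D f2 (L2Z (-1) g2).
by under [X in L2 X -> _]eq_fun do rewrite mulN1r.
Qed.

Lemma L2_sum (I : Type) (s : seq I) (F : I -> T -> R) :
  (forall i, L2 (F i)) -> L2 (fun x => \sum_(i <- s) F i x).
Proof.
move=> iF; elim: s => [|i s IH].
  by under [X in L2 X]eq_fun do rewrite big_nil; exact: (L2_cst 0).
by under [X in L2 X]eq_fun do rewrite big_cons; exact: L2D.
Qed.

End square_integrable.

(** * Testing against a sub-sigma-algebra *)

Section sub_sigma_algebra.
Context {R : realType} {d : measure_display} {T : measurableType d}.
Variables (mu : probability T R) (G : set (set T)).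
Hypotheses (sG : sigma_algebra setT G) (Gm : G `<=` measurable).
Implicit Types (f g : T -> R) (A : set T).

(** Measurability refers to the sigma-algebra generated by [G], so that the closure rules for
    measurable functions apply as they stand; when [G] is a sigma-algebra this adds nothing, by
    [adaptedP]. *)
Definition adapted f := measurable_fun setT (f : g_sigma_algebraType G -> R).

Lemma adaptedP f : adapted f <-> forall B : set R, measurable B -> G (f @^-1` B).
Proof.
split => [mf B mB|GB].
  have := mf measurableT B mB; rewrite setTI.
  by rewrite /measurable/= sigma_algebra_id.
move=> _ B mB; rewrite setTI; apply: sub_sigma_algebra; exact: GB.
Qed.

Lemma adapted_set A : G A -> measurable (A : set (g_sigma_algebraType G)).
Proof. exact: sub_sigma_algebra. Qed.

Lemma adapted_indic A : G A -> adapted \1_A.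
Proof. by move=> GA; apply: measurable_indic; exact: adapted_set. Qed.

Lemma adapted_measurable f : adapted f -> measurable_fun setT f.
Proof.
by move=> /adaptedP GB _ B mB; rewrite setTI; apply: Gm; exact: GB.
Qed.

Lemma adapted_setE f (B : set R) : adapted f -> measurable B -> G (f @^-1` B).
Proof. by move=> /adaptedP; exact. Qed.

Lemma truncn_sumE (x : R) J : 0 <= x -> x <= J%:R ->
  (Num.truncn x)%:R = \sum_(1 <= j < J.+1) (j%:R <= x)%R%:R :> R.
Proof.
move=> x0 xJ.
have tJ : (Num.truncn x <= J)%N.
  by rewrite -(ler_nat R) (le_trans _ xJ)// truncn_le.
rewrite (big_cat_nat _ (n := (Num.truncn x).+1))//=.
rewrite [X in _ + X]big_nat_cond [X in _ + X]big1 ?addr0; last first.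
  move=> j /andP[/andP[tj _] _]; rewrite leNgt.
  by rewrite (lt_le_trans (truncnS_gt _))// ler_nat.
rewrite big_nat_cond (eq_bigr (fun=> 1)).
  by rewrite -big_nat_cond sumr_const_nat subn1.
move=> j /andP[/andP[_ jt] _].
rewrite (_ : (j%:R <= x) = true)//.
by rewrite (@le_trans _ _ (Num.truncn x)%:R) ?ler_nat// truncn_le.
Qed.

(* [truncn x] is a sum of indicators [j <= x], which gives a uniform
   approximation of [xi] by [G]-simple functions. *)
Lemma ex_adapted0 f (xi : T -> R) K : intg mu f ->
  (forall A, G A -> \int[mu]_(x in A) f x = 0) ->
  adapted xi -> (forall x, `|xi x| <= K) ->
  \int[mu]_x (xi x * f x) = 0.
Proof.
move=> intf f0 axi xiK.
have GT : G setT by have [G0 GC _] := sG; have := GC _ G0; rewrite setD0.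
(* Adding the constant [K] makes [xi] nonnegative and leaves the integral unchanged, since [f] has
   integral 0 over the whole space. *)
wlog xi0 : xi K axi xiK / forall x, 0 <= xi x.
  move=> H; pose xi' x := xi x + K.
  have := H xi' (K + K) _ _ _ => /(_ _ _ _).
  have mxi := adapted_measurable axi.
  have -> : \int[mu]_x (xi' x * f x) = \int[mu]_x (xi x * f x) + K * \int[mu]_x f x.
    rewrite -exZ// -exD//; last 2 first.
    - exact: intgM xiK intf.
    - exact: intgZ.
    by apply: eq_Rintegral => x _; rewrite /xi' mulrDl.
  rewrite (f0 _ GT) mulr0 addr0; apply.
  - by apply: measurable_funD => //; exact: axi.
  - by move=> x; rewrite /xi' (le_trans (ler_normD _ _))// lerD// ger0_norm// (le_trans _ (xiK x)).
  - by move=> x; have := xiK x; rewrite ler_norml /xi'; lra.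
have mxi := adapted_measurable axi.
have ixif : intg mu (fun x => xi x * f x) by exact: intgM xiK intf.
apply/eqP; rewrite -normr_eq0; apply/eqP/le_anti; rewrite normr_ge0 andbT.
apply/ler_addgt0Pr => e e0; rewrite add0r.
set If := \int[mu]_x `|f x|.
have If0 : 0 <= If by apply: Rintegral_ge0.
(* Rounding [m * xi] down to integers has uniform error 1/m in [xi], which costs at most If / m <= e
   in the integral. *)
pose m := (Num.truncn (If / e)).+1.
have m0 : 0 < m%:R :> R by rewrite ltr0n.
have Im : If <= e * m%:R.
  by rewrite mulrC -ler_pdivrMr// ltW// truncnS_gt.
pose xim x : R := (Num.truncn (m%:R * xi x))%:R.
pose J := (Num.truncn (m%:R * K)).+1.
have ximE x : xim x = \sum_(1 <= j < J.+1) \1_(xi @^-1` `[j%:R / m%:R, +oo[%classic) x.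
  rewrite /xim (@truncn_sumE _ J).
  - apply: eq_bigr => j _; rewrite indicE; congr (nat_of_bool _)%:R.
    apply/idP/idP; rewrite inE/= in_itv/= andbT ler_pdivrMr// mulrC//.
  - by rewrite mulr_ge0.
  - apply: (@le_trans _ _ (m%:R * K)); last by rewrite ltW// truncnS_gt.
    by rewrite ler_wpM2l// (le_trans (ler_norm _)).
have ximf : \int[mu]_x (xim x * f x) = 0.
  under eq_Rintegral do rewrite ximE big_distrl/=.
  rewrite ex_sum.
    apply: big1 => j _; rewrite -ex_setE ?f0//; last apply: Gm.
      exact: adapted_setE.
    exact: adapted_setE.
  move=> j; apply: intgM (indic_le1 _) intf; apply: measurable_indic; apply: Gm.
  exact: adapted_setE.
have mxim : measurable_fun setT xim.
  rewrite (_ : xim = fun x => \sum_(1 <= j < J.+1) \1_(xi @^-1` `[j%:R / m%:R, +oo[%classic) x).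
    by apply: measurable_sum => j; apply: measurable_indic; apply: Gm; exact: adapted_setE.
  by apply/funext.
have dxi x : `|m%:R * xi x - xim x| <= 1.
  have mx : 0 <= m%:R * xi x by rewrite mulr_ge0.
  rewrite /xim ger0_norm ?subr_ge0 ?truncn_le//.
  by have := truncnS_gt (m%:R * xi x); rewrite -[_.+1%:R]natr1; lra.
have iximf : intg mu (fun x => xim x * f x).
  apply: (@intgM _ _ _ _ _ _ (m%:R * K + 1)) intf => // x.
  have := dxi x; rewrite ler_norml => hd; have := ler_wpM2l (ltW m0) (le_trans (ler_norm _) (xiK x)).
  have : 0 <= xim x by rewrite ler0n.
  by move=> h1; rewrite (ger0_norm h1); lra.
have : `|m%:R * \int[mu]_x (xi x * f x)| <= If.
  rewrite -exZ// -[X in `|X|]subr0 -ximf -exB//; last exact: intgZ.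
  apply: (le_trans (ex_norm _)); first by apply: intgB => //; exact: intgZ.
  apply: ex_le; [|exact: intg_norm|] => //.
    by apply: intg_norm; apply: intgB => //; exact: intgZ.
  by move=> x; rewrite mulrA -mulrBl normrM ler_piMl.
rewrite normrM ger0_norm// mulrC -ler_pdivlMr// => /le_trans; apply.
by rewrite ler_pdivrMr.
Qed.

Lemma ex_adapted f g (xi : T -> R) K : intg mu f -> intg mu g ->
  (forall A, G A -> \int[mu]_(x in A) f x = \int[mu]_(x in A) g x) ->
  adapted xi -> (forall x, `|xi x| <= K) ->
  \int[mu]_x (xi x * f x) = \int[mu]_x (xi x * g x).
Proof.
move=> intf intg' fg axi xiK.
have mxi := adapted_measurable axi.
apply/eqP; rewrite -subr_eq0 -exB; [|exact: intgM xiK _|exact: intgM xiK _].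
apply/eqP; rewrite -[RHS](@ex_adapted0 (fun x => f x - g x) xi K)//.
- by apply: eq_Rintegral => x _; rewrite mulrBr.
- exact: intgB.
- move=> A GA; have mA := Gm GA.
  rewrite RintegralB ?fg ?subrr//; apply: integrableS (measurableT) _ _ _ => //.
Qed.

(** The sign of [f - g] is itself adapted and bounded, and testing against it turns the hypothesis
    into E|f - g| = 0. *)
Lemma adapted_ae_eq f g : intg mu f -> intg mu g -> adapted f -> adapted g ->
  (forall A, G A -> \int[mu]_(x in A) f x = \int[mu]_(x in A) g x) ->
  {ae mu, forall x, f x = g x}.
Proof.
move=> intf intg' af ag fg.
have h : adapted (fun x => f x - g x) by apply: measurable_funB.
pose xi x : R := 2 * \1_((fun x => f x - g x) @^-1` `[0, +oo[%classic) x - 1.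
have axi : adapted xi.
  apply: measurable_funB => //; apply: measurable_funM => //.
  by apply: adapted_indic; exact: adapted_setE.
have xi1 x : `|xi x| <= 1.
  by rewrite /xi indicE; case: (_ \in _); rewrite /= ?mulr1n ?mulr0n ler_norml; lra.
have ifg := intgB intf intg'.
have H : \int[mu]_x `|f x - g x| = 0.
  rewrite -[RHS](@ex_adapted0 (fun x => f x - g x) xi 1)//.
    apply: eq_Rintegral => x _; rewrite /xi indicE.
    have -> : (x \in (fun x => f x - g x) @^-1` `[0, +oo[%classic) = (0 <= f x - g x).
      by apply/idP/idP; rewrite inE/= in_itv/= andbT.
    have [fg0|fg0] := leP 0 (f x - g x).
      by rewrite ger0_norm// mulr1n; ring.
    by rewrite ltr0_norm// mulr0n; ring.
  move=> A GA; have mA := Gm GA.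
  by rewrite RintegralB ?fg ?subrr//; apply: integrableS (measurableT) _ _ _ => //.
have := ex0_ae ifg H; apply: filterS => x /= /eqP.
by rewrite subr_eq0 => /eqP.
Qed.

End sub_sigma_algebra.

(** * A conditional martingale central limit theorem *)

Section martingale_clt.
Context {R : realType} {d : measure_display} {T : measurableType d}.
Variables (mu : probability T R) (F : nat -> set (set T)).
(** [dd k] is the increment from time k to k + 1, [c k] its conditional second moment, [l k] that of
    its part above [eps]. The inequalities on [c] and [l] are assumed at every point, which
    integrals against a kernel do satisfy, so the stopping argument meets no exceptional sets. *)
Variables (dd c l : nat -> T -> R) (eps lam eta dl a : R).
Hypotheses (sF : forall k, sigma_algebra setT (F k)).
Hypotheses (Fm : forall k, F k `<=` measurable).
Hypotheses (Fnd : forall k, F k `<=` F k.+1).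
Hypotheses (add : forall k, adapted (F k.+1) (dd k)).
Hypotheses (ac : forall k, adapted (F k) (c k)).
Hypotheses (al : forall k, adapted (F k) (l k)).
Hypotheses (c0 : forall k x, 0 <= c k x) (l0 : forall k x, 0 <= l k x).
Hypotheses (cl : forall k x, c k x <= eps ^+ 2 + l k x).
Hypotheses (id2 : forall k, intg mu (fun x => dd k x ^+ 2)).
Hypotheses (ic : forall k, intg mu (c k)) (il : forall k, intg mu (l k)).
Let tail k x : R := dd k x ^+ 2 * \1_[set y | eps < `|dd k y|] x.
Hypotheses (hd1 : forall k A, F k A -> \int[mu]_(x in A) dd k x = 0).
Hypotheses (hd2 : forall k A, F k A ->
  \int[mu]_(x in A) dd k x ^+ 2 = \int[mu]_(x in A) c k x).
Hypotheses (hdl : forall k A, F k A ->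
  \int[mu]_(x in A) (dd k x ^+ 2 * \1_[set y | eps < `|dd k y|] x) =
  \int[mu]_(x in A) l k x).
Hypotheses (eps0 : 0 < eps) (lam0 : 0 <= lam) (eta0 : 0 < eta) (dl0 : 0 < dl).

(* [chi] stops the increments once the conditional variances exceed
   [lam + eta] or the Lindeberg sums exceed [eta]; the heat flow then runs over
   the time [Tm] left on the clock of the conditional variances, which keeps it
   above [dl ^+ 2], where the flow is smooth. *)
Let Asum k x := \sum_(j < k) c j x.
Let Lsum k x := \sum_(j < k) l j x.
Let chi k x : R := \1_(Asum k.+1 @^-1` `]-oo, lam + eta]%classic) x *
                   \1_(Lsum k.+1 @^-1` `]-oo, eta]%classic) x.
Let M k x := \sum_(j < k) chi j x * dd j x.
Let V k x := \sum_(j < k) chi j x * c j x.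
Let U k x := \sum_(j < k) chi j x * l j x.
Let Tm k x := dl ^+ 2 + (lam + eta - V k x).
Let u k x := hflow a (Tm k x) (M k x).

Let adapted_le j k (f : T -> R) : (j <= k)%N -> adapted (F j) f -> adapted (F k) f.
Proof.
move=> jk /(adaptedP (sF j)) fj; apply/(adaptedP (sF k)) => B /fj.
by elim: k jk {fj} => [|k IH]; rewrite leq_eqVlt => /predU1P[->//|//]; move=> /IH h /h /Fnd.
Qed.

Let mF k (f : T -> R) : adapted (F k) f -> measurable_fun setT f.
Proof. exact: (adapted_measurable (sF k) (@Fm k)). Qed.

Let mdd k : measurable_fun setT (dd k). Proof. exact: mF (@add k). Qed.

Let chiP k x : chi k x = 0 \/
  [/\ chi k x = 1, Asum k.+1 x <= lam + eta & Lsum k.+1 x <= eta].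
Proof.
rewrite /chi !indicE.
have -> : (x \in Asum k.+1 @^-1` `]-oo, lam + eta]%classic) = (Asum k.+1 x <= lam + eta).
  by apply/idP/idP; rewrite inE/= in_itv.
have -> : (x \in Lsum k.+1 @^-1` `]-oo, eta]%classic) = (Lsum k.+1 x <= eta).
  by apply/idP/idP; rewrite inE/= in_itv.
have [h1|h1] := leP (Asum k.+1 x) (lam + eta); last by left; rewrite mulr0n mul0r.
have [h2|h2] := leP (Lsum k.+1 x) eta; last by left; rewrite mulr0n mulr0.
by right; rewrite mulr1n mulr1.
Qed.

Let chi_eq1 k x : Asum k.+1 x <= lam + eta -> Lsum k.+1 x <= eta -> chi k x = 1.
Proof. by move=> h1 h2; rewrite /chi !indicE !mem_set ?mulr1//= in_itv. Qed.

Let chi_ge0 k x : 0 <= chi k x.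
Proof. by have [->|[->]] := chiP k x. Qed.

Let chi_le1 k x : `|chi k x| <= 1.
Proof. by have [->|[->]] := chiP k x; rewrite ?normr0 ?normr1. Qed.

Let chi_sqr k x : chi k x * chi k x = chi k x.
Proof. by have [->|[->]] := chiP k x; rewrite ?mul0r ?mulr1. Qed.

(** The two bounds go through the induction together: at a step with [chi = 1], comparison with the
    unstopped sum yields the cap. *)
Let V_le k x : V k x <= Asum k x /\ V k x <= lam + eta.
Proof.
have p1 := lam0; have p2 := eta0.
elim: k => [|k [h1 h2]]; first by rewrite /V /Asum !big_ord0; split => //; lra.
have := c0 k x => ck; rewrite /V big_ord_recr/= -/(V k x).
have AS : Asum k.+1 x = Asum k x + c k x by rewrite /Asum big_ord_recr.
have [->|[-> h3 _]] := chiP k x; rewrite ?mul0r ?mul1r ?addr0 AS; first by split => //; lra.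
by move: h3; rewrite AS => ?; split; lra.
Qed.

Let U_le k x : U k x <= Lsum k x /\ U k x <= eta.
Proof.
have p2 := eta0.
elim: k => [|k [h1 h2]]; first by rewrite /U /Lsum !big_ord0; split => //; lra.
have := l0 k x => ck; rewrite /U big_ord_recr/= -/(U k x).
have AS : Lsum k.+1 x = Lsum k x + l k x by rewrite /Lsum big_ord_recr.
have [->|[-> _ h3]] := chiP k x; rewrite ?mul0r ?mul1r ?addr0 AS; first by split => //; lra.
by move: h3; rewrite AS => ?; split; lra.
Qed.

Let Tm_ge k x : dl ^+ 2 <= Tm k x.
Proof. by have [_] := V_le k x; rewrite /Tm; lra. Qed.

Let aAsum k : adapted (F k) (Asum k.+1).
Proof. by apply: measurable_sum => j; apply: adapted_le (@ac j); rewrite -ltnS. Qed.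

Let aLsum k : adapted (F k) (Lsum k.+1).
Proof. by apply: measurable_sum => j; apply: adapted_le (@al j); rewrite -ltnS. Qed.

(** [chi k] involves [c k] and [l k], which are known at time k: the stopping is predictable and the
    stopped increments remain martingale differences. *)
Let achi k : adapted (F k) (chi k).
Proof.
apply: measurable_funM; apply: adapted_indic.
  exact: adapted_setE (@aAsum k) _.
exact: adapted_setE (@aLsum k) _.
Qed.

Let aM k : adapted (F k) (M k).
Proof.
apply: measurable_sum => j; apply: measurable_funM.
  by apply: adapted_le (@achi j); rewrite ltnW.
exact: adapted_le (@add j).
Qed.

Let aV k : adapted (F k) (V k.+1).
Proof.
apply: measurable_sum => j; apply: measurable_funM.
  by apply: adapted_le (@achi j); rewrite -ltnS.
by apply: adapted_le (@ac j); rewrite -ltnS.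
Qed.

Let aTm k : adapted (F k) (Tm k.+1).
Proof.
apply: measurable_funD => //; apply: measurable_funB => //; exact: aV.
Qed.

Let aV' k : adapted (F k) (V k).
Proof.
apply: measurable_sum => j; apply: measurable_funM.
  by apply: adapted_le (@achi j); rewrite ltnW.
by apply: adapted_le (@ac j); rewrite ltnW.
Qed.

Let ainv k (f : T -> R) : adapted (F k) f -> (forall x, 0 <= f x) -> adapted (F k) (fun x => (f x)^-1).
Proof.
move=> af f0.
have -> : (fun x => (f x)^-1) = (fun x => (f x) `^ (-1)).
  by apply/funext => x; rewrite powR_inv1.
exact: measurableT_comp (measurable_powR _) af.
Qed.

Let asqrt k (f : T -> R) : adapted (F k) f -> adapted (F k) (fun x => Num.sqrt (f x)).
Proof.
move=> af; apply: measurableT_comp af.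
by apply: continuous_measurable_fun; exact: sqrt_continuous.
Qed.

Let ay k j : adapted (F k) (Tm j) -> adapted (F k) (M k) ->
  adapted (F k) (fun x => (a - M k x) / Num.sqrt (Tm j x)).
Proof.
move=> aT aMk; apply: measurable_funM; first exact: measurable_funB.
by apply: ainv => [|x]; [exact: asqrt|exact: sqrtr_ge0].
Qed.

Let au k : measurable_fun setT (u k).
Proof.
have aTk : adapted (F k) (Tm k).
  by apply: measurable_funD => //; apply: measurable_funB => //; exact: aV'.
have aY := @ay k k aTk (@aM k).
apply: (@mF k); exact: measurableT_comp (@measurable_Phi R) aY.
Qed.

(** The expansion is centred at the later clock value [Tm k.+1], already known at time k; this makes
    [B1 k] and [B2 k] adapted to [F k]. *)
Let B1 k x := hx a (Tm k.+1 x) (M k x).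
Let B2 k x := hxx a (Tm k.+1 x) (M k x).

Let aB1 k : adapted (F k) (B1 k).
Proof.
have aY := @ay k k.+1 (@aTm k) (@aM k).
have aI : adapted (F k) (fun x => (Num.sqrt (Tm k.+1 x))^-1).
  by apply: ainv => [|x]; [apply: asqrt; exact: aTm|exact: sqrtr_ge0].
have h : adapted (F k) (fun x => npdf ((a - M k x) / Num.sqrt (Tm k.+1 x)) / Num.sqrt (Tm k.+1 x)).
  by apply: measurable_funM => //; exact: measurableT_comp (@measurable_npdf R) aY.
exact: measurableT_comp h.
Qed.

Let aB2 k : adapted (F k) (B2 k).
Proof.
have aY := @ay k k.+1 (@aTm k) (@aM k).
have aI : adapted (F k) (fun x => (2 * Tm k.+1 x)^-1).
  apply: ainv => [|x]; last by rewrite mulr_ge0// (le_trans _ (Tm_ge k.+1 x))// sqr_ge0.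
  by apply: measurable_funM => //; exact: aTm.
have h1 : adapted (F k) (fun x => npdf ((a - M k x) / Num.sqrt (Tm k.+1 x))).
  exact: measurableT_comp (@measurable_npdf R) aY.
have h2 := measurable_funM (measurable_funM aY h1) aI.
exact: measurableT_comp h2.
Qed.

Let K := heat_cst dl.

Let mtail k : measurable_fun setT (tail k).
Proof.
apply: measurable_funM; first by apply: measurable_funX; exact: mdd.
by apply: measurable_indic; apply: measurable_lt_norm; exact: mdd.
Qed.

Let itail k : intg mu (tail k).
Proof.
apply: (intg_le (mtail k) (id2 k)) => x; rewrite /tail normrM ler_piMr//.
exact: indic_le1.
Qed.

Let u_bnd k x : `|u k x| <= 1.
Proof. by rewrite ger0_norm ?hflow_ge0 ?hflow_le1. Qed.

Let iu k : intg mu (u k).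
Proof. exact: intg_bnd (au k) (u_bnd k). Qed.

(** A jump of size at most [eps] makes the cube at most eps times the square; a larger one goes into
    [tail]. For the squared clock step, c <= eps^2 + l <= eps^2 + eta as long as the Lindeberg sums
    have not passed [eta], which is why [chi] watches them too. *)
Let rest_le k x :
  `|u k.+1 x - u k x - (chi k x * B1 k x * dd k x +
     chi k x * B2 k x * (dd k x ^+ 2 - c k x))| <=
  K * (eps * (chi k x * dd k x ^+ 2) + chi k x * tail k x +
       (eps ^+ 2 + eta) * (chi k x * c k x)).
Proof.
pose D := chi k x * dd k x; pose cc := chi k x * c k x.
have cc0 : 0 <= cc by rewrite mulr_ge0 ?chi_ge0 ?c0.
have TE : Tm k x = Tm k.+1 x + cc.
  by rewrite /Tm /V big_ord_recr/= /cc; ring.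
have ME : M k.+1 x = M k x + D by rewrite /M big_ord_recr.
have := hflow_step a (M k x) D dl0 (Tm_ge k.+1 x) cc0.
rewrite -TE -ME -/(u k x) -/(u k.+1 x) -/(B1 k x) -/(B2 k x) -/K => H.
have DE : D ^+ 2 = chi k x * dd k x ^+ 2 by rewrite /D exprMn expr2 chi_sqr.
rewrite (_ : _ - (_ + _) = u k.+1 x - u k x - D * B1 k x - (D ^+ 2 - cc) * B2 k x); last first.
  by rewrite DE /D /cc; ring.
apply: (le_trans H); rewrite ler_wpM2l ?(ltW (heat_cst_gt0 dl0))//.
have m1 : Num.min (D ^+ 2) (`|D| ^+ 3) <= eps * (chi k x * dd k x ^+ 2) + chi k x * tail k x.
  rewrite /tail indicE.
  have -> : (x \in [set y | eps < `|dd k y|]) = (eps < `|dd k x|).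
    by apply/idP/idP; rewrite inE.
  have [h|h] := ltP eps `|dd k x|.
    by rewrite mulr1n mulr1 -DE ge_min lerDr mulr_ge0 ?sqr_ge0// ltW// eps0.
  rewrite mulr0n !mulr0 addr0 -DE ge_min; apply/orP; right.
  rewrite exprS -normrX (ger0_norm (sqr_ge0 D)) ler_wpM2r ?sqr_ge0//.
  by rewrite /D normrM (le_trans _ h)// ler_piMl ?chi_le1.
have m2 : cc ^+ 2 <= (eps ^+ 2 + eta) * cc.
  rewrite expr2 ler_wpM2r// /cc.
  have e2 : 0 <= eps ^+ 2 by apply: sqr_ge0.
  have [->|[-> _ h]] := chiP k x; first by rewrite mul0r addr_ge0// ltW// eta0.
  rewrite mul1r (le_trans (cl k x))// lerD2l (le_trans _ h)//.
  by rewrite /Lsum big_ord_recr/= lerDr sumr_ge0// => *; exact: l0.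
by rewrite lerD.
Qed.

Variables (A : set T) (FA : F 0%N A).

Let FAk k : F k A. Proof. by elim: k => // k /Fnd. Qed.
Let mA : measurable A. Proof. exact: Fm FA. Qed.

Let ichi k (f : T -> R) : intg mu f -> intg mu (fun x => chi k x * f x).
Proof. by move=> h; apply: intgM (chi_le1 k) h; exact: mF (@achi k). Qed.

(** The indicator of [A] times [chi] times [B1] or [B2] is bounded and adapted to [F k], so both
    martingale terms integrate to zero. Testing with [chi] also replaces [dd ^+ 2] by [c] and [tail]
    by [l], whose stopped sums are bounded. *)
Let step_le k : `|\int[mu]_x (\1_A x * (u k.+1 x - u k x))| <=
  K * \int[mu]_x (eps * (chi k x * c k x) + chi k x * l k x +
       (eps ^+ 2 + eta) * (chi k x * c k x)).
Proof.
pose X1 x := \1_A x * chi k x * B1 k x.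
pose X2 x := \1_A x * chi k x * B2 k x.
have aA : adapted (F k) (\1_A : T -> R) by apply: adapted_indic; exact: FAk.
have aAc := measurable_funM aA (@achi k).
have aX1 : adapted (F k) X1 := measurable_funM aAc (@aB1 k).
have aX2 : adapted (F k) X2 := measurable_funM aAc (@aB2 k).
have bchi f : (forall x, `|f x| <= K) -> forall x, `|\1_A x * chi k x * f x| <= K.
  move=> fK x; rewrite normrM (le_trans _ (fK x))// ler_piMl//.
  by rewrite normrM mulr_ile1// ?indic_le1 ?chi_le1.
have X1K x : `|X1 x| <= K by apply: bchi => y; exact: hx_bnd _ _ dl0 (Tm_ge _ _).
have X2K x : `|X2 x| <= K by apply: bchi => y; exact: hxx_bnd _ _ dl0 (Tm_ge _ _).
have i1 : intg mu (dd k) by apply: L2_intg; split; [exact: mdd|exact: id2].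
have idc : intg mu (fun x => dd k x ^+ 2 - c k x).
  by apply: intgB; [exact: id2|exact: ic].
have e1 : \int[mu]_x (X1 x * dd k x) = 0.
  by apply: (ex_adapted0 (sF k) (@Fm k) i1 _ aX1 X1K) => B; exact: hd1.
have e2 : \int[mu]_x (X2 x * (dd k x ^+ 2 - c k x)) = 0.
  apply: (ex_adapted0 (sF k) (@Fm k) idc _ aX2 X2K) => B FB.
  have mB := Fm FB; rewrite RintegralB ?hd2 ?subrr//;
    by apply: integrableS (measurableT) _ _ _ => //.
have iX1 : intg mu (fun x => X1 x * dd k x) by apply: intgM X1K i1; exact: mF aX1.
have iX2 : intg mu (fun x => X2 x * (dd k x ^+ 2 - c k x)).
  by apply: intgM X2K idc; exact: mF aX2.
have iw : intg mu (fun x => \1_A x * (u k.+1 x - u k x)).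
  apply: intgM (indic_le1 A) _; first by apply: measurable_indic; exact: mA.
  by apply: intgB; exact: iu.
pose rest x := \1_A x * (u k.+1 x - u k x) -
  (X1 x * dd k x + X2 x * (dd k x ^+ 2 - c k x)).
have irest : intg mu rest by apply: intgB => //; apply: intgD.
have -> : \int[mu]_x (\1_A x * (u k.+1 x - u k x)) = \int[mu]_x rest x.
  by rewrite exB ?exD// ?e1 ?e2 ?addr0 ?subr0//; exact: intgD.
apply: (le_trans (ex_norm irest)).
have icd : intg mu (fun x => chi k x * dd k x ^+ 2) by apply: ichi; exact: id2.
have icc : intg mu (fun x => chi k x * c k x) by apply: ichi; exact: ic.
have ib1 : intg mu (fun x => eps * (chi k x * dd k x ^+ 2)) by exact: intgZ.
have ib2 : intg mu (fun x => chi k x * tail k x) by apply: ichi; exact: itail.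
have ib3 : intg mu (fun x => (eps ^+ 2 + eta) * (chi k x * c k x)) by exact: intgZ.
have ib4 : intg mu (fun x => eps * (chi k x * c k x)) by exact: intgZ.
have ib5 : intg mu (fun x => chi k x * l k x) by apply: ichi; exact: il.
have -> : \int[mu]_x (eps * (chi k x * c k x) + chi k x * l k x +
       (eps ^+ 2 + eta) * (chi k x * c k x)) =
  \int[mu]_x (eps * (chi k x * dd k x ^+ 2) + chi k x * tail k x +
       (eps ^+ 2 + eta) * (chi k x * c k x)).
  rewrite !exD//; try exact: intgD.
  rewrite !exZ//.
  congr (_ * _ + _ + _).
    apply: esym; apply: (ex_adapted (sF k) (@Fm k) (id2 k) (ic k) _ (@achi k) (chi_le1 k)).
    by move=> B; exact: hd2.
  apply: esym; apply: (ex_adapted (sF k) (@Fm k) (itail k) (il k) _ (@achi k) (chi_le1 k)).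
  by move=> B; exact: hdl.
rewrite -exZ; last by do 2 apply: intgD => //.
apply: ex_le; [exact: intg_norm|by apply: intgZ; do 2 apply: intgD => //|].
move=> x; apply: le_trans (rest_le k x).
rewrite (_ : rest x = \1_A x * (u k.+1 x - u k x - (chi k x * B1 k x * dd k x +
     chi k x * B2 k x * (dd k x ^+ 2 - c k x)))); last first.
  by rewrite /rest /X1 /X2; ring.
by rewrite normrM ler_piMl// indic_le1.
Qed.

Let bnd := eps * (lam + eta) + eta + (eps ^+ 2 + eta) * (lam + eta).

(** Summing the steps produces [V] and [U], bounded pointwise by [lam + eta] and [eta]; the total
    error depends neither on [n] nor on [A]. *)
Let stopped_le n : `|\int[mu]_x (\1_A x * (u n x - u 0 x))| <= K * bnd.
Proof.
pose S k x := eps * V k x + U k x + (eps ^+ 2 + eta) * V k x.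
have iV k : intg mu (V k) by apply: intg_sum => j; apply: ichi; exact: ic.
have iU k : intg mu (U k) by apply: intg_sum => j; apply: ichi; exact: il.
have iS k : intg mu (S k).
  by apply: intgD; [apply: intgD => //|]; exact: intgZ.
have K0 : 0 < K := heat_cst_gt0 dl0.
have iAu k m : intg mu (fun x => \1_A x * (u k x - u m x)).
  apply: intgM (indic_le1 A) _; first by apply: measurable_indic; exact: mA.
  by apply: intgB; exact: iu.
have main : `|\int[mu]_x (\1_A x * (u n x - u 0 x))| <= K * \int[mu]_x S n x.
  elim: n => [|k IH].
    under eq_Rintegral do rewrite subrr mulr0.
    rewrite ex_cst normr0 mulr_ge0 ?(ltW K0)//; apply: Rintegral_ge0 => x _.
    by rewrite /S /V /U !big_ord0 !mulr0 !addr0.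
  have -> : \int[mu]_x (\1_A x * (u k.+1 x - u 0 x)) =
     \int[mu]_x (\1_A x * (u k.+1 x - u k x)) + \int[mu]_x (\1_A x * (u k x - u 0 x)).
    by rewrite -exD//; apply: eq_Rintegral => x _; ring.
  apply: (le_trans (ler_normD _ _)); apply: (le_trans (lerD (step_le k) IH)).
  rewrite -mulrDr -exD//; last first.
    by apply: intgD; [apply: intgD|]; do ?apply: intgZ; apply: ichi.
  rewrite ler_wpM2l ?(ltW K0)// le_eqVlt; apply/orP; left; apply/eqP.
  by apply: eq_Rintegral => x _; rewrite /S /V /U !big_ord_recr/=; ring.
apply: (le_trans main); rewrite ler_wpM2l ?(ltW K0)//.
rewrite -[leRHS](ex_cst mu); apply: ex_le => //; first exact: intg_cst.
move=> x; have [_ h1] := V_le n x; have [_ h2] := U_le n x.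
rewrite /S /bnd; apply: lerD; first apply: lerD => //.
  by rewrite ler_wpM2l// ltW.
by rewrite ler_wpM2l// addr_ge0 ?sqr_ge0// ltW.
Qed.

(** Off the two exceptional events nothing is stopped and the final clock lies within 2 eta of
    [dl ^+ 2], while the initial clock exceeds dl^2 + lam by eta; Lipschitz continuity in time gives
    the 3 eta. On the exceptional events the crude bound 2 is used. *)
Lemma martingale_clt_bound n :
  `|\int[mu]_x (\1_A x * (hflow a (dl ^+ 2) (\sum_(j < n) dd j x) -
                           hflow a (dl ^+ 2 + lam) 0))| <=
  heat_cst dl * (eps * (lam + eta) + eta + (eps ^+ 2 + eta) * (lam + eta) + 3 * eta) +
  2 * (fine (mu [set x | eta <= `|\sum_(j < n) c j x - lam|]) +
       fine (mu [set x | eta <= `|\sum_(j < n) l j x|])).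
Proof.
have p1 := lam0; have p2 := eta0; have p3 := eps0.
have K0 : 0 < K := heat_cst_gt0 dl0.
set b1 := [set x | eta <= `|\sum_(j < n) c j x - lam|].
set b2 := [set x | eta <= `|\sum_(j < n) l j x|].
pose Mn x := \sum_(j < n) dd j x.
have mMn : measurable_fun setT Mn by apply: measurable_sum => j; exact: mdd.
have iun := iu n; have iu0 := iu 0.
have mP := (@measurable_Phi R).
have mb1 : measurable b1.
  apply: measurable_le_norm; apply: measurable_funB => //.
  by apply: measurable_sum => j; exact: mF (@ac j).
have mb2 : measurable b2.
  by apply: measurable_le_norm; apply: measurable_sum => j; exact: mF (@al j).
pose v x := hflow a (dl ^+ 2) (Mn x); pose v0 := hflow a (dl ^+ 2 + lam) 0.
have mv : measurable_fun setT v.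
  have h : measurable_fun setT (fun x => (a - Mn x) / Num.sqrt (dl ^+ 2)).
    by apply: measurable_funM => //; exact: measurable_funB.
  exact: measurableT_comp mP h.
have iv : intg mu v.
  by apply: (@intg_bnd _ _ _ mu v 1) => // x; rewrite ger0_norm ?hflow_ge0 ?hflow_le1.
have mu0 : forall x, u 0 x = hflow a (dl ^+ 2 + lam + eta) 0.
  by move=> x; rewrite /u /Tm /V /M !big_ord0 subr0 addrA.
have iA f : intg mu f -> intg mu (fun x => \1_A x * f x).
  by apply: intgM (indic_le1 A); apply: measurable_indic; exact: mA.
have i1 : intg mu (fun x => v x - u n x - (v0 - u 0 x)).
  by apply: intgB; apply: intgB => //; exact: intg_cst.
have i2 : intg mu (fun x => u n x - u 0 x) by apply: intgB.
have -> : \int[mu]_x (\1_A x * (v x - v0)) =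
  \int[mu]_x (\1_A x * (v x - u n x - (v0 - u 0 x))) +
  \int[mu]_x (\1_A x * (u n x - u 0 x)).
  rewrite -exD; [|exact: iA|exact: iA].
  by apply: eq_Rintegral => x _; ring.
apply: (le_trans (ler_normD _ _)).
have S := stopped_le n.
have ib1 := intg_indic mu mb1; have ib2 := intg_indic mu mb2.
have W : `|\int[mu]_x (\1_A x * (v x - u n x - (v0 - u 0 x)))| <=
    K * (3 * eta) + 2 * (fine (mu b1) + fine (mu b2)).
  apply: (le_trans (ex_norm (iA _ i1))).
  rewrite -(ex_indic mu mb1) -(ex_indic mu mb2) -exD// -exZ; last exact: intgD.
  rewrite -[X in _ <= X + _](ex_cst mu) -exD; last 2 first.
  - exact: intg_cst.
  - by apply: intgZ; exact: intgD.
  apply: ex_le.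
  - exact/intg_norm/iA.
  - by apply: intgD; [exact: intg_cst|apply: intgZ; exact: intgD].
  move=> x; rewrite normrM.
  apply: (@le_trans _ _ `|v x - u n x - (v0 - u 0 x)|).
    by rewrite ler_piMl// indic_le1.
  have t0 : `|v0 - u 0 x| <= K * eta.
    rewrite mu0 distrC; apply: hflow_time_lip => //; last exact: ltW.
    by rewrite lerDl.
  apply: (le_trans (ler_normB _ _)).
  have : `|v x - u n x| <= K * (2 * eta) + 2 * (\1_b1 x + \1_b2 x).
    have bad : `|v x - u n x| <= 2.
      have := hflow_ge0 a (dl ^+ 2) (Mn x); have := hflow_le1 a (dl ^+ 2) (Mn x).
      have := hflow_ge0 a (Tm n x) (M n x); have := hflow_le1 a (Tm n x) (M n x).
      by rewrite /v /u => *; rewrite ler_norml; lra.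
    have Ke : 0 <= K * (2 * eta) by apply: mulr_ge0; [exact: ltW|lra].
    rewrite !indicE.
    have -> : (x \in b1) = (eta <= `|Asum n x - lam|) by apply/idP/idP; rewrite inE.
    have -> : (x \in b2) = (eta <= `|Lsum n x|) by apply/idP/idP; rewrite inE.
    have [h1|h1] := leP eta `|Asum n x - lam|.
      rewrite mulr1n; have := ler0n R (eta <= `|Lsum n x|)%R; lra.
    have [h2|h2] := leP eta `|Lsum n x|; first by rewrite mulr1n mulr0n; lra.
    rewrite !mulr0n !addr0 mulr0 addr0.
    move: h1 h2; rewrite !ltr_norml => /andP[h1 h1'] /andP[_ h2].
    (* The summands are nonnegative, so no partial sum exceeds the total and no earlier time
       triggers the stopping. *)
    have chi1 k : (k < n)%N -> chi k x = 1.
      move=> kn; apply: chi_eq1.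
        apply: (@le_trans _ _ (Asum n x)); last by lra.
        rewrite /Asum -!(big_mkord xpredT (fun j => c j x)).
        by rewrite [leRHS](big_cat_nat _ (n := k.+1))//= lerDl sumr_ge0.
      apply: (@le_trans _ _ (Lsum n x)); last by lra.
      rewrite /Lsum -!(big_mkord xpredT (fun j => l j x)).
      by rewrite [leRHS](big_cat_nat _ (n := k.+1))//= lerDl sumr_ge0.
    have MnE : M n x = Mn x by apply: eq_bigr => j _; rewrite chi1// mul1r.
    have VnE : V n x = Asum n x by apply: eq_bigr => j _; rewrite chi1// mul1r.
    rewrite /v /u MnE /Tm VnE distrC.
    apply: (@le_trans _ _ (K * (lam + eta - Asum n x))).
      by apply: hflow_time_lip => //; lra.
    by rewrite ler_wpM2l ?(ltW K0)//; lra.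
  by move=> h; apply: (le_trans (lerD h t0)); rewrite -/K; lra.
apply: (le_trans (lerD W S)); rewrite -/K -/bnd.
by lra.
Qed.

End martingale_clt.

(** * Reversible stationary Markov chains *)

Section graph_kernel.
Context {R : realType} {d : measure_display} {E : measurableType d}.
Variable Q : R.-pker E ~> E.

Lemma mpair (w : E) : measurable_fun [set: E] (pair w).
Proof. exact: pair1_measurable. Qed.

(* The dummy [unit] component is there because [mkcomp] composes with kernels
   on a product. *)
Definition graph_kernel (p : unit * E) : {measure set (E * E) -> \bar R} :=
  measure_function_pushforward__canonical__measure_function_Measure (Q p.2) (mpair p.2).

Lemma graph_kernel_meas (U : set (E * E)) : measurable U ->
  measurable_fun [set: unit * E] (graph_kernel ^~ U).
Proof.
move=> mU.
have -> : graph_kernel ^~ U = (fun w => Q w (xsection U w)) \o snd.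
  apply/funext => -[u w]; rewrite /graph_kernel/= /pushforward; congr (Q w _).
  by apply/seteqP; split => z; rewrite /xsection/= inE.
apply: measurableT_comp; last exact: measurable_snd.
by apply: measurable_fun_xsection_finite_kernel; rewrite inE.
Qed.

HB.instance Definition _ := isKernel.Build _ _ _ _ R graph_kernel graph_kernel_meas.

Lemma graph_kernel_prob p : graph_kernel p [set: E * E] = 1%E.
Proof. by rewrite /graph_kernel/= /pushforward preimage_setT prob_kernel. Qed.

HB.instance Definition _ := Kernel_isProbability.Build _ _ _ _ R graph_kernel graph_kernel_prob.

Lemma measurable_integral_graph (F : E * E -> \bar R) :
  measurable_fun setT F -> (forall p, 0 <= F p)%E ->
  measurable_fun setT (fun w => \int[Q w]_z F (w, z))%E.
Proof.
move=> mF F0.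
have -> : (fun w => \int[Q w]_z F (w, z))%E =
    (fun p => \int[graph_kernel p]_y F y)%E \o (fun w => (tt, w)).
  apply/funext => w /=.
  by rewrite /graph_kernel/= (ge0_integral_pushforward (mpair w)) ?preimage_setT.
apply: measurableT_comp; last exact: pair1_measurable.
by apply: measurable_fun_integral_kernel => //; exact: graph_kernel_meas.
Qed.

End graph_kernel.

Lemma integral_mrestr {R : realType} {d : measure_display} {T : measurableType d}
    (mu : {measure set T -> \bar R}) (A : set T) (mA : measurable A) (f : T -> \bar R) :
  measurable_fun setT f -> (forall x, 0 <= f x)%E ->
  (\int[mrestr mu mA]_x f x = \int[mu]_(x in A) f x)%E.
Proof.
move=> mf f0.
have mN := measurableC mA.
have N0 : mrestr mu mA (~` A) = 0%E by rewrite /mrestr setICl measure0.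
rewrite (ge0_negligible_integral mN measurableT mf (fun x _ => f0 x) N0).
rewrite setTD setCK; apply: eq_measure_integral => B mB BA.
by rewrite /= /mrestr setIidl.
Qed.

Section markov.
Context {R : realType} {d d' : measure_display} {Omega : measurableType d}
  {E : measurableType d'} {P : probability Omega R}.
Variables (W : int -> {RV P >-> E}) (pi : probability E R) (Q : R.-pker E ~> E).

Lemma past_sigma n : sigma_algebra setT (past W n).
Proof. exact: smallest_sigma_algebra. Qed.

Lemma past_measurable n : past W n `<=` measurable.
Proof.
apply: smallest_sub; first exact: sigma_algebra_measurable.
move=> A [m _] [B mB <-]; rewrite setTI.
by rewrite -[X in measurable X]setTI; apply: (measurable_funPT (W m)).
Qed.

Lemma past_nd m n : m <= n -> past W m `<=` past W n.
Proof.
move=> mn; apply: sub_sigma_algebra2 => A [k /= km WA].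
by exists k => //=; exact: le_trans km mn.
Qed.

Lemma past_preimage n m (B : set E) : m <= n -> measurable B -> past W n (W m @^-1` B).
Proof.
move=> mn mB; apply: sub_sigma_algebra; exists m => //=.
by exists B => //; rewrite setTI.
Qed.

Lemma preimage_sigma (m : int) : sigma_algebra setT (g_sigma_algebra_preimage (W m)).
Proof. exact/sigma_algebra_preimage/sigma_algebra_measurable. Qed.

Lemma preimage_sub_past n m : m <= n -> g_sigma_algebra_preimage (W m) `<=` past W n.
Proof.
by move=> mn A [B mB <-]; rewrite setTI; exact: past_preimage.
Qed.

Hypothesis hmarkov : markov_chain W Q.

Lemma markov_set n (A : set Omega) (B : set E) : past W n A -> measurable B ->
  P (A `&` W (n + 1) @^-1` B) = (\int[P]_(w in A) Q (W n w) B)%E.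
Proof.
move=> pA mB; have [_ _ /(_ A pA)] := hmarkov n mB.
have mA := past_measurable pA.
rewrite integral_indic//; last by exact: measurable_funPTI.
rewrite setIC => <-; apply: eq_integral => w _.
rewrite fineK//; exact: finite_kernel_measure.
Qed.

(** Both sides integrate [F] against finite measures on pairs: the law of (W_n, W_{n+1}) on [A], and
    the law of W_n on [A] followed by the graph kernel. They agree on rectangles, a generating
    pi-system. *)
Lemma markov_pair n (A : set Omega) (F : E * E -> \bar R) : past W n A ->
  measurable_fun setT F -> (forall p, 0 <= F p)%E ->
  (\int[P]_(x in A) F (W n x, W (n + 1) x) =
   \int[P]_(x in A) \int[Q (W n x)]_z F (W n x, z))%E.
Proof.
move=> pA mF F0; have mA := past_measurable pA.
have mW m : measurable_fun setT (W m) by exact: measurable_funPT.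
pose PA := mrestr P mA.
pose l0 : {measure set E -> \bar R} :=
  measure_function_pushforward__canonical__measure_function_Measure PA (mW n).
pose l (_ : unit) := l0.
have ml U : measurable U -> measurable_fun [set: unit] (l ^~ U).
  by move=> mU; exact: measurable_cst.
have ul : measure_fam_uub l.
  exists 2 => x; rewrite /l/= /pushforward preimage_setT /PA/= /mrestr setTI.
  by rewrite (le_lt_trans (probability_le1 _ _))// lte_fin ltr1n.
pose lk0 : R.-ker unit ~> E := HB.pack l (isKernel.Build _ _ _ _ R l ml).
pose lk : R.-fker unit ~> E := HB.pack l (isKernel.Build _ _ _ _ R l ml)
  (Kernel_isFinite.Build _ _ _ _ R lk0 ul).
have mWW : measurable_fun setT (fun x => (W n x, W (n + 1) x)).
  exact: measurable_fun_pair.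
pose m1 : {measure set (E * E) -> \bar R} :=
  measure_function_pushforward__canonical__measure_function_Measure PA mWW.
pose m2 := mkcomp lk (graph_kernel Q) tt.
have m12 G : measurable G -> m1 G = m2 G.
  apply: (measure_unique [set A `*` B | A in measurable & B in measurable]
    (fun=> setT)).
  - exact: measurable_prod_measurableType.
  - move=> _ _ [X1 mX1 [X2 mX2 <-]] [Y1 mY1 [Y2 mY2 <-]].
    exists (X1 `&` Y1); first exact: measurableI.
    by exists (X2 `&` Y2); [exact: measurableI|rewrite setXI].
  - by move=> _; exists setT => //; exists setT => //; rewrite setXTT.
  - by apply/seteqP; split => // x _; exists 0%N.
  - move=> _ [A1 mA1 [B1 mB1 <-]].
    rewrite /m2 /= /kcomp /l /l0/=.
    under eq_integral => w _.
      rewrite /graph_kernel/= /pushforward/=.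
      rewrite (_ : Q w _ = Q w B1 * (\1_A1 w)%:E)%E; last first.
        rewrite indicE; have [wA|wA] := boolP (w \in A1).
          rewrite mule1; congr (Q w _); apply/seteqP; split => z /=; first by case.
          by split => //=; exact: set_mem.
        rewrite mule0 (_ : _ @^-1` _ = set0) ?measure0//.
        by apply/seteqP; split => z //= -[/=] /mem_set; rewrite (negbTE wA).
      over.
    have mi : measurable_fun setT (fun w => Q w B1 * (\1_A1 w)%:E)%E.
      apply: emeasurable_funM; first exact: measurable_kernel.
      by apply/measurable_EFinP; exact: measurable_indic.
    have i0 w : (0 <= Q w B1 * (\1_A1 w)%:E)%E.
      by rewrite mule_ge0// lee_fin indicE.
    rewrite (ge0_integral_pushforward (mW n))// preimage_setT.
    rewrite (@integral_mrestr _ _ _ P A mA _ (measurableT_comp mi (mW n))) => [|x /=]; last exact: i0.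
    (* One side of the rectangle moves into the conditioning event, which stays in the past, so the
       Markov property is applied to the other side alone. *)
    have pA1 : past W n (A `&` W n @^-1` A1).
      by apply: (@measurableI _ (g_sigma_algebraType _) A _ pA); exact: past_preimage.
    transitivity (P ((A `&` W n @^-1` A1) `&` W (n + 1) @^-1` B1)).
      rewrite /m1/= /pushforward /PA/= /mrestr setIC; congr (P _).
      by apply/seteqP; split => x /=; tauto.
    rewrite (markov_set pA1 mB1) integral_mkcondr; apply: eq_integral => x _ /=.
    rewrite patchE indicE.
    rewrite (_ : (W n x \in A1) = (x \in W n @^-1` A1)); last by apply/idP/idP; rewrite !inE.
    by case: ifP; rewrite ?mule1 ?mule0.
  - move=> _; rewrite /m1/= /pushforward preimage_setT /PA/= /mrestr setTI.
    by rewrite (le_lt_trans (probability_le1 _ _))// ltry.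
have -> : (\int[P]_(x in A) F (W n x, W (n + 1) x) = \int[m1]_y F y)%E.
  rewrite (ge0_integral_pushforward mWW)// preimage_setT.
  rewrite (@integral_mrestr _ _ _ P A mA _ (measurableT_comp mF mWW))//.
  by move=> x; exact: F0.
have -> : (\int[m1]_y F y = \int[m2]_y F y)%E.
  by apply: eq_measure_integral => G mG _; exact: m12.
rewrite integral_kcomp//.
under eq_integral do rewrite /graph_kernel/= ge0_integral_pushforward ?preimage_setT//=.
have mQF := measurable_integral_graph Q mF F0.
rewrite /l /l0/= (ge0_integral_pushforward (mW n))// => [|x _]; last exact: integral_ge0.
rewrite preimage_setT (@integral_mrestr _ _ _ P A mA _ (measurableT_comp mQF (mW n)))//.
by move=> x; exact: integral_ge0.
Qed.

End markov.

Section stationarity.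
Context {R : realType} {d d' : measure_display} {Omega : measurableType d}
  {E : measurableType d'} {P : probability Omega R}.
Variables (W : int -> {RV P >-> E}) (pi : probability E R).
Hypothesis hstat : stationary W pi.

Lemma mW n : measurable_fun setT (W n). Proof. exact: measurable_funPT. Qed.

Lemma ge0_integral_stat n (f : E -> \bar R) : measurable_fun setT f ->
  (forall z, 0 <= f z)%E -> (\int[P]_x f (W n x) = \int[pi]_z f z)%E.
Proof.
move=> mf f0.
pose m1 : {measure set E -> \bar R} :=
  measure_function_pushforward__canonical__measure_function_Measure P (mW n).
have <- : (\int[m1]_z f z = \int[pi]_z f z)%E.
  by apply: eq_measure_integral => B mB _; exact: hstat.
by rewrite (ge0_integral_pushforward (mW n))// preimage_setT.
Qed.

Lemma intg_stat n (f : E -> R) : intg pi f -> intg P (fun x => f (W n x)).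
Proof.
move=> intf; have mf := intg_measurable intf.
apply/integrableP; split; first by apply/measurable_EFinP; exact: measurableT_comp mf (mW n).
rewrite (ge0_integral_stat n (f := fun z => `|(f z)%:E|%E)).
- by have /integrableP[] := intf.
- by apply: measurableT_comp => //; exact/measurable_EFinP.
- by move=> z; rewrite abse_ge0.
Qed.

Lemma ex_stat n (f : E -> R) : intg pi f -> \int[P]_x f (W n x) = \int[pi]_z f z.
Proof.
move=> intf; have mf := intg_measurable intf; congr fine.
pose m1 : {measure set E -> \bar R} :=
  measure_function_pushforward__canonical__measure_function_Measure P (mW n).
have <- : (\int[m1]_z (f z)%:E = \int[pi]_z (f z)%:E)%E.
  by apply: eq_measure_integral => B mB _; exact: hstat.
rewrite (integral_pushforward (mW n)) ?preimage_setT//; first exact/measurable_EFinP.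
exact: intg_stat.
Qed.

Lemma L2_stat n (f : E -> R) : L2 pi f -> L2 P (fun x => f (W n x)).
Proof.
move=> [mf if2]; split; first exact: measurableT_comp mf (mW n).
exact: (intg_stat n if2).
Qed.

Lemma ae_stat n (p : E -> Prop) : {ae pi, forall z, p z} -> {ae P, forall x, p (W n x)}.
Proof.
move=> [N [mN N0 pN]]; exists (W n @^-1` N); split.
- exact: measurable_funPTI.
- by rewrite hstat.
- by move=> x /= np; apply: pN.
Qed.

End stationarity.

Section unbounded_adapted.
Context {R : realType} {d : measure_display} {T : measurableType d}.
Variables (mu : probability T R) (G : set (set T)).
Hypotheses (sG : sigma_algebra setT G) (Gm : G `<=` measurable).

(** Truncation of [xi] to [-N, N] and dominated convergence reduce this to the bounded case. It
    serves covariances, where the factor g(W_i) is merely square-integrable. *)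
Lemma ex_adapted0_unbounded (f xi : T -> R) : intg mu f ->
  (forall A, G A -> \int[mu]_(x in A) f x = 0) ->
  adapted G xi -> intg mu (fun x => xi x * f x) -> \int[mu]_x (xi x * f x) = 0.
Proof.
move=> intf f0 axi ixif.
pose xiN (N : nat) x : R := xi x * \1_(xi @^-1` `[- N%:R, N%:R]%classic) x.
have axiN N : adapted G (xiN N).
  apply: measurable_funM => //; apply: adapted_indic.
  exact: adapted_setE.
have xiNb N x : `|xiN N x| <= N%:R.
  rewrite /xiN indicE; have [/set_mem|_] := boolP (x \in _); last by rewrite mulr0 normr0.
  by rewrite /= in_itv/= mulr1 ler_norml.
have eN N : \int[mu]_x (xiN N x * f x) = 0.
  exact: (ex_adapted0 sG Gm intf f0 (@axiN N) (@xiNb N)).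
have mf := intg_measurable intf.
have mxi := adapted_measurable sG Gm axi.
have mxiN N := adapted_measurable sG Gm (@axiN N).
have H N : (\int[mu]_x (xiN N x * f x)%:E = 0)%E.
  have iN : intg mu (fun x => xiN N x * f x).
    by apply: intgM (@xiNb N) intf.
  have /fineK <- := integral_fune_fin_num measurableT iN; congr EFin; exact: eN.
have d1 N : measurable_fun setT (fun x => (xiN N x * f x)%:E).
  by apply/measurable_EFinP; exact: measurable_funM.
have d2 : measurable_fun setT (fun x => (xi x * f x)%:E).
  by apply/measurable_EFinP; exact: measurable_funM.
have d3 : {ae mu, forall x, setT x ->
    (xiN N x * f x)%:E @[N --> \oo] --> (xi x * f x)%:E}.
  apply: aeW => x _; apply: cvg_near_cst; near=> N; rewrite /xiN indicE mem_set ?mulr1//=.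
  rewrite in_itv/= -ler_norml; near: N; exact: nbhs_infty_ger.
have d5 : {ae mu, forall x, forall N, setT x ->
    (`|(xiN N x * f x)%:E| <= `|xi x * f x|%:E)%E}.
  apply: aeW => x N _; rewrite /= lee_fin [leLHS]normrM [leRHS]normrM ler_wpM2r// /xiN normrM ler_piMr//.
  exact: indic_le1.
have [_ _ +] := dominated_convergence measurableT d1 d2 d3 (intg_norm ixif) d5.
under eq_fun do rewrite H.
move=> /(cvg_unique _ (cvg_cst (0 : \bar R))) h.
by rewrite /Rintegral -h.
Unshelve. all: by end_near. Qed.

End unbounded_adapted.

Section markov_expectation.
Context {R : realType} {d d' : measure_display} {Omega : measurableType d}
  {E : measurableType d'} {P : probability Omega R}.
Variables (W : int -> {RV P >-> E}) (Q : R.-pker E ~> E).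
Hypothesis hmarkov : markov_chain W Q.

(** The version of E(f(W_n, W_{n+1}) | W_n) supplied by the kernel, as a function of the state,
    defined everywhere and the same for all n. *)
Definition ker2 (f : E * E -> R) (w : E) : R := \int[Q w]_z f (w, z).

Lemma measurable_ker2 (f : E * E -> R) : measurable_fun setT f ->
  measurable_fun setT (ker2 f).
Proof.
move=> mf; rewrite /ker2 /Rintegral.
have mF : measurable_fun setT (EFin \o f) by exact/measurable_EFinP.
have -> : (fun w => fine (\int[Q w]_z (f (w, z))%:E)) =
  fine \o (fun w => \int[Q w]_z ((EFin \o f)^\+ (w, z)) - \int[Q w]_z ((EFin \o f)^\- (w, z)))%E.
  apply/funext => w; rewrite [in LHS]integralE /=; congr (fine (_ - _)%E);
    by apply: eq_integral => z _; rewrite ?funeposE ?funenegE.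
apply: measurableT_comp => //.
apply: emeasurable_funB; apply: measurable_integral_graph => //.
  exact: measurable_funepos.
exact: measurable_funeneg.
Qed.

Lemma mWW n : measurable_fun setT (fun x => (W n x, W (n + 1) x)).
Proof. by apply: measurable_fun_pair; exact: measurable_funPT. Qed.

Lemma ae_intg_ker2 n (f : E * E -> R) : measurable_fun setT f ->
  intg P (fun x => f (W n x, W (n + 1) x)) ->
  {ae P, forall x, (Q (W n x)).-integrable setT (fun z => (f (W n x, z))%:E)}.
Proof.
move=> mf intf.
pose F p := `|(f p)%:E|%E.
have mF : measurable_fun setT F.
  by apply: measurableT_comp => //; exact/measurable_EFinP.
have F0 p : (0 <= F p)%E by exact: abse_ge0.
have pT : past W n setT by exact: (@measurableT _ (g_sigma_algebraType _)).
have H := markov_pair hmarkov pT mF F0.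
have mK : measurable_fun setT (fun x => \int[Q (W n x)]_z F (W n x, z))%E.
  exact: measurableT_comp (measurable_integral_graph Q mF F0) (measurable_funPT (W n)).
have iK : P.-integrable setT (fun x => \int[Q (W n x)]_z F (W n x, z))%E.
  apply/integrableP; split => //.
  under eq_integral do rewrite gee0_abs ?integral_ge0//.
  by rewrite -H; have /integrableP[] := intf.
have := integrable_ae measurableT iK; apply: filterS => x /= /(_ I) fx.
apply/integrableP; split.
  by apply/measurable_EFinP; apply: measurableT_comp mf _; exact: pair1_measurable.
by rewrite -ge0_fin_numE ?integral_ge0.
Qed.

Lemma ex_markov_ge0 n (f : E * E -> R) : measurable_fun setT f ->
  (forall p, 0 <= f p) -> intg P (fun x => f (W n x, W (n + 1) x)) ->
  intg P (fun x => ker2 f (W n x)) /\ forall A, past W n A ->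
    \int[P]_(x in A) f (W n x, W (n + 1) x) = \int[P]_(x in A) ker2 f (W n x).
Proof.
move=> mf f0 intf; have hae := ae_intg_ker2 mf intf.
have mF : measurable_fun setT (EFin \o f) by exact/measurable_EFinP.
have F0 p : (0 <= (EFin \o f) p)%E by rewrite /= lee_fin.
have mk : measurable_fun setT (fun x => ker2 f (W n x)).
  exact: measurableT_comp (measurable_ker2 mf) (measurable_funPT (W n)).
have mK : measurable_fun setT (fun x => \int[Q (W n x)]_z (EFin \o f) (W n x, z))%E.
  exact: measurableT_comp (measurable_integral_graph Q mF F0) (measurable_funPT (W n)).
have aeK : {ae P, forall x, (ker2 f (W n x))%:E = (\int[Q (W n x)]_z (EFin \o f) (W n x, z))%E}.
  apply: filterS hae => x ix; rewrite /ker2 /Rintegral.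
  by have /fineK -> := integral_fune_fin_num measurableT ix.
have main A : past W n A -> (\int[P]_(x in A) (f (W n x, W (n + 1) x))%:E =
    \int[P]_(x in A) (ker2 f (W n x))%:E)%E.
  move=> pA; have mA := past_measurable pA.
  rewrite (markov_pair hmarkov pA mF F0); apply: ae_eq_integral => //.
  - exact: measurable_funTS.
  - by apply: measurable_funTS; exact/measurable_EFinP.
  - by apply: filterS aeK => x /= ->.
split; last by move=> A pA; rewrite /Rintegral main.
apply/integrableP; split; first exact/measurable_EFinP.
under eq_integral do rewrite gee0_abs ?lee_fin ?Rintegral_ge0//.
have pT : past W n setT by exact: (@measurableT _ (g_sigma_algebraType _)).
rewrite -(main setT pT); have /integrableP[_] := intf.
by under eq_integral do rewrite gee0_abs ?lee_fin//.
Qed.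

Lemma ex_markov n (f : E * E -> R) : measurable_fun setT f ->
  intg P (fun x => f (W n x, W (n + 1) x)) ->
  intg P (fun x => ker2 f (W n x)) /\ forall A, past W n A ->
    \int[P]_(x in A) f (W n x, W (n + 1) x) = \int[P]_(x in A) ker2 f (W n x).
Proof.
move=> mf intf.
pose fp p := Num.max (f p) 0; pose fn p := Num.max (- f p) 0.
have fE p : f p = fp p - fn p.
  rewrite /fp /fn; case: (leP (f p) 0) => h.
    by rewrite max_l ?oppr_ge0// sub0r opprK.
  by rewrite max_r ?subr0// oppr_le0 ltW.
have mfp : measurable_fun setT fp by exact: measurable_maxr.
have mfn : measurable_fun setT fn by apply: measurable_maxr => //; exact: measurableT_comp.
have fp0 p : 0 <= fp p by rewrite le_max lexx orbT.
have fn0 p : 0 <= fn p by rewrite le_max lexx orbT.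
have fp_le p : `|fp p| <= `|f p|.
  by rewrite ger0_norm// ge_max ler_norm normr_ge0.
have fn_le p : `|fn p| <= `|f p|.
  by rewrite ger0_norm// ge_max -normrN ler_norm normr_ge0.
have ifp : intg P (fun x => fp (W n x, W (n + 1) x)).
  by apply: (intg_le _ intf) => //; exact: measurableT_comp mfp (mWW n).
have ifn : intg P (fun x => fn (W n x, W (n + 1) x)).
  by apply: (intg_le _ intf) => //; exact: measurableT_comp mfn (mWW n).
have [kp Hp] := ex_markov_ge0 mfp fp0 ifp.
have [kn Hn] := ex_markov_ge0 mfn fn0 ifn.
have mk : measurable_fun setT (fun x => ker2 f (W n x)).
  exact: measurableT_comp (measurable_ker2 mf) (measurable_funPT (W n)).
have aeK : {ae P, forall x, ker2 fp (W n x) - ker2 fn (W n x) = ker2 f (W n x)}.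
  apply: filterS2 (ae_intg_ker2 mfp ifp) (ae_intg_ker2 mfn ifn) => x ix1 ix2; rewrite /ker2 -RintegralB//.
  by apply: eq_Rintegral => z _; rewrite -fE.
have ik : intg P (fun x => ker2 f (W n x)) by apply: intg_ae mk aeK (intgB kp kn).
split => // A pA; have mA := past_measurable pA.
transitivity (\int[P]_(x in A) (ker2 fp (W n x) - ker2 fn (W n x))).
  rewrite RintegralB//; try by apply: integrableS (measurableT) _ _ _ => //.
  rewrite -Hp// -Hn// -RintegralB//; try by apply: integrableS (measurableT) _ _ _ => //.
  by apply: eq_Rintegral => x _; rewrite -fE.
congr fine; apply: ae_eq_integral => //.
- apply: measurable_funTS; apply/measurable_EFinP; apply: measurable_funB;
    [exact: intg_measurable kp|exact: intg_measurable kn].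
- by apply: measurable_funTS; exact/measurable_EFinP.
- by apply: filterS aeK => x /= -> .
Qed.

End markov_expectation.

(** * The transition operator of a reversible chain *)

Section reversible_chain.
Context {R : realType} {d d' : measure_display} {Omega : measurableType d}
  {E : measurableType d'} {P : probability Omega R}.
Variables (W : int -> {RV P >-> E}) (pi : probability E R) (Q : R.-pker E ~> E).
Hypotheses (hmarkov : markov_chain W Q) (hstat : stationary W pi).
Implicit Types f h : E -> R.

Let pT n : past W n setT.
Proof. exact: (@measurableT _ (g_sigma_algebraType _)). Qed.

Lemma measurable_kop f : measurable_fun setT f -> measurable_fun setT (kop Q f).
Proof.
move=> mf; apply: (measurable_ker2 Q (f := f \o snd)).
exact: measurableT_comp mf measurable_snd.
Qed.

Lemma intg_statW n f : measurable_fun setT f -> intg P (fun x => f (W n x)) -> intg pi f.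
Proof.
move=> mf intf; apply/integrableP; split; first exact/measurable_EFinP.
rewrite -(ge0_integral_stat hstat n (f := fun z => `|(f z)%:E|%E)).
- by have /integrableP[] := intf.
- by apply: measurableT_comp => //; exact/measurable_EFinP.
- by move=> z; rewrite abse_ge0.
Qed.

(** Invariance of [pi] gives Q|f| a finite integral, so Q|f| is finite almost everywhere. Linearity
    of [kop] is available only at such states, whence the almost-everywhere form of the rules
    below. *)
Lemma ae_intg_kop f : intg pi f -> {ae pi, forall w, (Q w).-integrable setT (EFin \o f)}.
Proof.
move=> intf; have mf := intg_measurable intf.
pose F (p : E * E) := `|(f p.2)%:E|%E.
have mF : measurable_fun setT F.
  apply: measurableT_comp => //; apply/measurable_EFinP.
  exact: measurableT_comp mf measurable_snd.
have F0 p : (0 <= F p)%E by exact: abse_ge0.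
have mK := measurable_integral_graph Q mF F0.
have iK : pi.-integrable setT (fun w => \int[Q w]_z F (w, z))%E.
  apply/integrableP; split => //.
  under eq_integral do rewrite gee0_abs ?integral_ge0//.
  rewrite -(ge0_integral_stat hstat 0 mK) => [|z]; last exact: integral_ge0.
  rewrite -(markov_pair hmarkov (@pT 0) mF F0) /F/=.
  rewrite (ge0_integral_stat hstat _ (f := fun z => `|(f z)%:E|%E)).
  - by have /integrableP[] := intf.
  - by apply: measurableT_comp => //; exact/measurable_EFinP.
  - by move=> z; rewrite abse_ge0.
have := integrable_ae measurableT iK; apply: filterS => w /= /(_ I) fw.
apply/integrableP; split; first exact/measurable_EFinP.
by rewrite -ge0_fin_numE ?integral_ge0.
Qed.

Lemma ex_kop n f : intg pi f -> intg P (fun x => kop Q f (W n x)) /\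
  forall A, past W n A ->
    \int[P]_(x in A) f (W (n + 1) x) = \int[P]_(x in A) kop Q f (W n x).
Proof.
move=> intf; have mf := intg_measurable intf.
apply: (ex_markov hmarkov (f := f \o snd)); last exact: (intg_stat hstat _ intf).
exact: measurableT_comp mf measurable_snd.
Qed.

Lemma intg_kop f : intg pi f -> intg pi (kop Q f).
Proof.
move=> intf; apply: (intg_statW (n := 0)).
  exact/measurable_kop/(intg_measurable intf).
by have [] := ex_kop 0 intf.
Qed.

Lemma ex_kop_inv f : intg pi f -> \int[pi]_w kop Q f w = \int[pi]_w f w.
Proof.
move=> intf; rewrite -(ex_stat hstat 0 (intg_kop intf)) -(ex_stat hstat (0 + 1) intf).
by have [_ ->] := ex_kop 0 intf.
Qed.

(** Jensen's inequality for the square: integrate 2 m f <= f^2 + m^2 against [Q w], of mass 1, with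
    m = Q f(w). *)
Lemma kop_sqr_le f : L2 pi f -> {ae pi, forall w, kop Q f w ^+ 2 <= kop Q (fun z => f z ^+ 2) w}.
Proof.
move=> f2; have [mf if2] := f2.
apply: filterS2 (ae_intg_kop (L2_intg f2)) (ae_intg_kop if2) => w i1 i2.
set m := kop Q f w.
have ic (r : R) : (Q w).-integrable setT (EFin \o cst r).
  rewrite (_ : EFin \o cst r = cst r%:E)//; apply/integrableP; split => //=.
  by rewrite integral_cst// (_ : Q w setT = 1%E) ?mule1 ?ltry//; exact: prob_kernel.
have i3 : (Q w).-integrable setT (EFin \o (fun z => 2 * m * f z)).
  by have := integrableZl measurableT (2 * m) i1.
have i4 : (Q w).-integrable setT (EFin \o (fun z => f z ^+ 2 + m ^+ 2)).
  by have := integrableD measurableT i2 (ic (m ^+ 2)).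
have : \int[Q w]_z (2 * m * f z) <= \int[Q w]_z (f z ^+ 2 + m ^+ 2).
  apply: le_Rintegral => // z _; have := sqr_ge0 (f z - m); lra.
rewrite RintegralZl// RintegralD//; last exact: (ic (m ^+ 2)).
have Q1 : Q w setT = 1%E by exact: prob_kernel.
rewrite Rintegral_cst// Q1/= mulr1.
rewrite -/(kop Q f w) -/(kop Q (fun z => f z ^+ 2) w) -/m; lra.
Qed.

Lemma L2_kop f : L2 pi f -> L2 pi (kop Q f).
Proof.
move=> f2; have [mf if2] := f2.
have mk := measurable_kop mf; split => //.
have ik := intg_kop if2.
(* The minimum is dominated at every point and agrees almost everywhere with the square of
   [kop Q f]. *)
pose hh w := Num.min (kop Q f w ^+ 2) (kop Q (fun z => f z ^+ 2) w).
have mh : measurable_fun setT hh.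
  by apply: measurable_minr; [exact: measurable_funX|exact: intg_measurable ik].
have k0 w : 0 <= kop Q (fun z => f z ^+ 2) w by apply: Rintegral_ge0 => z _; exact: sqr_ge0.
have ih : intg pi hh.
  apply: (intg_le mh ik) => w; rewrite !ger0_norm// ?le_min ?k0 ?sqr_ge0//.
  by rewrite /hh ge_min lexx orbT.
apply: intg_ae ih; first exact: measurable_funX.
by apply: filterS (kop_sqr_le f2) => w h; rewrite /hh min_l.
Qed.

Lemma kop_contr f : L2 pi f -> \int[pi]_w (kop Q f w ^+ 2) <= \int[pi]_w (f w ^+ 2).
Proof.
move=> f2; have [mf if2] := f2; have [mk ik2] := L2_kop f2.
have ik := intg_kop if2.
rewrite -(ex_kop_inv if2).
have k0 w : 0 <= kop Q (fun z => f z ^+ 2) w by apply: Rintegral_ge0 => z _; exact: sqr_ge0.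
pose hh w := Num.max (kop Q f w ^+ 2) (kop Q (fun z => f z ^+ 2) w).
have mh : measurable_fun setT hh.
  by apply: measurable_maxr; [exact: measurable_funX|exact: intg_measurable ik].
have eh : {ae pi, forall w, kop Q (fun z => f z ^+ 2) w = hh w}.
  by apply: filterS (kop_sqr_le f2) => w h; rewrite /hh max_r.
rewrite (ex_ae (intg_measurable ik) mh eh); apply: ex_le => //.
  exact: intg_ae mh eh ik.
by move=> w; rewrite /hh le_max lexx.
Qed.

Lemma kopD f h : intg pi f -> intg pi h ->
  {ae pi, forall w, kop Q (fun z => f z + h z) w = kop Q f w + kop Q h w}.
Proof.
move=> i1 i2; apply: filterS2 (ae_intg_kop i1) (ae_intg_kop i2) => w j1 j2.
by rewrite /kop RintegralD.
Qed.

Lemma kopZ (r : R) f : intg pi f ->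
  {ae pi, forall w, kop Q (fun z => r * f z) w = r * kop Q f w}.
Proof.
move=> i1; apply: filterS (ae_intg_kop i1) => w j1.
by rewrite /kop RintegralZl.
Qed.

Lemma kop_sum (I : Type) (s : seq I) (F : I -> E -> R) : (forall i, intg pi (F i)) ->
  {ae pi, forall w, kop Q (fun z => \sum_(i <- s) F i z) w = \sum_(i <- s) kop Q (F i) w}.
Proof.
move=> iF; elim: s => [|i s IH].
  apply: aeW => w; rewrite big_nil /kop.
  under eq_Rintegral do rewrite big_nil.
  by rewrite Rintegral_cst// mul0r.
apply: filterS2 IH (kopD (iF i) (intg_sum s iF)) => w h1 h2.
rewrite big_cons -h1 -h2; apply: eq_Rintegral => z _.
by rewrite big_cons.
Qed.

Lemma ex_prod n f h : L2 pi f -> L2 pi h ->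
  \int[P]_x (f (W n x) * h (W (n + 1) x)) = \int[pi]_w (f w * kop Q h w).
Proof.
move=> f2 h2; have mf := L2_measurable f2; have mh := L2_measurable h2.
pose F (p : E * E) := f p.1 * h p.2.
have mF : measurable_fun setT F.
  apply: measurable_funM.
    exact: measurableT_comp mf measurable_fst.
  exact: measurableT_comp mh measurable_snd.
have iF : intg P (fun x => F (W n x, W (n + 1) x)).
  exact: L2M (L2_stat hstat n f2) (L2_stat hstat (n + 1) h2).
have [ik /(_ setT (@pT n)) ->] := ex_markov hmarkov mF iF.
have ifk : intg pi (fun w => f w * kop Q h w) by apply: L2M => //; exact: L2_kop.
rewrite -(ex_stat hstat n ifk); apply: ex_ae.
- exact: intg_measurable ik.
- exact: intg_measurable (intg_stat hstat n ifk).
- apply: (ae_stat hstat n (p := fun w => ker2 Q F w = f w * kop Q h w)).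
  by apply: filterS (ae_intg_kop (L2_intg h2)) => w jw; rewrite /ker2 /F/= RintegralZl.
Qed.

Hypothesis hrev : reversible pi Q.

Lemma rev_set n A B : measurable A -> measurable B ->
  P (W n @^-1` A `&` W (n + 1) @^-1` B) = P (W n @^-1` B `&` W (n + 1) @^-1` A).
Proof.
move=> mA mB.
have main X Y : measurable X -> measurable Y ->
    P (W n @^-1` X `&` W (n + 1) @^-1` Y) = (\int[pi]_(w in X) Q w Y)%E.
  move=> mX mY; rewrite (markov_set hmarkov (past_preimage (lexx n) mX) mY).
  rewrite integral_mkcond [RHS]integral_mkcond.
  rewrite -(ge0_integral_stat hstat n); last 2 first.
  - apply/(measurable_restrictT _ mX); apply: measurable_funTS.
    exact: measurable_kernel.
  - by move=> z; rewrite patchE; case: ifP.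
  apply: eq_integral => x _; rewrite !patchE.
  by rewrite (_ : (x \in W n @^-1` X) = (W n x \in X))//; apply/idP/idP; rewrite !inE.
by rewrite !main//; exact: hrev.
Qed.

(** Detailed balance says that (W_n, W_{n+1}) and its swap give equal mass to rectangles, hence have
    the same law. Self-adjointness of Q then follows by swapping in f(x) h(y), without passing
    through simple functions. *)
Lemma rev_pair n (F : E * E -> R) : measurable_fun setT F ->
  intg P (fun x => F (W n x, W (n + 1) x)) ->
  intg P (fun x => F (W (n + 1) x, W n x)) ->
  \int[P]_x F (W n x, W (n + 1) x) = \int[P]_x F (W (n + 1) x, W n x).
Proof.
move=> mF i1 i2; congr fine.
have mw1 := mWW W n.
have mw2 : measurable_fun setT (fun x => (W (n + 1) x, W n x)).
  by apply: measurable_fun_pair; exact: measurable_funPT.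
pose m1 : {measure set (E * E) -> \bar R} :=
  measure_function_pushforward__canonical__measure_function_Measure P mw1.
pose m2 : {measure set (E * E) -> \bar R} :=
  measure_function_pushforward__canonical__measure_function_Measure P mw2.
transitivity (\int[m1]_y (F y)%:E)%E.
  by rewrite (integral_pushforward mw1) ?preimage_setT//; exact/measurable_EFinP.
transitivity (\int[m2]_y (F y)%:E)%E; last first.
  by rewrite (integral_pushforward mw2) ?preimage_setT//; exact/measurable_EFinP.
apply: eq_measure_integral => G mG _.
apply: (measure_unique [set A `*` B | A in measurable & B in measurable]
    (fun=> setT)) => //.
- exact: measurable_prod_measurableType.
- move=> _ _ [X1 mX1 [X2 mX2 <-]] [Y1 mY1 [Y2 mY2 <-]].
  exists (X1 `&` Y1); first exact: measurableI.
  by exists (X2 `&` Y2); [exact: measurableI|rewrite setXI].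
- by move=> _; exists setT => //; exists setT => //; rewrite setXTT.
- by apply/seteqP; split => // x _; exists 0%N.
- move=> _ [A1 mA1 [B1 mB1 <-]]; rewrite /m1 /m2/= /pushforward.
  transitivity (P (W n @^-1` A1 `&` W (n + 1) @^-1` B1)); first by congr (P _).
  by rewrite rev_set//; congr (P _); apply/seteqP; split => x /= [].
- move=> _; rewrite /m1/= /pushforward preimage_setT.
  by rewrite (le_lt_trans (probability_le1 _ _))// ltry.
Qed.

Lemma kop_sym f h : L2 pi f -> L2 pi h ->
  \int[pi]_w (f w * kop Q h w) = \int[pi]_w (kop Q f w * h w).
Proof.
move=> f2 h2; rewrite -(ex_prod 0 f2 h2).
have -> : \int[pi]_w (kop Q f w * h w) = \int[pi]_w (h w * kop Q f w).
  by apply: eq_Rintegral => w _; rewrite mulrC.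
rewrite -(ex_prod 0 h2 f2).
have -> : \int[P]_x (h (W 0 x) * f (W (0 + 1) x)) =
  \int[P]_x (f (W (0 + 1) x) * h (W 0 x)).
  by apply: eq_Rintegral => w _; rewrite mulrC.
have mf := L2_measurable f2; have mh := L2_measurable h2.
apply: (rev_pair (F := fun p => f p.1 * h p.2)).
- apply: measurable_funM.
    exact: measurableT_comp mf measurable_fst.
  exact: measurableT_comp mh measurable_snd.
- exact: L2M (L2_stat hstat 0 f2) (L2_stat hstat (0 + 1) h2).
- exact: L2M (L2_stat hstat (0 + 1) f2) (L2_stat hstat 0 h2).
Qed.

End reversible_chain.

(** * Martingale approximation *)

Section covariance_algebra.
Context {R : realType}.
Variables (s c : nat -> R).
Hypotheses (sS : forall n, s n.+1 = s n + c 0%N + 2 * \sum_(1 <= i < n.+1) c i).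

(** Passing to n + 1 borders the square of indices with two strips and a corner, which adds 2
    (C_{2n+1} - C_{n+1}) + c_{2n+2}, where C denotes partial sums of [c]. The increments of [s] are
    c_0 + 2 C, so the right side grows by the same amount. *)
Lemma double_sum_cov n :
  \sum_(1 <= i < n.+1) \sum_(1 <= j < n.+1) c (i + j)%N =
  (s n.*2.+1 - 2 * s n.+1 + s 1%N) / 2.
Proof.
pose C m := \sum_(1 <= i < m.+1) c i.
have sSC m : s m.+1 = s m + c 0%N + 2 * C m by exact: sS.
elim: n => [|n IH].
  by rewrite big_nil double0; field.
have shift : \sum_(1 <= i < n.+1) c (i + n.+1)%N = C (n.*2.+1) - C n.+1.
  rewrite /C (big_cat_nat _ (n := n.+2) (p := n.*2.+2))//=; last first.
    by rewrite ltnS ltnS -addnn leq_addr.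
  rewrite addrAC subrr add0r -{1}(add1n n.+1) big_addn.
  by rewrite (_ : (n.*2.+2 - n.+1 = n.+1)%N)// -addnn -addSn -addnS addnK.
have -> : \sum_(1 <= i < n.+2) \sum_(1 <= j < n.+2) c (i + j)%N =
  \sum_(1 <= i < n.+1) \sum_(1 <= j < n.+1) c (i + j)%N
  + 2 * (C (n.*2.+1) - C n.+1) + c n.*2.+2.
  rewrite big_nat_recr//=.
  under eq_bigr do rewrite big_nat_recr//=.
  rewrite big_split/= shift [\sum_(1 <= j < n.+2) _]big_nat_recr//=.
  under [\sum_(1 <= j < n.+1) c (n.+1 + j)%N]eq_bigr do rewrite addnC.
  rewrite shift addnn doubleS; ring.
rewrite IH doubleS.
have e1 := sSC n.*2.+2; have e2 := sSC n.*2.+1; have e3 := sSC n.+1.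
have e4 : C n.*2.+2 = C n.*2.+1 + c n.*2.+2 by rewrite /C big_nat_recr.
lra.
Qed.

Hypotheses (c_sqr : forall j, 0 <= c j.*2 + 2 * c j.*2.+1 + c j.*2.+2)
  (c_dec : forall j, c j.*2.+2 <= c j.*2).

(* [c i = <g, Q^i g>] may be negative for odd [i], so [s] need not be monotone. *)
Lemma cov_step2 n : s n <= s n.+2.
Proof.
pose C m := \sum_(1 <= i < m.+1) c i.
have sSC m : s m.+1 = s m + c 0%N + 2 * C m by exact: sS.
have CS m : C m.+1 = C m + c m.+1 by rewrite /C big_nat_recr.
have C0 : C 0%N = 0 by rewrite /C big_nil.
pose B m := c 0%N + C m + C m.+1.
(* [s n.+2 - s n] is twice [B n]. From an odd index, two steps add c_{2j} + 2 c_{2j+1} + c_{2j+2} to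
   [B], in the application the squared norm of Q^j g + Q^{j+1} g; a positive even index lies c_{2j}
   + c_{2j+1} above the odd one before it. *)
suff B0 m : 0 <= B m by have := B0 n; rewrite /B 2!sSC; lra.
have c1 j : 0 <= c j.*2 + c j.*2.+1 by have := c_sqr j; have := c_dec j; lra.
have Bodd m' : 0 <= B m'.*2.+1.
  elim: m' => [|m' IH]; first by have := c_sqr 0; rewrite /B !CS C0 double0; lra.
  have := c_sqr m'.+1; move: IH; rewrite /B doubleS !CS; lra.
rewrite -[m]odd_double_half; case: (odd m); first by rewrite add1n; exact: Bodd.
rewrite add0n; case: (m./2) => [|k]; first by have := c1 0%N; rewrite /B double0 CS C0; lra.
by have := Bodd k; have := c1 k.+1; rewrite /B doubleS !CS; lra.
Qed.

End covariance_algebra.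

Lemma sqr_sum_le {R : realType} (a : nat -> R) n :
  (\sum_(1 <= i < n.+1) a i) ^+ 2 <= n%:R * \sum_(1 <= i < n.+1) a i ^+ 2.
Proof.
case: n => [|n]; first by rewrite !big_nil expr0n/= mul0r.
set S := \sum_(_ <= _ < _) a _; set N : R := n.+1%:R.
have N0 : 0 < N by rewrite ltr0n.
have : 0 <= \sum_(1 <= i < n.+2) (a i - S / N) ^+ 2.
  by apply: sumr_ge0 => i _; exact: sqr_ge0.
rewrite (eq_bigr (fun i => a i ^+ 2 + (- 2 * (S / N)) * a i + (S / N) ^+ 2)); last first.
  by move=> i _; ring.
rewrite !big_split/= -mulr_sumr -/S sumr_const_nat subn1/= -[_ *+ n.+1]mulr_natl -/N => h.
have -> : S ^+ 2 = N * (S ^+ 2 / N) by field; rewrite gt_eqF.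
rewrite ler_pM2l// -subr_ge0; apply: le_trans h _.
rewrite le_eqVlt; apply/orP; left; apply/eqP; field.
by rewrite gt_eqF.
Qed.

Section chain_sums.
Context {R : realType} {d d' : measure_display} {Omega : measurableType d}
  {E : measurableType d'} {P : probability Omega R}.
Variables (W : int -> {RV P >-> E}) (pi : probability E R) (Q : R.-pker E ~> E).
Hypotheses (hmarkov : markov_chain W Q) (hstat : stationary W pi)
  (hrev : reversible pi Q).
Variable g : E -> R.
Hypothesis g2 : L2 pi g.
Implicit Types f h : E -> R.

Definition qpow i : E -> R := iter i (kop Q) g.

Lemma L2_iter i f : L2 pi f -> L2 pi (iter i (kop Q) f).
Proof. by move=> f2; elim: i => [|i IH] //=; exact: (L2_kop hmarkov hstat IH). Qed.

Lemma L2_qpow i : L2 pi (qpow i). Proof. exact: L2_iter. Qed.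

Definition cov m : R := \int[pi]_w (g w * qpow m w).

(** Self-adjointness moves one power of Q at a time to the other factor; this is where reversibility
    enters the variance computation. *)
Lemma ex_qpow i j : \int[pi]_w (qpow i w * qpow j w) = cov (i + j).
Proof.
elim: i j => [|i IH] j; first by rewrite add0n.
rewrite addSnnS -IH.
by have := kop_sym hmarkov hstat hrev (L2_qpow i) (L2_qpow j) => /= ->.
Qed.

Lemma adapted_W n m f : m <= n -> measurable_fun setT f ->
  adapted (past W n) (fun x => f (W m x)).
Proof.
move=> mn mf; apply/(adaptedP (past_sigma W n)) => B mB.
by apply: (past_preimage (B := f @^-1` B)) => //; exact: measurable_preimT.
Qed.

(** Conditioning on the past at time i + m replaces the last step of the chain by one application of
    Q, so [f] has to vary in the induction. *)
Lemma ex_tower (i : int) m f : L2 pi f ->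
  \int[P]_x (g (W i x) * f (W (i + m%:Z) x)) = \int[pi]_w (g w * iter m (kop Q) f w).
Proof.
elim: m f => [|m IH] f f2.
  rewrite addr0/= -(ex_stat hstat i (f := fun w => g w * f w))//.
  exact: L2M.
rewrite iterSr -IH; last exact: (L2_kop hmarkov hstat f2).
rewrite -addn1 PoszD addrA.
set n := i + m%:Z.
have gW : L2 P (fun x => g (W i x)) by exact: (L2_stat hstat _ g2).
have fW : L2 P (fun x => f (W (n + 1) x)) by exact: (L2_stat hstat _ f2).
have kW : L2 P (fun x => kop Q f (W n x)).
  by apply: (L2_stat hstat); exact: (L2_kop hmarkov hstat f2).
apply/eqP; rewrite -subr_eq0 -exB; [|exact: L2M|exact: L2M].
pose Z x := f (W (n + 1) x) - kop Q f (W n x).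
have Z2 : L2 P Z by exact: L2B.
have -> : \int[P]_x (g (W i x) * f (W (n + 1) x) - g (W i x) * kop Q f (W n x)) =
  \int[P]_x (g (W i x) * Z x).
  by apply: eq_Rintegral => x _; rewrite mulrBr.
apply/eqP; apply: (ex_adapted0_unbounded (past_sigma W n) (@past_measurable _ _ _ _ _ _ W n)).
- exact: L2_intg Z2.
- move=> A pA; have mA := past_measurable pA.
  have [ik H] := ex_kop hmarkov hstat n (L2_intg f2).
  rewrite RintegralB//; first by rewrite H// subrr.
    by apply: integrableS (measurableT) _ _ (L2_intg fW).
  by apply: integrableS (measurableT) _ _ ik.
- by apply: adapted_W; [rewrite lerDl|exact: L2_measurable g2].
- exact: L2M.
Qed.

Lemma L2_gW n : L2 P (fun x => g (W n x)). Proof. exact: (L2_stat hstat n g2). Qed.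

Lemma ex_gW (i : int) m : \int[P]_x (g (W i x) * g (W (i + m%:Z) x)) = cov m.
Proof. exact: ex_tower. Qed.

Lemma L2_Sn n : L2 P (Sn W g n).
Proof. by apply: L2_sum => k; exact: L2_gW. Qed.

Definition ssq n : R := \int[P]_x (Sn W g n x ^+ 2).

Lemma sigmaE n : sigma W g n ^+ 2 = ssq n.
Proof.
rewrite /sigma sqr_sqrtr; first by rewrite unlock.
by rewrite fine_ge0// expectation_ge0// => x; exact: sqr_ge0.
Qed.

Lemma ssq_ge0 n : 0 <= ssq n.
Proof. by rewrite -sigmaE sqr_ge0. Qed.

Lemma SnS n x : Sn W g n.+1 x = Sn W g n x + g (W n.+1%:Z x).
Proof. by rewrite /Sn big_nat_recr. Qed.

Lemma cov0E : cov 0 = \int[pi]_w (g w ^+ 2).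
Proof. by apply: eq_Rintegral => w _; rewrite expr2. Qed.

Lemma ex_gW2 n : \int[P]_x (g (W n x) ^+ 2) = cov 0.
Proof. by rewrite cov0E (ex_stat hstat n (f := fun w => g w ^+ 2))//; case: g2. Qed.

Lemma ssqS n : ssq n.+1 = ssq n + cov 0 + 2 * \sum_(1 <= i < n.+1) cov i.
Proof.
have SG : intg P (fun x => Sn W g n x * g (W n.+1%:Z x)) by exact: L2M (L2_Sn n) (L2_gW _).
have [_ iS] := L2_Sn n; have [_ iG] := L2_gW n.+1%:Z.
rewrite /ssq.
have -> : \int[P]_x (Sn W g n.+1 x ^+ 2) = \int[P]_x (Sn W g n x ^+ 2 + g (W n.+1%:Z x) ^+ 2 + 2 * (Sn W g n x * g (W n.+1%:Z x))).
  by apply: eq_Rintegral => x _; rewrite SnS; ring.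
rewrite exD; [|exact: intgD|exact: intgZ].
rewrite exD// exZ// ex_gW2; congr (_ + _ + 2 * _).
rewrite /Sn; under eq_Rintegral do rewrite mulr_suml.
rewrite ex_sum => [|k]; last exact: L2M (L2_gW _) (L2_gW _).
(* Reversing the summation matches time k with lag n + 1 - k. *)
rewrite [RHS]big_nat_rev/= [LHS]big_nat [RHS]big_nat; apply: eq_bigr => k /andP[k1 kn].
rewrite -(ex_gW k%:Z); congr Rintegral; apply/funext => x; congr (_ * g (W _ x)).
by rewrite add1n subSS -PoszD subnKC// ltnW.
Qed.

(** Young's inequality 2ab <= h a^2 + b^2 / h, obtained from (h a - b)^2 / h >= 0. *)
Lemma ssq_step1 n (h : R) : 0 < h -> ssq n.+1 <= (1 + h) * ssq n + (1 + h^-1) * cov 0.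
Proof.
move=> h0; have [_ iS] := L2_Sn n; have [_ iG] := L2_gW n.+1%:Z.
rewrite -(ex_gW2 n.+1%:Z) /ssq -!exZ// -exD; [|exact: intgZ|exact: intgZ].
apply: ex_le; [by case: (L2_Sn n.+1)|by apply: intgD; exact: intgZ|].
move=> x; rewrite SnS; set a := Sn _ _ _ _; set b := g _.
have : 0 <= (h * a - b) ^+ 2 / h by rewrite divr_ge0 ?sqr_ge0// ltW.
have -> : (h * a - b) ^+ 2 / h = h * a ^+ 2 - 2 * a * b + h^-1 * b ^+ 2.
  by field; rewrite gt_eqF.
by lra.
Qed.

(** Explicit sum standing for Q V_i g: [kop] of [Vsum] equals it only almost everywhere, whereas
    [poisson_eq] is wanted at every state. *)
Definition Usum i (w : E) : R := \sum_(1 <= j < i.+1) qpow j w.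

Lemma L2_Usum i : L2 pi (Usum i).
Proof. by apply: L2_sum => j; exact: L2_qpow. Qed.

Definition usq i : R := \int[pi]_w (Usum i w ^+ 2).

Lemma usqE n : usq n = (ssq n.*2.+1 - 2 * ssq n.+1 + ssq 1) / 2.
Proof.
rewrite -(double_sum_cov ssqS) /usq /Usum.
under eq_Rintegral do rewrite expr2 mulr_suml.
rewrite ex_sum => [|i]; last by apply: L2M; [exact: L2_qpow|exact: L2_Usum].
apply: eq_bigr => i _; under eq_Rintegral do rewrite mulr_sumr.
rewrite ex_sum => [|j]; last by apply: L2M; exact: L2_qpow.
by apply: eq_bigr => j _; rewrite ex_qpow.
Qed.

Lemma ssq_step2 n : ssq n <= ssq n.+2.
Proof.
apply: (cov_step2 ssqS) => j; rewrite -!addnn.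
  have q1 := L2_qpow j; have q2 := L2_qpow j.+1.
  have [_ i1] := q1; have [_ i2] := q2; have i3 := L2M q1 q2.
  have : 0 <= \int[pi]_w ((qpow j w + qpow j.+1 w) ^+ 2).
    by apply: Rintegral_ge0 => w _; exact: sqr_ge0.
  have -> : \int[pi]_w ((qpow j w + qpow j.+1 w) ^+ 2) =
     \int[pi]_w (qpow j w ^+ 2 + 2 * (qpow j w * qpow j.+1 w) + qpow j.+1 w ^+ 2).
    by apply: eq_Rintegral => w _; ring.
  rewrite exD//; last by apply: intgD => //; exact: intgZ.
  rewrite exD//; last exact: intgZ.
  rewrite exZ//.
  have e k : \int[pi]_w (qpow k w ^+ 2) = cov (k + k) by rewrite -ex_qpow.
  by rewrite !e ex_qpow !addnS !addSn.
have := kop_contr hmarkov hstat (L2_qpow j).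
have e k : \int[pi]_w (qpow k w ^+ 2) = cov (k + k) by rewrite -ex_qpow.
by rewrite (e j.+1) e addnS addSn.
Qed.

Definition Ubar n (w : E) : R := (\sum_(1 <= i < n.+1) Usum i w) / n%:R.

Lemma ae_sum (I : Type) (s : seq I) (F G : I -> E -> R) :
  (forall i, {ae pi, forall w, F i w = G i w}) ->
  {ae pi, forall w, \sum_(i <- s) F i w = \sum_(i <- s) G i w}.
Proof.
move=> FG; elim: s => [|i s IH]; first by apply: aeW => w; rewrite !big_nil.
by apply: filterS2 IH (FG i) => w h1 h2; rewrite !big_cons h1 h2.
Qed.

Lemma L2_Vsum i : L2 pi (Vsum Q i g).
Proof. by apply: L2_sum => j; exact: L2_iter. Qed.

Lemma VbarE n w : Vbar Q n g w = n%:R^-1 * \sum_(1 <= i < n.+1) Vsum Q i g w.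
Proof. by rewrite /Vbar mulrC. Qed.

Lemma L2_Vbar n : L2 pi (Vbar Q n g).
Proof.
rewrite (_ : Vbar Q n g = fun w => n%:R^-1 * \sum_(1 <= i < n.+1) Vsum Q i g w).
  by apply: L2Z; apply: L2_sum => i; exact: L2_Vsum.
by apply/funext => w; exact: VbarE.
Qed.

Lemma L2_Ubar n : L2 pi (Ubar n).
Proof.
rewrite (_ : Ubar n = fun w => n%:R^-1 * \sum_(1 <= i < n.+1) Usum i w).
  by apply: L2Z; apply: L2_sum => i; exact: L2_Usum.
by apply/funext => w; rewrite /Ubar mulrC.
Qed.

Lemma kop_Vsum i : {ae pi, forall w, kop Q (Vsum Q i g) w = Usum i w}.
Proof.
have iq (j : 'I_i) : intg pi (qpow j) by exact: L2_intg (L2_qpow j).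
have := kop_sum hmarkov hstat (index_enum 'I_i) iq; apply: filterS => w.
by rewrite /Vsum => ->; rewrite /Usum big_add1/= big_mkord.
Qed.

Lemma kop_Vbar n : {ae pi, forall w, kop Q (Vbar Q n g) w = Ubar n w}.
Proof.
have iV i : intg pi (Vsum Q i g) by exact: L2_intg (L2_Vsum i).
have h1 := kop_sum hmarkov hstat (index_iota 1 n.+1) iV.
have h2 := ae_sum (index_iota 1 n.+1) kop_Vsum.
have h3 := kopZ hmarkov hstat n%:R^-1 (intg_sum (index_iota 1 n.+1) iV).
apply: filterS3 h1 h2 h3 => w e1 e2 e3.
rewrite (_ : Vbar Q n g = fun w => n%:R^-1 * \sum_(1 <= i < n.+1) Vsum Q i g w); last first.
  by apply/funext => z; exact: VbarE.
by rewrite e3 e1 e2 /Ubar mulrC.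
Qed.

(* [g = (I - Q) Vbar_n g + Q V_n g / n], with [Ubar n] for [Q Vbar_n g] and
   [Usum n] for [Q V_n g]. *)
Lemma poisson_eq n w : (0 < n)%N -> Vbar Q n g w - Ubar n w = g w - Usum n w / n%:R.
Proof.
move=> n0; have n0' : (n%:R : R) != 0 by rewrite pnatr_eq0 -lt0n.
rewrite /Vbar /Ubar -mulrBl -sumrB.
have V i : Vsum Q i g w - Usum i w = g w - qpow i w.
  rewrite /Vsum /Usum big_add1/= big_mkord.
  have := big_ord_recl i (fun j : 'I_i.+1 => qpow j w) (op := +%R) (idx := 0).
  rewrite big_ord_recr/= => h.
  have : \sum_(j < i) qpow j w + qpow i w = g w + \sum_(j < i) qpow j.+1 w by exact: h.
  by rewrite /qpow => h'; lra.
under eq_bigr do rewrite V.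
rewrite sumrB sumr_const_nat subn1/= -/(Usum n w) -mulr_natl; field.
exact: n0'.
Qed.

Lemma L2_Dnk n k : L2 P (Dnk W Q g n k).
Proof.
apply: L2B; first exact: (L2_stat hstat _ (L2_Vbar n)).
exact: (L2_stat hstat _ (L2_kop hmarkov hstat (L2_Vbar n))).
Qed.

(** Along the path [poisson_eq] telescopes the remainder to an average of Q V_n g at W_1, ..., W_n
    plus boundary terms Q Vbar_n g at W_0 and W_n. By stationarity and Cauchy-Schwarz the average
    has mean square at most [usq n], and each boundary term at most the mean of the [usq i]. *)
Lemma remainder_le n : (0 < n)%N ->
  \int[P]_x ((Sn W g n x - \sum_(1 <= k < n.+1) Dnk W Q g n k x) ^+ 2) <=
  3 * (usq n + 2 * ((\sum_(1 <= i < n.+1) usq i) / n%:R)).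
Proof.
move=> n0; have n0' : 0 < n%:R :> R by rewrite ltr0n.
pose A x := (\sum_(1 <= k < n.+1) Usum n (W k%:Z x)) / n%:R.
pose rem x := A x + Ubar n (W 0 x) - Ubar n (W n%:Z x).
have hae k : {ae P, forall x, Dnk W Q g n k x = Vbar Q n g (W k%:Z x) - Ubar n (W (k%:Z - 1) x)}.
  by apply: filterS (ae_stat hstat (k%:Z - 1) (kop_Vbar n)) => x; rewrite /Dnk => ->.
have hae2 : {ae P, forall x, \sum_(1 <= k < n.+1) Dnk W Q g n k x =
    \sum_(1 <= k < n.+1) (Vbar Q n g (W k%:Z x) - Ubar n (W (k%:Z - 1) x))}.
  elim: (index_iota _ _) => [|k s IH]; first by apply: aeW => w; rewrite !big_nil.
  by apply: filterS2 IH (hae k) => w h1 h2; rewrite !big_cons h1 h2.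
have hrem : {ae P, forall x, (Sn W g n x - \sum_(1 <= k < n.+1) Dnk W Q g n k x) ^+ 2 = rem x ^+ 2}.
  apply: filterS hae2 => x ->; congr (_ ^+ 2); rewrite /Sn -sumrB.
  transitivity (\sum_(1 <= k < n.+1) (Usum n (W k%:Z x) / n%:R -
      (Ubar n (W k%:Z x) - Ubar n (W (k%:Z - 1) x)))).
    by apply: eq_bigr => k _; have := poisson_eq (W k%:Z x) n0; lra.
  rewrite sumrB -mulr_suml -/(A x) /rem -addrA; congr (_ + _).
  rewrite big_add1/=.
  rewrite (eq_bigr (fun k : nat => Ubar n (W k.+1%:Z x) - Ubar n (W k%:Z x))); last first.
    by move=> k _; rewrite -addn1 PoszD addrK.
  by rewrite (telescope_sumr (fun k : nat => Ubar n (W k%:Z x)))// opprB.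
have LU k : L2 P (fun x => Usum n (W k%:Z x)) by exact: (L2_stat hstat _ (L2_Usum n)).
have LUb m : L2 P (fun x => Ubar n (W m x)) by exact: (L2_stat hstat _ (L2_Ubar n)).
have LA : L2 P A.
  rewrite (_ : A = fun x => n%:R^-1 * \sum_(1 <= k < n.+1) Usum n (W k%:Z x)).
    by apply: L2Z; apply: L2_sum => k; exact: LU.
  by apply/funext => x; rewrite /A mulrC.
have Lrem : L2 P rem by apply: L2B => //; exact: L2D.
have LD : L2 P (fun x => \sum_(1 <= k < n.+1) Dnk W Q g n k x).
  by apply: L2_sum => k; exact: L2_Dnk.
have [mL _] := L2B (L2_Sn n) LD; have [mR iR] := Lrem.
rewrite (ex_ae _ _ hrem); [|exact: measurable_funX|exact: measurable_funX].
have [_ iA] := LA; have [_ i0] := LUb 0; have [_ i1] := LUb n%:Z.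
have UB m : \int[P]_x (Ubar n (W m x) ^+ 2) <= (\sum_(1 <= i < n.+1) usq i) / n%:R.
  have [_ iU] := L2_Ubar n.
  rewrite (ex_stat hstat m iU) mulrC /usq -ex_sum => [|i]; last by case: (L2_Usum i).
  rewrite -exZ; last by apply: intg_sum => i; case: (L2_Usum i).
  apply: ex_le => //; first by apply: intgZ; apply: intg_sum => i; case: (L2_Usum i).
  move=> w; rewrite /Ubar exprMn mulrC -ler_pdivlMl ?exprn_gt0 ?invr_gt0//.
  apply: (le_trans (sqr_sum_le _ _)); rewrite le_eqVlt; apply/orP; left; apply/eqP.
  by field; rewrite gt_eqF.
have AB : \int[P]_x (A x ^+ 2) <= usq n.
  have iU k : intg P (fun x => Usum n (W k%:Z x) ^+ 2) by case: (LU k).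
  have -> : usq n = n%:R^-1 * \int[P]_x (\sum_(1 <= k < n.+1) Usum n (W k%:Z x) ^+ 2).
    rewrite ex_sum//.
    rewrite (eq_bigr (fun=> usq n)); last first.
      move=> k _; rewrite (ex_stat hstat k%:Z (f := fun w => Usum n w ^+ 2))//.
      by case: (L2_Usum n).
    by rewrite sumr_const_nat subn1/= -[usq n *+ n]mulr_natl mulKf// gt_eqF.
  rewrite -exZ; last exact: intg_sum.
  apply: ex_le => //; first by apply: intgZ; exact: intg_sum.
  move=> x; rewrite /A exprMn mulrC -ler_pdivlMl ?exprn_gt0 ?invr_gt0//.
  apply: (le_trans (sqr_sum_le _ _)); rewrite le_eqVlt; apply/orP; left; apply/eqP.
  by field; rewrite gt_eqF.
apply: (@le_trans _ _ (3 * \int[P]_x (A x ^+ 2 + Ubar n (W 0 x) ^+ 2 + Ubar n (W n%:Z x) ^+ 2))).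
  rewrite -exZ; last by do 2 apply: intgD => //.
  apply: ex_le => //; first by apply: intgZ; do 2 apply: intgD => //.
  move=> x; rewrite /rem; move: (A x) (Ubar n (W 0 x)) (Ubar n (W n%:Z x)) => a b1 b2.
  (* The gap in (a + b1 - b2)^2 <= 3 (a^2 + b1^2 + b2^2) is exactly the sum of these three
     squares. *)
  have := sqr_ge0 (a - b1); have := sqr_ge0 (a + b2); have := sqr_ge0 (b1 + b2); lra.
rewrite exD//; last exact: intgD.
rewrite exD//; have := UB 0; have := UB n%:Z; lra.
Qed.

End chain_sums.

(** * Levy metric *)

Section levy.
Context {R : realType}.
Implicit Types (mu nu : probability (measurableTypeR R) R) (e h x : R).

Let levy_set mu nu : set R := [set e | 0 < e /\ forall x,
    dist_fun mu (x - e) - e <= dist_fun nu x <= dist_fun mu (x + e) + e].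

Lemma levy_set_nonempty mu nu : levy_set mu nu !=set0.
Proof.
exists 1; split => // x.
have := dist_fun_ge0 mu (x - 1); have := dist_fun_le1 mu (x - 1).
have := dist_fun_ge0 mu (x + 1); have := dist_fun_le1 mu (x + 1).
have := dist_fun_ge0 nu x; have := dist_fun_le1 nu x.
by move=> *; apply/andP; split; lra.
Qed.

Lemma levy_set_lb mu nu : lbound (levy_set mu nu) 0.
Proof. by move=> e [/ltW]. Qed.

Lemma levy_ge0 mu nu : 0 <= levy_dist mu nu.
Proof. by apply: lb_le_inf; [exact: levy_set_nonempty|exact: levy_set_lb]. Qed.

Lemma levy_le mu nu e : levy_set mu nu e -> levy_dist mu nu <= e.
Proof. by move=> se; apply: ge_inf => //; exists 0; exact: levy_set_lb. Qed.

(** Monotonicity allows the level and the points to be restricted to rationals, at the price of some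
    slack in the level. The condition becomes countable, which is what makes the level sets of the
    distance measurable. *)
Lemma levy_ltP mu nu e : levy_dist mu nu < e <->
  exists q : rat, (0 < ratr q :> R) && (ratr q < e) /\ forall r : rat,
    dist_fun mu (ratr r - ratr q) - ratr q <= dist_fun nu (ratr r) <=
    dist_fun mu (ratr r + ratr q) + ratr q.
Proof.
split=> [|[q [/andP[q0 qe] H]]].
  move=> /inf_lt -/(_ (levy_set_nonempty mu nu))[s [s0 Hs] se].
  have [q] := rat_in_itvoo se; rewrite in_itv/= => /andP[sq qe].
  exists q; split => [|r]; first by rewrite qe andbT (lt_trans s0).
  have /andP[h1 h2] := Hs (ratr r).
  have h3 : dist_fun mu (ratr r - ratr q) <= dist_fun mu (ratr r - s).
    by apply: dist_fun_nd; lra.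
  have h4 : dist_fun mu (ratr r + s) <= dist_fun mu (ratr r + ratr q).
    by apply: dist_fun_nd; lra.
  by apply/andP; split; lra.
pose q' := (ratr q + e) / 2.
have qq' : ratr q < q' by rewrite /q'; lra.
apply: (@le_lt_trans _ _ q'); last by rewrite /q'; lra.
apply: levy_le; split; first by lra.
move=> x.
have : x - (q' - ratr q) < x by lra.
move=> /rat_in_itvoo[r1]; rewrite in_itv/= => /andP[r1l r1u].
have : x < x + (q' - ratr q) by lra.
move=> /rat_in_itvoo[r2]; rewrite in_itv/= => /andP[r2l r2u].
have /andP[h1 _] := H r1; have /andP[_ h2] := H r2.
have h3 : dist_fun mu (x - q') <= dist_fun mu (ratr r1 - ratr q) by apply: dist_fun_nd; lra.
have h4 : dist_fun nu (ratr r1) <= dist_fun nu x by apply: dist_fun_nd; lra.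
have h5 : dist_fun mu (ratr r2 + ratr q) <= dist_fun mu (x + q') by apply: dist_fun_nd; lra.
have h6 : dist_fun nu x <= dist_fun nu (ratr r2) by apply: dist_fun_nd; lra.
by apply/andP; split; lra.
Qed.

(** The grid depends on [nu] and [h] only, so finitely many points serve all laws [mu]. Inside the
    grid monotonicity costs one mesh width; beyond it at most mass [h] of [nu] is left. *)
Lemma levy_grid nu h : 0 < h -> exists (J : nat) (b : nat -> R), forall mu,
  (forall j, (j <= J)%N -> dist_fun nu (b j - h) - h <= dist_fun mu (b j) <=
     dist_fun nu (b j + h) + h) ->
  levy_dist mu nu <= 3 * h.
Proof.
move=> h0.
have [M M0 HM] := dist_funNy nu h0; have [N N0 HN] := dist_funy nu h0.
(* The extra [h] leaves room for the shifts: b_0 + h is still below - M, and b_J - h is above N. *)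
pose A := M + N + h; pose b j : R := - A + j%:R * h.
pose J := (Num.truncn (2 * A / h)).+1.
exists J, b => mu Hb; apply: levy_le; split; first by lra.
have bJ : A <= b J.
  have := truncnS_gt (2 * A / h); rewrite ltr_pdivrMr// -/J /b; lra.
have b0 : b 0%N = - A by rewrite /b mul0r addr0.
have bS j : b j.+1 = b j + h by rewrite /b -natr1; ring.
have bracket y : b 0%N <= y -> y < b J -> exists j, (j < J)%N /\ b j <= y < b j.+1.
  move=> y0; elim: (J) => [|k IH] yk; first by move: y0; rewrite leNgt yk.
  have [/IH[j [jk hj]]|bky] := ltP y (b k); first by exists j; split => //; exact: ltnW.
  by exists k; rewrite bky yk.
have /andP[l0 u0] := Hb 0%N (leq0n _).
have /andP[lJ uJ] := Hb J (leqnn _).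
move=> x; apply/andP; split.
- set y := x - 3 * h.
  have [yb|yb] := ltP y (b 0%N).
    have h1 : dist_fun mu y <= dist_fun mu (b 0%N) by apply: dist_fun_nd; exact: ltW.
    have h2 : dist_fun nu (b 0%N + h) <= h by apply: HM; rewrite b0 /A; lra.
    by have := dist_fun_ge0 nu x; lra.
  have [yJ|yJ] := ltP y (b J).
    have [j [jJ /andP[j1 j2]]] := bracket y yb yJ.
    have /andP[_ uj] := Hb j.+1 jJ.
    have h1 : dist_fun mu y <= dist_fun mu (b j.+1) by apply: dist_fun_nd; exact: ltW.
    have h2 : dist_fun nu (b j.+1 + h) <= dist_fun nu x.
      by apply: dist_fun_nd; rewrite bS; rewrite /y in j1; lra.
    by lra.
  have h1 : 1 - h <= dist_fun nu x by apply: HN; rewrite /y in yJ; rewrite /A in bJ; lra.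
  by have := dist_fun_le1 mu y; lra.
- set y := x + 3 * h.
  have [yb|yb] := ltP y (b 0%N).
    have h1 : dist_fun nu x <= h by apply: HM; rewrite b0 /A /y in yb; lra.
    by have := dist_fun_ge0 mu y; lra.
  have [yJ|yJ] := ltP y (b J).
    have [j [jJ /andP[j1 j2]]] := bracket y yb yJ.
    have /andP[lj _] := Hb j (ltnW jJ).
    have h1 : dist_fun mu (b j) <= dist_fun mu y by apply: dist_fun_nd.
    have h2 : dist_fun nu x <= dist_fun nu (b j - h).
      by apply: dist_fun_nd; rewrite bS /y in j2; lra.
    by lra.
  have h1 : dist_fun mu (b J) <= dist_fun mu y by apply: dist_fun_nd.
  have h2 : 1 - h <= dist_fun nu (b J - h) by apply: HN; rewrite /A in bJ; lra.
  by have := dist_fun_le1 nu x; lra.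
Qed.

Lemma measurable_levy {d : measure_display} {T : measurableType d}
    (mu : T -> probability (measurableTypeR R) R) nu e :
  (forall b, measurable_fun setT (fun w => dist_fun (mu w) b)) ->
  measurable [set w | e <= `|levy_dist (mu w) nu - 0|].
Proof.
move=> mmu.
rewrite (_ : [set _ | _] = ~` \bigcup_(q : rat) (if (0 < ratr q :> R) && (ratr q < e) then
   \bigcap_(r : rat) [set w | dist_fun (mu w) (ratr r - ratr q) - ratr q <= dist_fun nu (ratr r) <=
    dist_fun (mu w) (ratr r + ratr q) + ratr q] else set0)); last first.
  apply/seteqP; split => w /=; rewrite subr0 (ger0_norm (levy_ge0 _ _)).
    move=> le [q _]; case: ifP => // /andP[q0 qe] /= H.
    have : levy_dist (mu w) nu < e.
      by apply/levy_ltP; exists q; rewrite q0 qe; split => // r; exact: H.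
    by rewrite ltNge le.
  move=> H; rewrite leNgt; apply/negP => /levy_ltP[q [q0 Hq]]; apply: H.
  by exists q => //; rewrite q0 => r _; exact: Hq.
apply: measurableC; apply: bigcupT_measurable_rat => q; case: ifP => // _.
rewrite -[X in measurable X]setCK setC_bigcap; apply: measurableC.
apply: bigcupT_measurable_rat => r; apply: measurableC.
rewrite (_ : [set _ | _] =
  (fun w => dist_fun (mu w) (ratr r - ratr q)) @^-1` `]-oo, dist_fun nu (ratr r) + ratr q]%classic `&`
  (fun w => dist_fun (mu w) (ratr r + ratr q)) @^-1` `[dist_fun nu (ratr r) - ratr q, +oo[%classic).
  by apply: measurableI; apply: measurable_preimT.
apply/seteqP; split => w /=; rewrite !in_itv/= andbT.
  by move=> /andP[]; split; lra.
by move=> [? ?]; apply/andP; split; lra.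
Qed.

End levy.

(** * Conditional central limit theorem *)

Section in_probability.
Context {R : realType} {d : measure_display} {T : measurableType d}.
Variable mu : probability T R.
Implicit Types (X : nat -> T -> R) (l e r : R).

Lemma cvg_in_prob_le X l : cvg_in_prob mu X l -> forall e r, 0 < e -> 0 < r ->
  exists N, forall n, (N <= n)%N -> fine (mu [set w | e <= `|X n w - l|]) <= r.
Proof.
move=> cX e r e0 r0; have /fine_cvgP[_ /cvgrPdist_le /(_ _ r0)] := cX e e0.
move=> [N _ HN]; exists N => n Nn.
by have := HN n Nn; rewrite sub0r normrN /=; apply: le_trans; exact: ler_norm.
Qed.

Lemma le_cvg_in_prob X l :
  (forall e, 0 < e -> exists N, forall n, (N <= n)%N ->
     measurable [set w | e <= `|X n w - l|]) ->
  (forall e r, 0 < e -> 0 < r ->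
     exists N, forall n, (N <= n)%N -> fine (mu [set w | e <= `|X n w - l|]) <= r) ->
  cvg_in_prob mu X l.
Proof.
move=> mX H e e0; have [N HN] := mX e e0.
apply/fine_cvgP; split.
  by exists N => // n /HN mS; exact: fin_num_measure.
apply/cvgrPdist_le => r r0; have [M HM] := H e r e0 r0.
exists M => // n /HM; rewrite sub0r normrN/= ger0_norm//.
by rewrite fine_ge0.
Qed.

Lemma prob_ae_eq (X Y : T -> R) e l : measurable_fun setT X -> measurable_fun setT Y ->
  {ae mu, forall w, X w = Y w} ->
  fine (mu [set w | e <= `|X w - l|]) = fine (mu [set w | e <= `|Y w - l|]).
Proof.
move=> mX mY XY.
have m (Z : T -> R) : measurable_fun setT Z -> measurable [set w | e <= `|Z w - l|].
  by move=> mZ; apply: measurable_le_norm; exact: measurable_funB.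
rewrite -!ex_indic; [|exact: m|exact: m].
apply: ex_ae.
- by apply: measurable_indic; exact: m.
- by apply: measurable_indic; exact: m.
- apply: filterS XY => w XYw; rewrite !indicE; congr (nat_of_bool _)%:R.
  by apply/idP/idP; rewrite !inE/= XYw.
Qed.

End in_probability.

Section conditional_clt.
Context {R : realType} {d d' : measure_display} {Omega : measurableType d}
  {E : measurableType d'} {P : probability Omega R}.
Variables (W : int -> {RV P >-> E}) (pi : probability E R) (Q : R.-pker E ~> E).
Hypotheses (hmarkov : markov_chain W Q) (hstat : stationary W pi)
  (hrev : reversible pi Q).
Variable g : E -> R.
Hypothesis g2 : L2 pi g.

Lemma cond_exp_Rintegral F (X Y : Omega -> R) A : is_cond_exp P F X Y -> F A ->
  \int[P]_(w in A) Y w = \int[P]_(w in A) X w.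
Proof. by move=> [_ _ H] FA; rewrite /Rintegral H. Qed.

Lemma cond_exp_intg F (X Y : Omega -> R) : is_cond_exp P F X Y -> intg P Y.
Proof. by move=> []. Qed.

Lemma cond_exp_adapted F (X Y : Omega -> R) : sigma_algebra setT F ->
  is_cond_exp P F X Y -> adapted F Y.
Proof. by move=> sF [H _ _]; apply/(adaptedP sF) => B; exact: H. Qed.

(** The theorem's hypotheses condition on a single state, the martingale argument on the whole past.
    The kernel version serves both by the Markov property, and uniqueness identifies any given
    version with it. *)
Lemma cond_exp_version (k : int) (f : E * E -> R) (Y : Omega -> R) :
  measurable_fun setT f -> intg P (fun x => f (W k x, W (k + 1) x)) ->
  is_cond_exp P (g_sigma_algebra_preimage (W k)) (fun x => f (W k x, W (k + 1) x)) Y ->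
  {ae P, forall x, Y x = ker2 Q f (W k x)}.
Proof.
move=> mf intf hY; have [ik H] := ex_markov hmarkov mf intf.
have sk := @preimage_sigma _ _ _ _ _ P W k.
apply: (adapted_ae_eq sk _ (cond_exp_intg hY) ik (cond_exp_adapted sk hY)) => [||A FA].
- by move=> B /(@preimage_sub_past _ _ _ _ _ P W k k (lexx k)); exact: past_measurable.
- apply/(adaptedP sk) => B mB; exists (ker2 Q f @^-1` B); last by rewrite setTI.
  by apply: measurable_preimT => //; exact: measurable_ker2.
- rewrite (cond_exp_Rintegral hY FA) H//.
  exact: (preimage_sub_past (lexx k)).
Qed.

Section fixed_n.
Variables (n : nat) (lam eps eta dl a : R) (C L : nat -> Omega -> R).
Hypotheses (sig0 : 0 < sigma W g n) (lam0 : 0 <= lam) (eps0 : 0 < eps)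
  (eta0 : 0 < eta) (dl0 : 0 < dl).
Hypothesis hC : forall k : nat, (0 < k)%N ->
  is_cond_exp P (g_sigma_algebra_preimage (W (k%:Z - 1)))
    (fun w => Dnk W Q g n k w ^+ 2) (C k).
Hypothesis hL : forall k : nat, (0 < k)%N ->
  is_cond_exp P (g_sigma_algebra_preimage (W (k%:Z - 1)))
    (fun w => Dnk W Q g n k w ^+ 2 *
        \1_[set w' | eps * sigma W g n < `|Dnk W Q g n k w'|] w) (L k).

Let sig := sigma W g n.
(** The increment normalized by sigma_n, as a function of two successive states. The index is
    shifted: [dd k] is D_{n,k+1} / sigma_n. *)
Let delta (p : E * E) : R := (Vbar Q n g p.2 - kop Q (Vbar Q n g) p.1) / sig.
Let tail (p : E * E) : R := delta p ^+ 2 * (eps < `|delta p|)%R%:R.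
Let dd k x := delta (W k%:Z x, W (k%:Z + 1) x).
Let cc k x := ker2 Q (fun p => delta p ^+ 2) (W k%:Z x).
Let ll k x := ker2 Q tail (W k%:Z x).

Let V2 : L2 pi (Vbar Q n g). Proof. exact: (L2_Vbar hmarkov hstat g2). Qed.
Let kV2 : L2 pi (kop Q (Vbar Q n g)). Proof. exact: (L2_kop hmarkov hstat V2). Qed.

Let mdelta : measurable_fun setT delta.
Proof.
apply: measurable_funM => //; apply: measurable_funB.
  exact: measurableT_comp (L2_measurable V2) measurable_snd.
exact: measurableT_comp (L2_measurable kV2) measurable_fst.
Qed.

Let mtail : measurable_fun setT tail.
Proof.
apply: measurable_funM; first exact: measurable_funX.
rewrite (_ : (fun p => _) = \1_[set p | eps < `|delta p|]).
  by apply: measurable_indic; exact: measurable_lt_norm.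
apply/funext => p; rewrite indicE; congr (nat_of_bool _)%:R.
by apply/idP/idP; rewrite inE.
Qed.

Let ddE k x : dd k x = Dnk W Q g n k.+1 x / sig.
Proof.
rewrite /dd /delta /Dnk/=; have -> : k.+1%:Z = k%:Z + 1 by rewrite -addn1 PoszD.
by rewrite addrK.
Qed.

Let dd2 k : L2 P (dd k).
Proof.
rewrite (_ : dd k = fun x => sig^-1 * Dnk W Q g n k.+1 x).
  by apply: L2Z; exact: (L2_Dnk hmarkov hstat g2).
by apply/funext => x; rewrite ddE mulrC.
Qed.

Let id2 k : intg P (fun x => dd k x ^+ 2). Proof. by case: (dd2 k). Qed.

Let itail k : intg P (fun x => tail (W k%:Z x, W (k%:Z + 1) x)).
Proof.
apply: (intg_le _ (id2 k)); first exact: measurableT_comp mtail (mWW W k%:Z).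
move=> x; rewrite /tail -/(dd k x) normrM ler_piMr//.
by case: (_ < _); rewrite ?normr1 ?normr0.
Qed.

Let kZ k : k.+1%:Z - 1 = k%:Z :> int.
Proof. by rewrite -addn1 PoszD addrK. Qed.

Let ker_dom w : ker2 Q (fun p => delta p ^+ 2) w <= eps ^+ 2 + ker2 Q tail w.
Proof.
have me2 : measurable_fun setT (fun z => (delta (w, z) ^+ 2)%:E).
  apply/measurable_EFinP; apply: measurable_funX.
  exact: measurableT_comp mdelta (pair1_measurable _).
have mt2 : measurable_fun setT (fun z => (tail (w, z))%:E).
  by apply/measurable_EFinP; exact: measurableT_comp mtail (pair1_measurable _).
have t0 z : 0 <= tail (w, z) by rewrite mulr_ge0 ?sqr_ge0.
have tle z : tail (w, z) <= delta (w, z) ^+ 2.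
  by rewrite /tail; case: (_ < _); rewrite ?mulr1 ?mulr0// sqr_ge0.
have dle z : delta (w, z) ^+ 2 <= eps ^+ 2 + tail (w, z).
  rewrite /tail; have [h|h] := ltP eps `|delta (w, z)|; first by rewrite mulr1 lerDr sqr_ge0.
  by rewrite mulr0 addr0 -[delta _ ^+ 2]ger0_norm ?sqr_ge0// normrX lerXn2r ?nnegrE// ltW.
have Il0 : (0 <= \int[Q w]_z (tail (w, z))%:E)%E by apply: integral_ge0 => z _; rewrite lee_fin.
have Id0 : (0 <= \int[Q w]_z (delta (w, z) ^+ 2)%:E)%E.
  by apply: integral_ge0 => z _; rewrite lee_fin sqr_ge0.
have I1 : (\int[Q w]_z (tail (w, z))%:E <= \int[Q w]_z (delta (w, z) ^+ 2)%:E)%E.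
  by apply: ge0_le_integral => // z _; rewrite lee_fin// sqr_ge0.
have I2 : (\int[Q w]_z (delta (w, z) ^+ 2)%:E <= (eps ^+ 2)%:E + \int[Q w]_z (tail (w, z))%:E)%E.
  apply: (@le_trans _ _ (\int[Q w]_z ((eps ^+ 2)%:E + (tail (w, z))%:E))%E).
    apply: ge0_le_integral => //.
    - by move=> z _; rewrite lee_fin sqr_ge0.
    - exact: emeasurable_funD.
    - by move=> z _; rewrite -EFinD lee_fin.
  rewrite ge0_integralD//; [|by move=> z _; rewrite lee_fin sqr_ge0|by move=> z _; rewrite lee_fin].
  by rewrite integral_cst// (_ : Q w setT = 1%E) ?mule1//; exact: prob_kernel.
rewrite /ker2 /Rintegral.
have [fi|nfi] := boolP ((\int[Q w]_z (delta (w, z) ^+ 2)%:E)%E \is a fin_num).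
  have fil : (\int[Q w]_z (tail (w, z))%:E)%E \is a fin_num.
    by rewrite ge0_fin_numE// (le_lt_trans I1)// -ge0_fin_numE.
  by move: I2; rewrite -(fineK fi) -(fineK fil) -EFinD lee_fin.
(* At states where the second moment is infinite [fine] gives it the value 0, so the inequality
   holds there as well. *)
rewrite (_ : (\int[Q w]_z (delta (w, z) ^+ 2)%:E)%E = +oo%E)/=.
  by rewrite addr_ge0 ?sqr_ge0// fine_ge0.
by move: nfi; rewrite ge0_fin_numE// -leNgt leye_eq => /eqP.
Qed.

Let aedd : {ae P, forall x, \sum_(j < n) cc j x =
    (sig ^+ 2)^-1 * \sum_(1 <= k < n.+1) C k x}.
Proof.
have h k : {ae P, forall x, cc k x = (sig ^+ 2)^-1 * C k.+1 x}.
  have i2 := id2 k.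
  have md : measurable_fun setT (fun p => delta p ^+ 2) by exact: measurable_funX.
  suff hY : is_cond_exp P (g_sigma_algebra_preimage (W k%:Z)) (fun x => dd k x ^+ 2)
      (fun x => (sig ^+ 2)^-1 * C k.+1 x).
    by apply: filterS (cond_exp_version md i2 hY) => x ->.
  have := hC (ltn0Sn k); rewrite kZ => -[h1 h2 h3]; split.
  - move=> B mB; have sk := @preimage_sigma _ _ _ _ _ P W k%:Z.
    apply: (adapted_setE sk) => //; apply: measurable_funM => //.
    by apply/(adaptedP sk) => B'; exact: h1.
  - exact: intgZ.
  - move=> A FA; have mA : measurable A.
      exact: (past_measurable (preimage_sub_past (lexx k%:Z) FA)).
    under eq_integral do rewrite EFinM.
    rewrite integralZl//; last by apply: integrableS (measurableT) _ _ h2.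
    rewrite h3// -integralZl//; last first.
      by apply: integrableS (measurableT) _ _ _ => //; case: (L2_Dnk hmarkov hstat g2 n k.+1).
    apply: eq_integral => x _; rewrite -EFinM -/(dd k x) ddE; congr EFin.
    by rewrite exprMn exprVn mulrC.
have : {ae P, forall x, \sum_(0 <= j < n) cc j x = \sum_(0 <= j < n) (sig ^+ 2)^-1 * C j.+1 x}.
  elim: (index_iota _ _) => [|k s IH]; first by apply: aeW => w; rewrite !big_nil.
  by apply: filterS2 IH (h k) => w h1 h2; rewrite !big_cons h1 h2.
apply: filterS => x; rewrite big_mkord => ->.
by rewrite -mulr_sumr [in RHS]big_add1.
Qed.

Let aell : {ae P, forall x, \sum_(j < n) ll j x =
    (sig ^+ 2)^-1 * \sum_(1 <= k < n.+1) L k x}.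
Proof.
have h k : {ae P, forall x, ll k x = (sig ^+ 2)^-1 * L k.+1 x}.
  suff hY : is_cond_exp P (g_sigma_algebra_preimage (W k%:Z))
      (fun x => tail (W k%:Z x, W (k%:Z + 1) x)) (fun x => (sig ^+ 2)^-1 * L k.+1 x).
    by apply: filterS (cond_exp_version mtail (itail k) hY) => x ->.
  have := hL (ltn0Sn k); rewrite kZ => -[h1 h2 h3]; split.
  - move=> B mB; have sk := @preimage_sigma _ _ _ _ _ P W k%:Z.
    apply: (adapted_setE sk) => //; apply: measurable_funM => //.
    by apply/(adaptedP sk) => B'; exact: h1.
  - exact: intgZ.
  - move=> A FA; have mA : measurable A.
      exact: (past_measurable (preimage_sub_past (lexx k%:Z) FA)).
    under eq_integral do rewrite EFinM.
    rewrite integralZl//; last by apply: integrableS (measurableT) _ _ h2.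
    have [mD iD] := L2_Dnk hmarkov hstat g2 n k.+1.
    rewrite h3// -integralZl//; last first.
      apply: integrableS (measurableT) _ _ _ => //.
      apply: (intg_le _ iD) => [|x].
        apply: measurable_funM; first exact: measurable_funX.
        by apply: measurable_indic; exact: measurable_lt_norm.
      by rewrite normrM ler_piMr// indic_le1.
    apply: eq_integral => x _; rewrite -EFinM /tail -/(dd k x) ddE; congr EFin.
    rewrite indicE (_ : (x \in _) = (eps < `|Dnk W Q g n k.+1 x / sig|)).
      by rewrite exprMn exprVn; ring.
    apply/idP/idP; rewrite inE/= normrM normfV (gtr0_norm sig0) ltr_pdivlMr//.
have : {ae P, forall x, \sum_(0 <= j < n) ll j x = \sum_(0 <= j < n) (sig ^+ 2)^-1 * L j.+1 x}.
  elim: (index_iota _ _) => [|k s IH]; first by apply: aeW => w; rewrite !big_nil.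
  by apply: filterS2 IH (h k) => w h1 h2; rewrite !big_cons h1 h2.
apply: filterS => x; rewrite big_mkord => ->.
by rewrite -mulr_sumr [in RHS]big_add1.
Qed.

Lemma martingale_part_bound A : past W 0 A ->
  `|\int[P]_x (\1_A x * (hflow a (dl ^+ 2) (\sum_(1 <= k < n.+1) Dnk W Q g n k x / sigma W g n) -
                           hflow a (dl ^+ 2 + lam) 0))| <=
  heat_cst dl * (eps * (lam + eta) + eta + (eps ^+ 2 + eta) * (lam + eta) + 3 * eta) +
  2 * (fine (P [set x | eta <= `|(sigma W g n ^+ 2)^-1 * \sum_(1 <= k < n.+1) C k x - lam|]) +
       fine (P [set x | eta <= `|(sigma W g n ^+ 2)^-1 * \sum_(1 <= k < n.+1) L k x - 0|])).
Proof.
move=> pA.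
pose F (k : nat) := past W k%:Z.
have past_le (k : nat) : F k `<=` F k.+1 by apply: past_nd; rewrite lez_nat.
have add k : adapted (F k.+1) (dd k).
  apply: measurable_funM => //; apply: measurable_funB.
    have := @adapted_W _ _ _ _ _ P W k.+1%:Z (k%:Z + 1) (Vbar Q n g).
    by apply; [rewrite -addn1 PoszD|exact: L2_measurable V2].
  have := @adapted_W _ _ _ _ _ P W k.+1%:Z k%:Z (kop Q (Vbar Q n g)).
  by apply; [rewrite lez_nat|exact: L2_measurable kV2].
have md : measurable_fun setT (fun p => delta p ^+ 2) by exact: measurable_funX.
have ac k : adapted (F k) (cc k) by apply: adapted_W => //; exact: measurable_ker2.
have al k : adapted (F k) (ll k) by apply: adapted_W => //; exact: measurable_ker2.
have c0 k x : 0 <= cc k x by apply: Rintegral_ge0 => z _; exact: sqr_ge0.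
have l0 k x : 0 <= ll k x by apply: Rintegral_ge0 => z _; rewrite mulr_ge0 ?sqr_ge0.
have cl k x : cc k x <= eps ^+ 2 + ll k x by exact: ker_dom.
have Hc k := ex_markov hmarkov md (id2 k).
have Hl k := ex_markov hmarkov mtail (itail k).
have hd1 k B : F k B -> \int[P]_(x in B) dd k x = 0.
  move=> FB; have mB := past_measurable FB.
  have iV := L2_intg V2; have [ik H] := ex_kop hmarkov hstat k%:Z iV.
  have i1 : P.-integrable B (EFin \o (fun x => Vbar Q n g (W (k%:Z + 1) x))).
    by apply: integrableS (measurableT) _ _ (intg_stat hstat _ iV).
  have i2 : P.-integrable B (EFin \o (fun x => kop Q (Vbar Q n g) (W k%:Z x))).
    by apply: integrableS (measurableT) _ _ ik.
  rewrite /dd /delta/= RintegralZr//; last by have := integrableB mB i1 i2.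
  by rewrite RintegralB// H// subrr mul0r.
have hdl k B : F k B ->
    \int[P]_(x in B) (dd k x ^+ 2 * \1_[set y | eps < `|dd k y|] x) = \int[P]_(x in B) ll k x.
  move=> FB; have [_ <-//] := Hl k; apply: eq_Rintegral => x _.
  rewrite indicE /tail -/(dd k x); congr (_ * (nat_of_bool _)%:R).
  by apply/idP/idP; rewrite inE.
have hd2 k B : F k B -> \int[P]_(x in B) dd k x ^+ 2 = \int[P]_(x in B) cc k x.
  by move=> FB; have [_ <-//] := Hc k.
have main := martingale_clt_bound a (fun k => past_sigma W k%:Z)
  (fun k => @past_measurable _ _ _ _ _ P W k%:Z) past_le add ac al c0 l0 cl id2
  (fun k => (Hc k).1) (fun k => (Hl k).1) hd1 hd2 hdl eps0 lam0 eta0 dl0 pA n.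
have mC : measurable_fun setT (fun x => (sig ^+ 2)^-1 * \sum_(1 <= k < n.+1) C k x).
  apply: measurable_funM => //.
  rewrite (_ : (fun x => _) = fun x => \sum_(0 <= k < n) C k.+1 x).
    by apply: measurable_sum => k; exact: intg_measurable (cond_exp_intg (hC (ltn0Sn k))).
  by apply/funext => x; rewrite big_add1.
have mL : measurable_fun setT (fun x => (sig ^+ 2)^-1 * \sum_(1 <= k < n.+1) L k x).
  apply: measurable_funM => //.
  rewrite (_ : (fun x => _) = fun x => \sum_(0 <= k < n) L k.+1 x).
    by apply: measurable_sum => k; exact: intg_measurable (cond_exp_intg (hL (ltn0Sn k))).
  by apply/funext => x; rewrite big_add1.
have mcc : measurable_fun setT (fun x => \sum_(j < n) cc j x).
  by apply: measurable_sum => j; exact: intg_measurable (Hc j).1.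
have mll : measurable_fun setT (fun x => \sum_(j < n) ll j x).
  by apply: measurable_sum => j; exact: intg_measurable (Hl j).1.
rewrite -(prob_ae_eq eta lam mcc mC aedd) -(prob_ae_eq eta 0 mll mL aell).
have SE x : \sum_(1 <= k < n.+1) Dnk W Q g n k x / sigma W g n = \sum_(j < n) dd j x.
  by rewrite big_add1/= big_mkord; apply: eq_bigr => j _; rewrite ddE.
rewrite (eq_Rintegral _ (g := fun x => \1_A x * (hflow a (dl ^+ 2) (\sum_(j < n) dd j x) -
    hflow a (dl ^+ 2 + lam) 0))); last by move=> x _; rewrite SE.
rewrite (_ : [set x | eta <= `|\sum_(j < n) ll j x - 0|] =
  [set x | eta <= `|\sum_(j < n) ll j x|]); last by apply/funext => x; rewrite /= subr0.
exact: main.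
Qed.

End fixed_n.

End conditional_clt.

Section clt_limit.
Context {R : realType} {d d' : measure_display} {Omega : measurableType d}
  {E : measurableType d'} {P : probability Omega R}.
Variables (W : int -> {RV P >-> E}) (pi : probability E R) (Q : R.-pker E ~> E).
Hypotheses (hmarkov : markov_chain W Q) (hstat : stationary W pi)
  (hrev : reversible pi Q).
Variable g : E -> R.
Hypothesis g2 : L2 pi g.
Hypothesis hell : slowly_varying (ell W g).
Implicit Types e r dl : R.

Let slow : slowly_varying (fun n => ssq W g n / n%:R).
Proof.
rewrite (_ : (fun n => _) = ell W g)//.
by apply/funext => n; rewrite /ell sigmaE.
Qed.

Let cov_ge0 : 0 <= cov pi Q g 0.
Proof. by rewrite cov0E; apply: Rintegral_ge0 => w _; exact: sqr_ge0. Qed.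

Lemma sigma_gt0 : exists N, forall n, (N <= n)%N -> 0 < sigma W g n.
Proof.
have [N HN] := slow_gt0 slow; exists N => n /HN.
rewrite -sigmaE => s0; rewrite lt_neqAle sqrtr_ge0 andbT eq_sym.
by apply/eqP => s00; move: s0; rewrite s00 expr0n/= ltxx.
Qed.

Lemma martingale_approximation e : 0 < e -> exists N, forall n, (N <= n)%N ->
  \int[P]_x `|(Sn W g n x - \sum_(1 <= k < n.+1) Dnk W Q g n k x) / sigma W g n| <= e.
Proof.
(* With [usq n] and the mean of the [usq i] below t sigma_n^2, [remainder_le] gives 3 (t + 2 t) = 9
   t. The normalized remainder y satisfies |y| <= e/2 + (2/e) y^2, and (2/e) 9 e^2/36 = e/2. *)
move=> e0; have t0 : 0 < e ^+ 2 / 36 by rewrite divr_gt0// exprn_gt0.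
have step1 := @ssq_step1 _ _ _ _ _ _ W pi Q hstat g g2.
have step2 := ssq_step2 hmarkov hstat hrev g2.
have qE := usqE hmarkov hstat hrev g2.
have [N1 H1] := slow_remainder slow (ssq_ge0 W g) step2 step1 cov_ge0 qE t0.
have [N2 H2] := slow_remainder_avg slow (ssq_ge0 W g) step2 step1 cov_ge0 qE t0.
have [N3 H3] := sigma_gt0.
exists (maxn 1 (maxn N1 (maxn N2 N3))) => n.
rewrite !geq_max => /and4P[n0 /H1 h1 /H2 h2 /H3 s0].
pose Rm x := Sn W g n x - \sum_(1 <= k < n.+1) Dnk W Q g n k x.
have [mR iR] : L2 P Rm.
  apply: L2B; first exact: (L2_Sn hstat g2).
  by apply: L2_sum => k; exact: (L2_Dnk hmarkov hstat g2).
have i1 : intg P (fun x => Rm x / sigma W g n).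
  have := intgZ (sigma W g n)^-1 (L2_intg (conj mR iR)).
  by under eq_fun do rewrite mulrC.
have hR := remainder_le hmarkov hstat g2 n0.
have ssq0 : 0 < ssq W g n by rewrite -sigmaE exprn_gt0.
pose k2 := 2 / e / ssq W g n.
apply: (@le_trans _ _ (\int[P]_x (e / 2 + k2 * Rm x ^+ 2))).
  apply: ex_le; [exact: intg_norm|by apply: intgD; [exact: intg_cst|exact: intgZ]|].
  move=> x; rewrite -/(Rm x) /k2 -sigmaE.
  set y := Rm x / _.
  have -> : 2 / e / sigma W g n ^+ 2 * Rm x ^+ 2 = 2 / e * y ^+ 2.
    by rewrite /y exprMn exprVn; ring.
  have : 0 <= (e / 2 - `|y|) ^+ 2 * (2 / e) by rewrite mulr_ge0 ?sqr_ge0// divr_ge0// ltW.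
  have -> : (e / 2 - `|y|) ^+ 2 * (2 / e) = e / 2 - 2 * `|y| + 2 / e * `|y| ^+ 2.
    by field; rewrite gt_eqF.
  have y0 := normr_ge0 y.
  by rewrite real_normK ?num_real//; lra.
rewrite exD; [|exact: intg_cst|exact: intgZ]; rewrite ex_cst exZ//.
have k20 : 0 < k2 by rewrite !divr_gt0.
have : k2 * \int[P]_x Rm x ^+ 2 <= k2 * (9 * (e ^+ 2 / 36 * ssq W g n)).
  by rewrite ler_pM2l// (le_trans hR)//; lra.
have -> : k2 * (9 * (e ^+ 2 / 36 * ssq W g n)) = e / 2.
  by rewrite /k2; field; rewrite !gt_eqF.
lra.
Qed.

Variables (lam : R) (lam0 : 0 <= lam) (C : nat -> nat -> Omega -> R)
  (L : R -> nat -> nat -> Omega -> R).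
Hypothesis hC : forall n k : nat, (0 < n)%N -> (0 < k)%N ->
  is_cond_exp P (g_sigma_algebra_preimage (W (k%:Z - 1)))
    (fun w => Dnk W Q g n k w ^+ 2) (C n k).
Hypothesis hvar : cvg_in_prob P
  (fun n w => (sigma W g n ^+ 2)^-1 * \sum_(1 <= k < n.+1) C n k w) lam.
Hypothesis hL : forall (eps : R) (n k : nat), 0 < eps -> (0 < n)%N -> (0 < k)%N ->
  is_cond_exp P (g_sigma_algebra_preimage (W (k%:Z - 1)))
    (fun w => Dnk W Q g n k w ^+ 2 *
      \1_[set w' | eps * sigma W g n < `|Dnk W Q g n k w'|] w)
    (L eps n k).
Hypothesis hlind : forall eps : R, 0 < eps -> cvg_in_prob P
  (fun n w => (sigma W g n ^+ 2)^-1 * \sum_(1 <= k < n.+1) L eps n k w) 0.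

(** The Lipschitz bound in space passes from the martingale to S_n at the cost of the mean absolute
    remainder. The threshold is chosen before [A], which may therefore depend on [n]. *)
Lemma smoothed_conditional_clt a dl e : 0 < dl -> 0 < e ->
  exists N, forall n, (N <= n)%N -> forall A, past W 0 A ->
  `|\int[P]_x (\1_A x * (hflow a (dl ^+ 2) (Sn W g n x / sigma W g n) -
                         hflow a (dl ^+ 2 + lam) 0))| <= e.
Proof.
move=> dl0 e0; have K0 : 0 < heat_cst dl := heat_cst_gt0 dl0.
set K := heat_cst dl in K0 *.
have p0 := lam0.
have M0 : 0 < K * (3 * lam + 7) by rewrite mulr_gt0//; lra.
(* [t] serves as both [eps] and [eta]. For t <= 1 the error polynomial is at most t (lam + 1) + t +
   2 t (lam + 1) + 3 t = t (3 lam + 7). *)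
pose t := Num.min 1 (e / 4 / (K * (3 * lam + 7))).
have t0 : 0 < t by rewrite lt_min ltr01/= !divr_gt0.
have t1 : t <= 1 by rewrite ge_min lexx.
have tK : t * (K * (3 * lam + 7)) <= e / 4.
  by rewrite -ler_pdivlMr// ge_min lexx orbT.
have bK : K * (t * (lam + t) + t + (t ^+ 2 + t) * (lam + t) + 3 * t) <= t * (K * (3 * lam + 7)).
  rewrite mulrCA ler_pM2l//.
  have : t * (lam + t) <= t * (lam + 1) by rewrite ler_pM2l//; lra.
  have : (t ^+ 2 + t) * (lam + t) <= 2 * t * (lam + 1).
    apply: ler_pM; [by rewrite addr_ge0 ?sqr_ge0// ltW|lra| |lra].
    by have : t * t <= t * 1; [rewrite ler_pM2l|rewrite expr2; lra].
  by lra.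
have e34 : e / 4 + 2 * (e / 16 + e / 16) <= e * 3 / 4 by lra.
have eE : e = e * 3 / 4 + e / 4 by field.
have e16 : 0 < e / 16 by rewrite divr_gt0.
have eK : 0 < e / 4 / K by rewrite !divr_gt0.
have [N1 H1] := cvg_in_prob_le hvar t0 e16.
have [N2 H2] := cvg_in_prob_le (hlind t0) t0 e16.
have [N3 H3] := sigma_gt0.
have [N4 H4] := martingale_approximation eK.
exists (maxn 1 (maxn N1 (maxn N2 (maxn N3 N4)))) => n.
rewrite !geq_max => /and5P[n0 /H1 h1 /H2 h2 /H3 s0 /H4 h4] A pA.
have mA : measurable A := past_measurable pA.
have := martingale_part_bound hmarkov hstat g2 a s0 lam0 t0 t0 dl0
  (fun k => hC n0) (fun k => hL t0 n0) pA.
set X := fun x => \sum_(1 <= k < n.+1) Dnk W Q g n k x / sigma W g n.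
set Z := fun x => Sn W g n x / sigma W g n.
have ZX x : Z x - X x = (Sn W g n x - \sum_(1 <= k < n.+1) Dnk W Q g n k x) / sigma W g n.
  by rewrite /Z /X -mulr_suml mulrBl.
have mZ : measurable_fun setT Z.
  by apply: measurable_funM => //; exact: L2_measurable (L2_Sn hstat g2 n).
have mX : measurable_fun setT X.
  apply: measurable_sum => k; apply: measurable_funM => //.
  exact: L2_measurable (L2_Dnk hmarkov hstat g2 n k).
pose H := hflow a (dl ^+ 2).
have mH (Y : Omega -> R) : measurable_fun setT Y -> measurable_fun setT (fun x => H (Y x)).
  move=> mY; apply: (measurableT_comp (@measurable_Phi R)); apply: measurable_funM => //.
  exact: measurable_funB.
have iH (Y : Omega -> R) : measurable_fun setT Y -> intg P (fun x => H (Y x)).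
  move=> mY; apply: (@intg_bnd _ _ _ P _ 1 (mH _ mY)) => x.
  by rewrite ger0_norm ?hflow_ge0 ?hflow_le1.
set c := hflow a (dl ^+ 2 + lam) 0.
have iA (f : Omega -> R) : intg P f -> intg P (fun x => \1_A x * f x).
  by apply: (intgM (K := 1)); [exact: measurable_indic|exact: indic_le1].
have iX : intg P (fun x => H (X x) - c) by apply: intgB; [exact: iH|exact: intg_cst].
have iD : intg P (fun x => H (Z x) - H (X x)) by apply: intgB; exact: iH.
have iXn : intg P (fun x => `|Z x - X x|).
  apply: intg_norm; apply: intgB; apply: L2_intg.
    have := L2Z (sigma W g n)^-1 (L2_Sn hstat g2 n).
    by under [X in L2 _ X -> _]eq_fun do rewrite mulrC.
  apply: L2_sum => k; have := L2Z (sigma W g n)^-1 (L2_Dnk hmarkov hstat g2 n k).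
  by under [X in L2 _ X -> _]eq_fun do rewrite mulrC.
rewrite -/K.
have -> : \int[P]_x (\1_A x * (H (Z x) - c)) =
    \int[P]_x (\1_A x * (H (X x) - c)) + \int[P]_x (\1_A x * (H (Z x) - H (X x))).
  by rewrite -exD; [|exact: iA|exact: iA]; apply: eq_Rintegral => x _; ring.
have bD : `|\int[P]_x (\1_A x * (H (Z x) - H (X x)))| <= e / 4.
  apply: (le_trans (ex_norm (iA _ iD))).
  apply: (@le_trans _ _ (\int[P]_x (K * `|Z x - X x|))).
    apply: ex_le; [exact: intg_norm (iA _ iD)|exact: intgZ|move=> x].
    rewrite normrM -[leRHS]mul1r ler_pM// ?indic_le1//.
    have := hflow_lip a (X x) (Z x - X x) dl0 (lexx _).
    by rewrite addrCA subrr addr0.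
  rewrite exZ// mulrC -ler_pdivlMr//; move: h4; apply: le_trans.
  by rewrite le_eqVlt; apply/orP; left; apply/eqP; apply: eq_Rintegral => x _; rewrite ZX.
move=> hI; apply: (le_trans (ler_normD _ _)); rewrite eE.
apply: lerD => //; apply: (le_trans hI).
apply: (le_trans _ e34).
apply: lerD; last by rewrite ler_pM2l//; exact: lerD h1 h2.
exact: le_trans bK tK.
Qed.

End clt_limit.

(** * From smoothed tests to the Levy distance *)

Section levy_convergence.
Context {R : realType} {d : measure_display} {T : measurableType d}.
Variables (P : probability T R) (F : set (set T)).
Hypotheses (sF : sigma_algebra setT F) (Fm : F `<=` measurable).
Variables (Z : nat -> T -> R) (mu : nat -> T -> probability (measurableTypeR R) R) (lam : R).
Hypothesis lam0 : 0 <= lam.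
Hypothesis mZ : forall n, measurable_fun setT (Z n).
Hypothesis hmu : forall n : nat, (0 < n)%N -> is_cond_dist P F (Z n) (mu n).
Hypothesis hZ : forall a dl e : R, 0 < dl -> 0 < e -> exists N, forall n, (N <= n)%N ->
  forall A, F A -> `|\int[P]_x (\1_A x * (hflow a (dl ^+ 2) (Z n x) -
                                         hflow a (dl ^+ 2 + lam) 0))| <= e.
Implicit Types a b e h r dl : R.

Let nu := normal_law 0 lam.

Let iA A (f : T -> R) : F A -> intg P f -> intg P (fun x => \1_A x * f x).
Proof. by move=> /Fm mA; apply: (intgM (K := 1)); [exact: measurable_indic|exact: indic_le1]. Qed.

Let iH a dl n : intg P (fun x => hflow a (dl ^+ 2) (Z n x)).
Proof.
apply: (@intg_bnd _ _ _ P _ 1) => [|x]; last by rewrite ger0_norm ?hflow_ge0 ?hflow_le1.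
apply: (measurableT_comp (@measurable_Phi R)); apply: measurable_funM => //.
exact: measurable_funB.
Qed.

Let ZE n b A : (0 < n)%N -> F A ->
  \int[P]_x (\1_A x * dist_fun (mu n x) b) = \int[P]_x (\1_A x * (Z n x <= b)%R%:R).
Proof.
move=> n0 FA; have mA := Fm FA.
have mB : measurable (`]-oo, b]%classic : set R) by exact: measurable_itv.
rewrite -ex_setE// (cond_exp_Rintegral (hmu n0 mB) FA) ex_setE//.
apply: eq_Rintegral => x _; congr (_ * _); rewrite indicE; congr (nat_of_bool _)%:R.
by apply/idP/idP; rewrite inE/= in_itv.
Qed.

Let adapted_dist_fun n b : (0 < n)%N -> adapted F (fun x => dist_fun (mu n x) b).
Proof.
move=> n0; have mB : measurable (`]-oo, b]%classic : set R) by exact: measurable_itv.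
exact: cond_exp_adapted sF (hmu n0 mB).
Qed.

Let iF n b : (0 < n)%N -> intg P (fun x => dist_fun (mu n x) b).
Proof.
move=> n0; have mB : measurable (`]-oo, b]%classic : set R) by exact: measurable_itv.
exact: cond_exp_intg (hmu n0 mB).
Qed.

Let iZ n b : intg P (fun x => (Z n x <= b)%R%:R).
Proof.
rewrite (_ : (fun x => _) = \1_(Z n @^-1` `]-oo, b]%classic)).
  by apply: intg_indic; exact: measurable_preimT.
apply/funext => x; rewrite indicE; congr (nat_of_bool _)%:R.
by apply/idP/idP; rewrite inE/= in_itv.
Qed.

Let ex_split A a dl e n : F A ->
  \int[P]_x (\1_A x * (hflow a (dl ^+ 2) (Z n x) + e)) =
  \int[P]_x (\1_A x * (hflow a (dl ^+ 2) (Z n x) - hflow a (dl ^+ 2 + lam) 0)) +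
  (hflow a (dl ^+ 2 + lam) 0 + e) * fine (P A).
Proof.
move=> FA; rewrite -(ex_indic _ (Fm FA)) -exZ; last exact: intg_indic (Fm FA).
rewrite -exD; last 2 first.
- by apply: iA => //; apply: intgB; [exact: iH|exact: intg_cst].
- by apply: intgZ; exact: intg_indic (Fm FA).
by apply: eq_Rintegral => x _; ring.
Qed.

(** The indicator of z <= b lies, up to e/2, between smoothed indicators at b - k and b + k.
    Comparing their normal values with the unsmoothed law shifts the argument by another k, hence k
    = h/2. *)
Lemma cond_dist_fun_bounds b h e r : 0 < h -> 0 < e -> 0 < r ->
  exists N, forall n, (N <= n)%N -> forall A, F A ->
  (dist_fun nu (b - h) - e) * fine (P A) - r <=
  \int[P]_x (\1_A x * dist_fun (mu n x) b) <=
  (dist_fun nu (b + h) + e) * fine (P A) + r.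
Proof.
move=> h0 e0 r0; pose k := h / 2; have k0 : 0 < k by rewrite divr_gt0.
have e2 : 0 < e / 2 by rewrite divr_gt0.
have [dl [dl0 _ dlh]] := normal_smoothing (b + k) lam0 k0 e2.
have [dl' [dl'0 dl'h _]] := normal_smoothing (b - k) lam0 k0 e2.
rewrite (_ : b - k - k = b - h) 1?(_ : b + k + k = b + h); [|by rewrite /k; field|by rewrite /k; field].
move=> /andP[cge _] /andP[_ cle].
have sq (c : R) : 0 < c -> Num.sqrt (c ^+ 2) = c by move=> c0; rewrite sqrtr_sqr gtr0_norm.
have low z : hflow (b - k) (dl' ^+ 2) z + - (e / 2) <= (z <= b)%R%:R.
  rewrite /hflow sq//.
  have [zb|zb] := leP z b; rewrite /= ?mulr1n ?mulr0n; first by have := Phi_le1 ((b - k - z) / dl'); lra.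
  suff : Phi ((b - k - z) / dl') <= Phi (- k / dl') by lra.
  by apply: Phi_nd; rewrite ler_pM2r ?invr_gt0//; lra.
have upp z : (z <= b)%R%:R <= hflow (b + k) (dl ^+ 2) z + e / 2.
  rewrite /hflow sq//.
  have [zb|zb] := leP z b; rewrite /= ?mulr1n ?mulr0n; last by have := Phi_ge0 ((b + k - z) / dl); lra.
  suff : Phi (k / dl) <= Phi ((b + k - z) / dl) by lra.
  by apply: Phi_nd; rewrite ler_pM2r ?invr_gt0//; lra.
have {}cge : dist_fun nu (b - h) - e <= hflow (b - k) (dl' ^+ 2 + lam) 0 + - (e / 2).
  by rewrite /hflow subr0; move: cge; rewrite -/nu => ?; lra.
have {}cle : hflow (b + k) (dl ^+ 2 + lam) 0 + e / 2 <= dist_fun nu (b + h) + e.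
  by rewrite /hflow subr0; move: cle; rewrite -/nu => ?; lra.
have [N1 H1] := hZ (b + k) dl0 r0; have [N2 H2] := hZ (b - k) dl'0 r0.
exists (maxn 1 (maxn N1 N2)) => n; rewrite !geq_max => /and3P[n0 /H1 h1 /H2 h2] A FA.
have p0 : 0 <= fine (P A) by exact: fine_ge0.
have A0 x : 0 <= \1_A x :> R by rewrite indicE.
have {}h1 := h1 A FA; have {}h2 := h2 A FA.
have ilow : intg P (fun x => \1_A x * (hflow (b - k) (dl' ^+ 2) (Z n x) + - (e / 2))).
  by apply: iA => //; apply: intgD; [exact: iH|exact: intg_cst].
have iupp : intg P (fun x => \1_A x * (hflow (b + k) (dl ^+ 2) (Z n x) + e / 2)).
  by apply: iA => //; apply: intgD; [exact: iH|exact: intg_cst].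
rewrite ZE//; apply/andP; split.
- apply: (le_trans _ (ex_le ilow (iA FA (iZ n b)) _)) => [|x]; last by apply: ler_wpM2l; rewrite ?low.
  rewrite ex_split// addrC [leRHS]addrC addrC; apply: lerD; first exact: ler_wpM2r.
  by move: h2; rewrite ler_norml => /andP[].
- apply: (le_trans (ex_le (iA FA (iZ n b)) iupp _)) => [x|]; first by apply: ler_wpM2l; rewrite ?upp.
  rewrite ex_split// addrC; apply: lerD; first exact: ler_wpM2r.
  by move: h1; rewrite ler_norml => /andP[].
Qed.

Let deviation n b h e : set T :=
  [set x | ~ (dist_fun nu (b - h) - e <= dist_fun (mu n x) b <= dist_fun nu (b + h) + e)].

(** The test events, where the conditional distribution function is too large or too small at [b],
    lie in [F] and change with [n]. On the first, (w + e) P(A) <= (w + e/2) P(A) + r e/4 forces P(A)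
    <= r/2; the second is symmetric. *)
Lemma cond_dist_fun_cvg b h e r : 0 < h -> 0 < e -> 0 < r ->
  exists N, forall n, (N <= n)%N ->
  measurable (deviation n b h e) /\ fine (P (deviation n b h e)) <= r.
Proof.
move=> h0 e0 r0; have e2 : 0 < e / 2 by rewrite divr_gt0.
have r0' : 0 < r / 2 * (e / 2) by rewrite !mulr_gt0// ?divr_gt0.
have aux1 (w p : R) : (w + e) * p <= (w + e / 2) * p + r / 2 * (e / 2) -> p <= r / 2.
  by move=> wp; rewrite -(ler_pM2r e2); lra.
have aux2 (w p : R) : (w - e / 2) * p - r / 2 * (e / 2) <= (w - e) * p -> p <= r / 2.
  by move=> wp; rewrite -(ler_pM2r e2); lra.
have [N HN] := cond_dist_fun_bounds b h0 e2 r0'.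
exists (maxn 1 N) => n; rewrite geq_max => /andP[n0 /HN {}HN].
pose f x := dist_fun (mu n x) b.
pose u := dist_fun nu (b + h) + e; pose v := dist_fun nu (b - h) - e.
have af : adapted F f := adapted_dist_fun b n0.
pose A1 := f @^-1` `]u, +oo[%classic; pose A2 := f @^-1` `]-oo, v[%classic.
have FA1 : F A1 by apply: (adapted_setE sF) => //; exact: measurable_itv.
have FA2 : F A2 by apply: (adapted_setE sF) => //; exact: measurable_itv.
rewrite (_ : deviation n b h e = A1 `|` A2); last first.
  apply/seteqP; split => x; rewrite /A1 /A2/= !in_itv/= andbT -/(f x) -/u -/v.
    by move=> /negP; rewrite negb_and -!ltNge => /orP[|] ?; [right|left].
  by move=> [] ?; apply/negP; rewrite negb_and -!ltNge; apply/orP; [right|left].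
have [m1 m2] := (Fm FA1, Fm FA2).
split; first exact: measurableU.
have intf : intg P f by exact: iF.
have A0 (A : set T) x : 0 <= \1_A x :> R by rewrite indicE.
have b1 : u * fine (P A1) <= \int[P]_x (\1_A1 x * f x).
  rewrite -(ex_indic _ m1) -exZ; last exact: intg_indic.
  apply: ex_le; [by apply: intgZ; exact: intg_indic|exact: iA|move=> x].
  rewrite mulrC indicE; case: (boolP (x \in A1)) => [|_]; last by rewrite !mul0r.
  by rewrite inE /A1/= in_itv/= andbT !mul1r => /ltW.
have b2 : \int[P]_x (\1_A2 x * f x) <= v * fine (P A2).
  rewrite -(ex_indic _ m2) -exZ; last exact: intg_indic.
  apply: ex_le; [exact: iA|by apply: intgZ; exact: intg_indic|move=> x].
  rewrite [leRHS]mulrC indicE; case: (boolP (x \in A2)) => [|_]; last by rewrite !mul0r.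
  by rewrite inE /A2/= in_itv/= !mul1r => /ltW.
have /andP[_ c1] := HN A1 FA1; have /andP[c2 _] := HN A2 FA2.
have q1 : fine (P A1) <= r / 2 by exact: aux1 (le_trans b1 c1).
have q2 : fine (P A2) <= r / 2 by exact: aux2 (le_trans c2 b2).
apply: (@le_trans _ _ (fine (P A1) + fine (P A2))); last first.
  by rewrite [leRHS]splitr; exact: lerD.
rewrite -fineD ?fin_num_measure//; apply: fine_le; rewrite ?fin_num_measure//.
- exact: measurableU.
- by rewrite fin_numD !fin_num_measure.
- exact: measureU2.
Qed.

Lemma levy_cvg_in_prob : cvg_in_prob P (fun n w => levy_dist (mu n w) nu) 0.
Proof.
apply: le_cvg_in_prob => [e e0|e r e0 r0].
  (* [mu 0] is an arbitrary map, so measurability starts at n = 1. *)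
  exists 1%N => n n0; apply: measurable_levy => b.
  by apply: (adapted_measurable sF Fm); exact: adapted_dist_fun.
(* Since 3 (e/6) < e, the distance can reach [e] only if some grid point is bad; the bounds r / (J +
   1) at the points add up to r. *)
have h0 : 0 < e / 6 by rewrite divr_gt0.
have e6 : 3 * (e / 6) < e by lra.
have [J [b Hb]] := levy_grid nu h0.
have rJ : 0 < r / J.+1%:R by rewrite divr_gt0.
have /choice [N HN] j := cond_dist_fun_cvg (b j) h0 h0 rJ.
exists (maxn 1 (\max_(j < J.+1) N j)) => n; rewrite geq_max => /andP[n0 nN].
have {}HN (j : 'I_J.+1) := HN j n (leq_trans (leq_bigmax j) nN).
pose B (j : nat) := deviation n (b j) (e / 6) (e / 6).
have mL : measurable [set w | e <= `|levy_dist (mu n w) nu - 0|].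
  apply: measurable_levy => b'.
  by apply: (adapted_measurable sF Fm); exact: adapted_dist_fun.
rewrite -ex_indic//; apply: (@le_trans _ _ (\int[P]_x (\sum_(j < J.+1) \1_(B j) x))).
  apply: ex_le; [exact: intg_indic|by apply: intg_sum => j; apply: intg_indic; exact: (HN j).1|].
  move=> x; have s0 (Q : pred 'I_J.+1) : 0 <= \sum_(j < J.+1 | Q j) \1_(B j) x :> R.
    by apply: sumr_ge0 => j _; rewrite indicE.
  rewrite [leLHS]indicE; case: (boolP (x \in _)) => [|_]; last exact: s0.
  rewrite inE/= subr0 ger0_norm ?levy_ge0// => eL.
  have [j xB] : exists j : 'I_J.+1, B j x.
    apply: contrapT => nB; suff /(le_trans eL) : levy_dist (mu n x) nu <= 3 * (e / 6) by apply/negP; rewrite -ltNge.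
    apply: Hb => j jJ; apply: contrapT => nj; apply: nB.
    by exists (Ordinal (jJ : (j < J.+1)%N)).
  by rewrite (bigD1 j)//= indicE mem_set// lerDl.
rewrite ex_sum => [|j]; last by apply: intg_indic; exact: (HN j).1.
have -> : r = \sum_(j < J.+1) r / J.+1%:R.
  by rewrite sumr_const card_ord -[RHS]mulr_natr divfK// pnatr_eq0.
apply: ler_sum => j _; rewrite ex_indic; [exact: (HN j).2|exact: (HN j).1].
Qed.

End levy_convergence.

Theorem corollary2 (R : realType) (d : measure_display)
  (Omega : measurableType d) (P : probability Omega R)
  (T : ptopologicalType) (hT : polish R T)
  (W : int -> {RV P >-> borel T}) (pi : probability (borel T) R)
  (Q : R.-pker borel T ~> borel T)
  (hmarkov : markov_chain W Q) (hstat : stationary W pi)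
  (hrev : reversible pi Q)
  (g : borel T -> R) (hg : L20 pi g)
  (hell : slowly_varying (ell W g))
  (lambda : R) (hlambda : 0 <= lambda)
  (* C n k is any version of E(D_{n,k}^2 | W_{k-1}) *)
  (C : nat -> nat -> Omega -> R)
  (hC : forall n k : nat, (0 < n)%N -> (0 < k)%N ->
    is_cond_exp P (g_sigma_algebra_preimage (W (k%:Z - 1)))
      (fun w => Dnk W Q g n k w ^+ 2) (C n k))
  (hvar : cvg_in_prob P
    (fun n w => (sigma W g n ^+ 2)^-1 * \sum_(1 <= k < n.+1) C n k w) lambda)
  (* L eps n k is any version of E(D_{n,k}^2 1_{|D_{n,k}| > eps sigma_n} | W_{k-1}) *)
  (L : R -> nat -> nat -> Omega -> R)
  (hL : forall (eps : R) (n k : nat), 0 < eps -> (0 < n)%N -> (0 < k)%N ->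
    is_cond_exp P (g_sigma_algebra_preimage (W (k%:Z - 1)))
      (fun w => Dnk W Q g n k w ^+ 2 *
        \1_[set w' | eps * sigma W g n < `|Dnk W Q g n k w'|] w)
      (L eps n k))
  (hlind : forall eps : R, 0 < eps -> cvg_in_prob P
    (fun n w => (sigma W g n ^+ 2)^-1 * \sum_(1 <= k < n.+1) L eps n k w) 0)
  (* mu n is any regular conditional distribution of S_n / sigma_n given W_0 *)
  (mu : nat -> Omega -> probability (measurableTypeR R) R)
  (hmu : forall n : nat, (0 < n)%N ->
    is_cond_dist P (g_sigma_algebra_preimage (W 0))
      (fun w => Sn W g n w / sigma W g n) (mu n)) :
  cvg_in_prob P (fun n w => levy_dist (mu n w) (normal_law 0 lambda)) 0.
Proof.
have g2 : L2 pi g.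
  have gL := hg.1; split; last exact: Lfun2_integrable_sqr.
  by move: gL; rewrite inE => /andP[]; rewrite inE.
(* The smoothed limit theorem covers all events of the past up to time 0, in particular those
   generated by W_0. *)
apply: (levy_cvg_in_prob (preimage_sigma W 0) _ hlambda _ hmu) => [A /(preimage_sub_past (lexx 0))|n|a dl e dl0 e0].
- exact: past_measurable.
- by apply: measurable_funM => //; exact: L2_measurable (L2_Sn hstat g2 n).
- have [N HN] := smoothed_conditional_clt hmarkov hstat hrev g2 hell hlambda hC hvar hL hlind a dl0 e0.
  by exists N => n /HN {}HN A FA; apply: HN; exact: (preimage_sub_past (lexx 0)).
Qed.
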